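(* Let $g_1,\dots,g_N$ be distinct functions in $L^2(\mathbb{R})$ and let $\Lambda_1,\dots,\Lambda_N\subset\mathbb{R}^2$ all be uniformly discrete. \begin{enumerate} \item If $\bigcup_{n=1}^N G(g_n,\Lambda_n)$ is a Riesz sequence in $L^2(\mathbb{R})$, then $D^+(\{\Lambda_n\})\le 1$. \item If $\bigcup_{n=1}^N G(g_n,\Lambda_n)$ is a frame in $L^2(\mathbb{R})$, then $D^-(\{\Lambda_n\})\ge 1$. \end{enumerate}
   Context: For $g\in L^2(\mathbb{R})$ and $(a,b)\in\mathbb{R}^2$ put $g_{ab}(t)=e^{2\pi i b t}g(t-a)$. The Gabor system is $G(g,\Lambda)=\{g_{\lambda\mu}\}_{(\lambda,\mu)\in\Lambda}$. $Q_{(a,b)}(R)=\{(x,y):|x-a|\le R,\ |y-b|\le R\}$. A set is uniformly discrete if distinct points are at distance greater than some $\delta>0$. The upper and lower densities of the family are \[ D^{+}(\{\Lambda_n\})=\lim_{R\to\infty}\frac{\max_{(a,b)\in\mathbb{R}^2}\sum_{n=1}^N|\Lambda_n\cap Q_{(a,b)}(R)|}{(2R)^2},\qquad D^{-}(\{\Lambda_n\})=\lim_{R\to\infty}\frac{\min_{(a,b)\in\mathbb{R}^2}\sum_{n=1}^N|\Lambda_n\cap Q_{(a,b)}(R)|}{(2R)^2}. \] These limits exist for uniformly discrete families. Riesz sequence: $A\sum|a_k|^2\le\|\sum a_kf_k\|^2\le B\sum|a_k|^2$ for some $A,B>0$. Frame: $A\|f\|^2\le\sum|\langle f,f_k\rangle|^2\le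 B\|f\|^2$ for some $A,B>0$. *)

(* Defs.v *)
(* over an arbitrary R : realType. *)
From HB Require Import structures.
From mathcomp Require Import all_boot all_order all_algebra.
From mathcomp Require Import finmap.
From mathcomp Require Import all_classical all_reals all_analysis.
From mathcomp Require Import complex.

Set Implicit Arguments.
Unset Strict Implicit.
Unset Printing Implicit Defensive.

Import Order.TTheory GRing.Theory Num.Theory.
Import numFieldNormedType.Exports.
Local Open Scope classical_set_scope.
Local Open Scope ring_scope.
Local Open Scope complex_scope.

Section Gabor.
Variable R : realType.

Local Notation mu := (@lebesgue_measure R).

(* squared modulus of a complex number *)
Definition cabs2 (z : R[i]) : R := (complex.Re z) ^+ 2 + (complex.Im z) ^+ 2.

(* e^{i theta} *)
Definition expi (th : R) : R[i] := cos th +i* sin th.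

(* f belongs to L^2(R): measurable (real and imaginary parts) and square integrable *)
Definition L2 (f : R -> R[i]) : Prop :=
  [/\ measurable_fun setT (fun x => complex.Re (f x)),
      measurable_fun setT (fun x => complex.Im (f x)) &
      (\int[mu]_x (cabs2 (f x))%:E < +oo)%E].

(* ||f||^2 *)
Definition norm2 (f : R -> R[i]) : R := Rintegral mu setT (fun x => cabs2 (f x)).

(* |<f,h>|^2 where <f,h> = \int f conj(h) *)
Definition ip_abs2 (f h : R -> R[i]) : R :=
  (Rintegral mu setT (fun x => complex.Re (f x * (h x)^*))) ^+ 2 +
  (Rintegral mu setT (fun x => complex.Im (f x * (h x)^*))) ^+ 2.

(* time-frequency shift g_{ab}(t) = e^{2 pi i b t} g(t - a) *)
Definition tfshift (g : R -> R[i]) (a b : R) : R -> R[i] :=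
  fun t => expi (2 * pi * b * t) * g (t - a).

(* the family f indexed by the index set D is a Riesz sequence in L^2(R):
   the Riesz inequalities hold for all finitely supported coefficient sequences *)
Definition riesz_seq (I : choiceType) (D : set I) (f : I -> R -> R[i]) : Prop :=
  exists A B : R, [/\ 0 < A, 0 < B &
    forall (s : seq I) (c : I -> R[i]), uniq s -> {subset s <= D} ->
      A * (\sum_(k <- s) cabs2 (c k))
        <= norm2 (fun t => \sum_(k <- s) c k * f k t)
        <= B * (\sum_(k <- s) cabs2 (c k))].

(* the family f indexed by D is a frame for L^2(R) *)
Definition frame (I : choiceType) (D : set I) (f : I -> R -> R[i]) : Prop :=
  exists A B : R, [/\ 0 < A, 0 < B &
    forall h : R -> R[i], L2 h ->
      ((A * norm2 h)%:E <= \esum_(k in D) (ip_abs2 h (f k))%:E)%E /\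
      (\esum_(k in D) (ip_abs2 h (f k))%:E <= (B * norm2 h)%:E)%E].

(* uniformly discrete subset of R^2 (Euclidean distance) *)
Definition unif_discrete (L : set (R * R)) : Prop :=
  exists2 d : R, 0 < d & forall p q, L p -> L q -> p <> q ->
    d < Num.sqrt ((p.1 - q.1) ^+ 2 + (p.2 - q.2) ^+ 2).

(* the square Q_{(a,b)}(r) *)
Definition square (a b r : R) : set (R * R) :=
  [set p | `|p.1 - a| <= r /\ `|p.2 - b| <= r].

(* \sum_n |Lambda_n \cap Q_{(a,b)}(r)| *)
Definition count_sq (N : nat) (L : 'I_N -> set (R * R)) (a b r : R) : R :=
  (\sum_(n < N) #|` fset_set (L n `&` square a b r)|%fset)%:R.

(* max / min over (a,b) (attained for uniformly discrete families), as sup / inf *)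
Definition Dplus (N : nat) (L : 'I_N -> set (R * R)) : R :=
  lim ((sup [set count_sq L ab.1 ab.2 r | ab in [set: R * R]] / (2 * r) ^+ 2)
         @[r --> +oo]).

Definition Dminus (N : nat) (L : 'I_N -> set (R * R)) : R :=
  lim ((inf [set count_sq L ab.1 ab.2 r | ab in [set: R * R]] / (2 * r) ^+ 2)
         @[r --> +oo]).

(* the union of the Gabor systems G(g_n, Lambda_n), as a family indexed by
   the pairs (n, lambda) with lambda in Lambda_n *)
Definition gabor_index (N : nat) (L : 'I_N -> set (R * R)) : set ('I_N * (R * R)) :=
  [set k | L k.1 k.2].

Definition gabor_family (N : nat) (g : 'I_N -> R -> R[i]) :
    'I_N * (R * R) -> R -> R[i] :=
  fun k => tfshift (g k.1) k.2.1 k.2.2.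

End Gabor.

(* Main.v *)
(* Both halves are instances of one comparison.  Let u_1, ..., u_n have lower
   Riesz bound A1, let (f_k) have lower frame bound A2, and fix m indices K0.
   The coefficient vectors c in C^n for which h = sum c_i u_i is orthogonal to
   all f_k, k in K0, form a space of dimension at least n - m, and for those
     A1 A2 |c|^2 <= A2 |h|^2 <= sum_(k notin K0) |<h, f_k>|^2.
   Summing over an orthonormal family of such c gives
     A1 A2 (n - m) <= sum_i sum_(k notin K0) |<u_i, f_k>|^2,
   so n (1 - e) <= m as soon as every inner tail is at most A1 A2 e.

   The given Gabor system is compared with the time-frequency shifts of the
   window w(t) = t^2 (1 - t)^2 on [0, 1], both restricted to squares whose radii
   differ by a constant r.  Along (1 - 2 eta) Z x Z these shifts form a frame
   (Parseval on [0, 1]), along Z x (1 - 2 eta)^-1 Z a Riesz sequence, and both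
   lattices have density close to 1.  The tails are uniformly small for r large
   because the shifts of w along any d-separated set satisfy a Bessel inequality
   whose constant depends on d only. *)

Require Import Defs.
From HB Require Import structures.
From mathcomp Require Import all_boot all_order all_algebra.
From mathcomp Require Import finmap.
From mathcomp Require Import all_classical all_reals all_analysis.
From mathcomp Require Import measurable_realfun.
From mathcomp Require Import complex spectral.
From mathcomp Require Import ring lra zify.
Import Order.TTheory GRing.Theory Num.Theory.
Import numFieldNormedType.Exports.
Local Open Scope classical_set_scope.
Local Open Scope ring_scope.

Set Implicit Arguments.
Unset Strict Implicit.
Unset Printing Implicit Defensive.

(** * Square-integrable complex functions *)

Section SquareIntegrable.
Variable R : realType.
Local Notation mu := (@lebesgue_measure R).
Local Notation "x +i* y" := (Complex x y) : ring_scope.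
Local Notation "x %:C" := (real_complex _ x) : ring_scope.
Implicit Types (f g h : R -> R[i]) (u v : R -> R) (z w : R[i]).

(** The [g n] are arbitrary in L^2, so their own Gram matrices carry no decay. Every tail is
    therefore brought to one form: a fixed [g n] paired with shifts of the window along a separated
    set. In the frame half this uses the symmetry of |<f, h>| and the fact that only the difference
    of two shifts counts: the window at z meets [g n] shifted by lambda as [g n] meets the window at
    z - lambda. Regularity is asked of the window alone: vanishing to second order at 0 and 1, it
    has second differences O(s^2), so its Gram entries decay like 1 / (1 + b^2) and can be summed
    over separated sets.

    For [eta] = 0 both lattices become Z x Z, where the window fails because all its integer
    translates vanish at the integers. Hence a margin [eta], whose cost disappears in the limit.

    Both densities are [lim]s, with default value 0 when no limit exists. This is harmless for an
    upper bound by 1 and fatal for a lower bound by 1, so the lower density needs a proof of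
    convergence. *)

Lemma ReD z w : complex.Re (z + w) = complex.Re z + complex.Re w.
Proof. by case: z w => ? ? [? ?]. Qed.
Lemma ImD z w : complex.Im (z + w) = complex.Im z + complex.Im w.
Proof. by case: z w => ? ? [? ?]. Qed.
Lemma ReM z w :
  complex.Re (z * w) = complex.Re z * complex.Re w - complex.Im z * complex.Im w.
Proof. by case: z w => ? ? [? ?]. Qed.
Lemma ImM z w :
  complex.Im (z * w) = complex.Re z * complex.Im w + complex.Im z * complex.Re w.
Proof. by case: z w => ? ? [? ?]. Qed.
Lemma ReJ z : complex.Re (z^*) = complex.Re z. Proof. by case: z. Qed.
Lemma ImJ z : complex.Im (z^*) = - complex.Im z. Proof. by case: z. Qed.

Definition cE := (ReD, ImD, ReM, ImM, ReJ, ImJ).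

Lemma complex_ext z w : complex.Re z = complex.Re w ->
  complex.Im z = complex.Im w -> z = w.
Proof. by case: z w => ? ? [? ?] /= -> ->. Qed.

Lemma cabs2_ge0 z : 0 <= cabs2 z.
Proof. by rewrite addr_ge0 ?sqr_ge0. Qed.

Lemma cabs2M z w : cabs2 (z * w) = cabs2 z * cabs2 w.
Proof. by case: z w => a b [c d]; rewrite /cabs2 /=; ring. Qed.

Lemma cabs2_conj z : cabs2 (z^*) = cabs2 z.
Proof. by rewrite /cabs2 !cE sqrrN. Qed.

Lemma cabs20 : cabs2 (0 : R[i]) = 0.
Proof. by rewrite /cabs2 /= expr0n /= addr0. Qed.

Lemma cabs2_expi x : cabs2 (expi x) = 1 :> R.
Proof. by rewrite /cabs2 /= cos2Dsin2. Qed.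

Lemma expiD x y : expi (x + y) = expi x * expi y :> R[i].
Proof.
rewrite /expi cosD sinD; apply/eqP; rewrite eq_complex /=.
by rewrite eqxx /= addrC.
Qed.

Lemma expiN x : expi (- x) = (expi x)^* :> R[i].
Proof. by apply: complex_ext; rewrite cE /= ?cosN ?sinN. Qed.

Lemma expi0 : expi 0 = 1 :> R[i].
Proof. by rewrite /expi cos0 sin0. Qed.

Lemma conjcM_cabs2 z : z * z^* = (cabs2 z)%:C.
Proof.
by apply: complex_ext; rewrite !cE /= /cabs2; ring.
Qed.

Lemma cabs2D_le z w : cabs2 (z + w) <= 2 * cabs2 z + 2 * cabs2 w.
Proof.
case: z w => a b [c d]; rewrite /cabs2 /=.
have := sqr_ge0 (a - c); have := sqr_ge0 (b - d); lra.
Qed.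

Lemma normr_Re_mul_conj z w : `|complex.Re (z * w^*)| <= cabs2 z + cabs2 w.
Proof.
rewrite !cE; case: z w => a b [c d]; rewrite /cabs2 /= ler_norml.
have := sqr_ge0 (a - c); have := sqr_ge0 (b - d).
have := sqr_ge0 (a + c); have := sqr_ge0 (b + d).
have := sqr_ge0 a; have := sqr_ge0 b; have := sqr_ge0 c; have := sqr_ge0 d.
by move=> *; apply/andP; split; nra.
Qed.

Lemma normr_Im_mul_conj z w : `|complex.Im (z * w^*)| <= cabs2 z + cabs2 w.
Proof.
rewrite !cE; case: z w => a b [c d]; rewrite /cabs2 /= ler_norml.
have := sqr_ge0 (a - d); have := sqr_ge0 (b - c).
have := sqr_ge0 (a + d); have := sqr_ge0 (b + c).
have := sqr_ge0 a; have := sqr_ge0 b; have := sqr_ge0 c; have := sqr_ge0 d.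
by move=> *; apply/andP; split; nra.
Qed.

Definition cmeas f := measurable_fun setT (fun x => complex.Re (f x)) /\
  measurable_fun setT (fun x => complex.Im (f x)).

Definition cintegrable f :=
  mu.-integrable setT (EFin \o (fun x => complex.Re (f x))) /\
  mu.-integrable setT (EFin \o (fun x => complex.Im (f x))).

Definition cint f : R[i] :=
  Rintegral mu setT (fun x => complex.Re (f x)) +i*
  Rintegral mu setT (fun x => complex.Im (f x)).

Definition ip f h : R[i] := cint (fun x => f x * (h x)^*).

Lemma ip_abs2E f h : ip_abs2 f h = cabs2 (ip f h).
Proof. by []. Qed.

Lemma cmeasD f g : cmeas f -> cmeas g -> cmeas (fun x => f x + g x).
Proof.
move=> [fr fi] [gr gi]; split.
- by under eq_fun do rewrite ReD; exact: measurable_funD.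
- by under eq_fun do rewrite ImD; exact: measurable_funD.
Qed.

Lemma cmeasM f g : cmeas f -> cmeas g -> cmeas (fun x => f x * g x).
Proof.
move=> [fr fi] [gr gi]; split.
- under eq_fun do rewrite ReM.
  by apply: measurable_funB; exact: measurable_funM.
- under eq_fun do rewrite ImM.
  by apply: measurable_funD; exact: measurable_funM.
Qed.

Lemma cmeas_conj f : cmeas f -> cmeas (fun x => (f x)^*).
Proof.
move=> [fr fi]; split.
- by under eq_fun do rewrite ReJ.
- by under eq_fun do rewrite ImJ; exact: measurableT_comp.
Qed.

Lemma cmeas_cst z : cmeas (fun=> z).
Proof. by split; exact: measurable_cst. Qed.

Lemma cmeas_cabs2 f : cmeas f -> measurable_fun setT (fun x => cabs2 (f x)).
Proof.
move=> [fr fi]; rewrite /cabs2.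
by apply: measurable_funD; exact: measurable_funX.
Qed.

Lemma L2P f : L2 f <->
  cmeas f /\ mu.-integrable setT (EFin \o (fun x => cabs2 (f x))).
Proof.
split=> [[fr fi foo]|[[fr fi] /integrableP[_ foo]]].
  split=> //; apply/integrableP; split.
    by apply/measurable_EFinP; exact: cmeas_cabs2.
  under eq_integral do rewrite /= ger0_norm ?cabs2_ge0//.
  exact: foo.
split=> //; apply: le_lt_trans foo.
rewrite le_eqVlt; apply/orP; left; apply/eqP/eq_integral => x _ /=.
by rewrite ger0_norm ?cabs2_ge0.
Qed.

Lemma L2_cmeas f : L2 f -> cmeas f. Proof. by move/L2P => []. Qed.

Lemma L2_integrable f : L2 f ->
  mu.-integrable setT (EFin \o (fun x => cabs2 (f x))).
Proof. by move/L2P => []. Qed.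

Lemma integrable_le u v : measurable_fun setT u ->
  mu.-integrable setT (EFin \o v) -> (forall x, `|u x| <= v x) ->
  mu.-integrable setT (EFin \o u).
Proof.
move=> mu_u iv uv; apply: le_integrable iv => //.
  exact/measurable_EFinP.
move=> x _ /=; rewrite lee_fin (le_trans (uv x))// ler_norm//.
Qed.

Lemma integrable_linear u v (a b : R) :
  mu.-integrable setT (EFin \o u) -> mu.-integrable setT (EFin \o v) ->
  mu.-integrable setT (EFin \o (fun x => a * u x + b * v x)).
Proof.
move=> iu iv.
have := integrableD measurableT (integrableZl measurableT a iu)
  (integrableZl measurableT b iv).
exact: eq_integrable.
Qed.

Lemma Rintegral_linear u v (a b : R) :
  mu.-integrable setT (EFin \o u) -> mu.-integrable setT (EFin \o v) ->
  Rintegral mu setT (fun x => a * u x + b * v x) =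
  a * Rintegral mu setT u + b * Rintegral mu setT v.
Proof.
move=> iu iv; rewrite RintegralD//.
- by rewrite !RintegralZl.
- exact: (integrableZl measurableT a iu).
- exact: (integrableZl measurableT b iv).
Qed.

Lemma L2D f g : L2 f -> L2 g -> L2 (fun x => f x + g x).
Proof.
move=> /L2P[mf fi] /L2P[mg gi]; apply/L2P; split; first exact: cmeasD.
apply: integrable_le (integrable_linear 2 2 fi gi) _.
  by apply: cmeas_cabs2; exact: cmeasD.
by move=> x; rewrite ger0_norm ?cabs2_ge0// cabs2D_le.
Qed.

Lemma L2M_bounded f g (M : R) : cmeas f -> (forall x, cabs2 (f x) <= M) ->
  L2 g -> L2 (fun x => f x * g x).
Proof.
move=> mf fM /L2P[mg gi]; apply/L2P; split; first exact: cmeasM.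
apply: integrable_le (integrable_linear M 0 gi gi) _.
  by apply: cmeas_cabs2; exact: cmeasM.
move=> x; rewrite ger0_norm ?cabs2_ge0// mul0r addr0 cabs2M.
by rewrite ler_wpM2r ?cabs2_ge0.
Qed.

Lemma L2Z z f : L2 f -> L2 (fun x => z * f x).
Proof. by apply: (@L2M_bounded _ _ (cabs2 z)) => //; exact: cmeas_cst. Qed.

Lemma L20 : L2 (fun=> 0 : R[i]).
Proof.
apply/L2P; split; first exact: cmeas_cst.
apply: eq_integrable (@integrable0 _ _ _ mu setT) => // x _ /=.
by rewrite cabs20.
Qed.

Lemma L2_sum (I : eqType) (s : seq I) (F : I -> R -> R[i]) :
  (forall i, i \in s -> L2 (F i)) -> L2 (fun x => \sum_(i <- s) F i x).
Proof.
elim: s => [|i s IH] sF.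
  by under eq_fun do rewrite big_nil; exact: L20.
under eq_fun do rewrite big_cons; apply: L2D.
  by apply: sF; rewrite mem_head.
by apply: IH => j js; apply: sF; rewrite inE js orbT.
Qed.

Lemma L2_comb (I : eqType) (s : seq I) (c : I -> R[i]) (F : I -> R -> R[i]) :
  (forall i, i \in s -> L2 (F i)) -> L2 (fun x => \sum_(i <- s) c i * F i x).
Proof. by move=> sF; apply: L2_sum => i /sF; exact: L2Z. Qed.

Lemma L2_cintegrable f h : L2 f -> L2 h -> cintegrable (fun x => f x * (h x)^*).
Proof.
move=> /L2P[mf fi] /L2P[mh hi].
have [mr mi] : cmeas (fun x => f x * (h x)^*).
  by apply: cmeasM => //; exact: cmeas_conj.
split; apply: integrable_le (integrable_linear 1 1 fi hi) _ => // x;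
  rewrite !mul1r.
- exact: normr_Re_mul_conj.
- exact: normr_Im_mul_conj.
Qed.

Lemma cintegrableD f g : cintegrable f -> cintegrable g ->
  cintegrable (fun x => f x + g x).
Proof.
move=> [fr fi] [gr gi]; split.
- apply: eq_integrable (integrable_linear 1 1 fr gr) => // x _ /=.
  by rewrite !mul1r ReD.
- apply: eq_integrable (integrable_linear 1 1 fi gi) => // x _ /=.
  by rewrite !mul1r ImD.
Qed.

Lemma cintD f g : cintegrable f -> cintegrable g ->
  cint (fun x => f x + g x) = cint f + cint g.
Proof.
move=> [fr fi] [gr gi]; apply: complex_ext; rewrite ?(ReD, ImD) /=.
- under eq_Rintegral do rewrite ReD.
  by rewrite RintegralD.
- under eq_Rintegral do rewrite ImD.
  by rewrite RintegralD.
Qed.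

Lemma cintZ z f : cintegrable f -> cint (fun x => z * f x) = z * cint f.
Proof.
move=> [fr fi]; apply: complex_ext; rewrite ?(ReM, ImM) /=.
- under eq_Rintegral do rewrite ReM -mulNr.
  by rewrite Rintegral_linear// mulNr.
- under eq_Rintegral do rewrite ImM.
  by rewrite Rintegral_linear.
Qed.

Lemma cint0 : cint (fun=> 0) = 0.
Proof.
by apply: complex_ext => /=; rewrite Rintegral_cst// mul0r.
Qed.

Lemma cintegrable0 : cintegrable (fun=> 0).
Proof. by split; exact: (@integrable0 _ _ _ mu setT). Qed.

Lemma cintegrable_sum (I : eqType) (s : seq I) (F : I -> R -> R[i]) :
  (forall i, i \in s -> cintegrable (F i)) ->
  cintegrable (fun x => \sum_(i <- s) F i x).
Proof.
elim: s => [|i s IH] sF.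
  by under eq_fun do rewrite big_nil; exact: cintegrable0.
under eq_fun do rewrite big_cons; apply: cintegrableD.
  by apply: sF; rewrite mem_head.
by apply: IH => j js; apply: sF; rewrite inE js orbT.
Qed.

Lemma cint_sum (I : eqType) (s : seq I) (F : I -> R -> R[i]) :
  (forall i, i \in s -> cintegrable (F i)) ->
  cint (fun x => \sum_(i <- s) F i x) = \sum_(i <- s) cint (F i).
Proof.
elim: s => [|i s IH] sF.
  by under [in LHS]eq_fun do rewrite big_nil; rewrite cint0 big_nil.
under [in LHS]eq_fun do rewrite big_cons.
rewrite big_cons cintD.
- by rewrite IH// => j js; apply: sF; rewrite inE js orbT.
- by apply: sF; rewrite mem_head.
- by apply: cintegrable_sum => j js; apply: sF; rewrite inE js orbT.
Qed.

Lemma cint_conj f : cintegrable f -> cint (fun x => (f x)^*) = (cint f)^*.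
Proof.
move=> [fr fi]; apply: complex_ext; rewrite ?(ReJ, ImJ) /=.
- by under eq_Rintegral do rewrite ReJ.
- under eq_Rintegral do rewrite ImJ -mulN1r.
  by rewrite RintegralZl// mulN1r.
Qed.

Lemma ip_suml (I : eqType) (s : seq I) (c : I -> R[i]) (F : I -> R -> R[i]) h :
  (forall i, i \in s -> L2 (F i)) -> L2 h ->
  ip (fun x => \sum_(i <- s) c i * F i x) h = \sum_(i <- s) c i * ip (F i) h.
Proof.
move=> sF Lh; rewrite /ip.
under [in LHS]eq_fun do rewrite mulr_suml.
rewrite cint_sum; last first.
  by move=> i /sF Fi; apply: L2_cintegrable => //; exact: L2Z.
apply: eq_big_seq => i /sF Fi.
under eq_fun do rewrite -mulrA.
by rewrite cintZ//; exact: L2_cintegrable.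
Qed.

Lemma ip_conj f h : L2 f -> L2 h -> ip h f = (ip f h)^*.
Proof.
move=> Lf Lh; rewrite /ip -cint_conj; last exact: L2_cintegrable.
by congr cint; apply/funext => x; rewrite rmorphM /= conjCK mulrC.
Qed.

Lemma ip_abs2C f h : L2 f -> L2 h -> ip_abs2 h f = ip_abs2 f h.
Proof. by move=> Lf Lh; rewrite !ip_abs2E ip_conj// cabs2_conj. Qed.

Lemma ip_sumr (I : eqType) (s : seq I) (c : I -> R[i]) (F : I -> R -> R[i]) h :
  (forall i, i \in s -> L2 (F i)) -> L2 h ->
  ip h (fun x => \sum_(i <- s) c i * F i x) =
  \sum_(i <- s) (c i)^* * ip h (F i).
Proof.
move=> sF Lh; rewrite ip_conj//; last exact: L2_comb.
rewrite ip_suml// rmorph_sum /=; apply: eq_big_seq => i /sF Fi.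
by rewrite rmorphM /= -ip_conj.
Qed.

Lemma norm2E f : ip f f = (norm2 f)%:C.
Proof.
rewrite /ip; under eq_fun do rewrite conjcM_cabs2.
by apply: complex_ext => //=; rewrite Rintegral_cst// mul0r.
Qed.

Lemma norm2_ge0 f : 0 <= norm2 f.
Proof. by apply: Rintegral_ge0 => x _; exact: cabs2_ge0. Qed.

Lemma norm2_sum (I : eqType) (s : seq I) (c : I -> R[i]) (F : I -> R -> R[i]) :
  (forall i, i \in s -> L2 (F i)) ->
  (norm2 (fun x => \sum_(i <- s) c i * F i x))%:C =
  \sum_(i <- s) \sum_(j <- s) c i * (c j)^* * ip (F i) (F j).
Proof.
move=> sF; have LF := L2_comb c sF.
rewrite -norm2E ip_suml//; apply: eq_big_seq => i /sF Fi.
by rewrite ip_sumr// mulr_sumr; apply: eq_bigr => j _; rewrite mulrA.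
Qed.

Lemma cauchy_schwarz f h : L2 f -> L2 h -> ip_abs2 f h <= norm2 f * norm2 h.
Proof.
move=> Lf Lh; rewrite ip_abs2E.
set z := ip f h.
(* Indexing by [bool] lets [norm2_sum] expand the squared norm of s f + t h. *)
pose F (b : bool) := if b then f else h.
have LF (b : bool) : b \in [:: true; false] -> L2 (F b) by case: b.
have key (s t : R[i]) :
    0 <= cabs2 s * norm2 f + cabs2 t * norm2 h + 2 * complex.Re (s * t^* * z).
  have := norm2_ge0 (fun x => \sum_(b <- [:: true; false])
    (if b then s else t) * F b x).
  have /(congr1 (@complex.Re R)) := norm2_sum (fun b : bool => if b then s else t) LF.
  rewrite /= !big_cons !big_nil /= !addr0 => ->.
  rewrite (norm2E f) (norm2E h) (ip_conj Lf Lh) -/z.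
  rewrite !cE; move: z => [x y]; case: s t => [a b] [c d]; rewrite /cabs2 /=.
  set A := norm2 f; set B := norm2 h => H; lra.
clearbody z; move: z key => [x y] key.
(* If |h| > 0, the optimal combination is |h|^2 f - <f, h> h. If |h| = 0, subtracting a large
   multiple of h would make the squared norm equal to |f|^2 - 2 (|f|^2 + 1) < 0 unless <f, h> =
   0. *)
case: (ltP 0 (norm2 h)) => [h0|h0].
  have := key (norm2 h)%:C (- (x +i* y)).
  rewrite /cabs2 !cE /= => H.
  rewrite -(ler_pM2r h0); nra.
have {h0} h0 : norm2 h = 0 by apply/eqP; rewrite eq_le h0 norm2_ge0.
rewrite h0 mulr0 leNgt; apply/negP => S0.
have := key 1 (- ((norm2 f + 1) / cabs2 (x +i* y))%:C * (x +i* y)).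
rewrite h0 mulr0 addr0 !cE /= [cabs2 1]/cabs2 /=.
move: S0; rewrite {1}/cabs2 /= => S0.
set k := _ / _.
have kS : k * (x ^+ 2 + y ^+ 2) = norm2 f + 1 by rewrite divfK// gt_eqF.
have := norm2_ge0 f; nra.
Qed.

Lemma norm2D_le f g : L2 f -> L2 g ->
  norm2 (fun x => f x + g x) <= 2 * norm2 f + 2 * norm2 g.
Proof.
move=> Lf Lg; rewrite /norm2 -Rintegral_linear; try exact: L2_integrable.
apply: le_Rintegral => //.
- by apply: L2_integrable; exact: L2D.
- by apply: integrable_linear; exact: L2_integrable.
- by move=> x _; exact: cabs2D_le.
Qed.

End SquareIntegrable.

(** * Riesz sequences against frames *)

Section Comparison.
Local Open Scope sesquilinear_scope.
Variable R : realType.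
Local Notation "x +i* y" := (Complex x y) : ring_scope.
Local Notation "x %:C" := (real_complex _ x) : ring_scope.

Lemma adjoint_mul_cV (p : nat) (x : 'cV[R[i]]_p) :
  (x ^t* *m x) 0 0 = (\sum_j cabs2 (x j 0))%:C.
Proof.
rewrite mxE raddf_sum /=; apply: eq_bigr => j _.
by rewrite !mxE mulrC conjcM_cabs2.
Qed.

Lemma adjointB (p q : nat) (A B : 'M[R[i]]_(p, q)) :
  (A - B) ^t* = A ^t* - B ^t*.
Proof. by apply/matrixP => i j; rewrite !mxE rmorphB. Qed.

Lemma adjointM (p q r : nat) (A : 'M[R[i]]_(p, q)) (B : 'M[R[i]]_(q, r)) :
  (A *m B) ^t* = B ^t* *m A ^t*.
Proof. by rewrite trmx_mul map_mxM. Qed.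

(** For rectangular [K], [unitarymx] says that the rows are orthonormal. The squared length of l -
    K^* K l equals |l|^2 - |K l|^2, and it is nonnegative. *)
Lemma unitary_bessel (p n : nat) (K : 'M[R[i]]_(p, n)) (l : 'cV[R[i]]_n) :
  K \is unitarymx ->
  \sum_i cabs2 ((K *m l) i 0) <= \sum_j cabs2 (l j 0).
Proof.
move=> /unitarymxP KK; pose v := K *m l; rewrite -/v.
have tK : (K ^t*) ^t* = K by rewrite trmxCK.
have := adjoint_mul_cV (l - K ^t* *m v).
have -> : (l - K ^t* *m v) ^t* *m (l - K ^t* *m v) = l ^t* *m l - v ^t* *m v.
  rewrite adjointB adjointM tK.
  rewrite mulmxBl !mulmxBr !mulmxA.
  have -> : l ^t* *m K ^t* = v ^t* by rewrite /v adjointM.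
  by rewrite -(mulmxA (v ^t*) K (K ^t*)) KK mulmx1 -mulmxA -/v
    subrr subr0.
have subE (A B : 'M[R[i]]_1) : (A - B) 0 0 = A 0 0 - B 0 0 by rewrite !mxE.
rewrite subE !adjoint_mul_cV => /(congr1 (@complex.Re R)) /= H.
rewrite -subr_ge0 H sumr_ge0// => j _; exact: cabs2_ge0.
Qed.

(** Rank-nullity for the row kernel of the matrix [C], followed by Gram-Schmidt. No conjugate
    appears in the kernel condition, because [ip] is linear in its first argument. *)
Lemma kernel_bessel (n m : nat) (C : 'I_n -> 'I_m -> R[i]) :
  exists p (K : 'I_p -> 'I_n -> R[i]), [/\ (n <= p + m)%N,
    forall i, \sum_j cabs2 (K i j) = 1,
    forall i k, \sum_j K i j * C j k = 0 &
    forall l : 'I_n -> R[i],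
      \sum_i cabs2 (\sum_j K i j * l j) <= \sum_j cabs2 (l j)].
Proof.
pose M := \matrix_(j, k) C j k.
pose p := \rank (kermx M); pose K := schmidt (row_base (kermx M)).
have pn : (p <= n)%N by exact: rank_leq_row.
have uK : K \is unitarymx by exact: schmidt_unitarymx.
exists p, (fun i j => K i j); split.
- rewrite /p mxrank_ker addnC -leq_subLR leq_sub2l//.
  exact: rank_leq_col.
- move=> i; have /unitarymxP/matrixP/(_ i i) := uK.
  rewrite !mxE eqxx => /(congr1 (@complex.Re R)) /= <-.
  rewrite (raddf_sum (@complex.Re R : {additive _ -> _})).
  apply: eq_bigr => j _.
  by rewrite !mxE conjcM_cabs2.
- move=> i k.
  have /sub_kermxP/matrixP/(_ i k) : (K <= kermx M)%MS.
    by rewrite eqmx_schmidt_free ?row_base_free// eq_row_base.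
  by rewrite !mxE => E; rewrite -[RHS]E; apply: eq_bigr => j _; rewrite mxE.
- move=> l; have := unitary_bessel (\col_j l j) uK.
  under eq_bigr do rewrite mxE.
  under [in X in _ <= X -> _]eq_bigr do rewrite mxE.
  by under eq_bigr do under eq_bigr do rewrite mxE.
Qed.

Lemma esum_le_uniq (K : choiceType) (D : set K) (F : K -> R) (e : R) :
  (forall Y : seq K, uniq Y -> {subset Y <= D} -> \sum_(k <- Y) F k <= e) ->
  (\esum_(k in D) (F k)%:E <= e%:E)%E.
Proof.
move=> FY; rewrite /esum; apply: ge_ereal_sup => _ [X [finX XD] <-].
rewrite fsbig_finite//= sumEFin lee_fin; apply: FY; first exact: fset_uniq.
by move=> k; rewrite in_fset_set// !inE => /XD.
Qed.

Lemma esum_ge_uniq (K : choiceType) (D : set K) (F : K -> R) (Y : seq K) :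
  uniq Y -> {subset Y <= D} ->
  ((\sum_(k <- Y) F k)%:E <= \esum_(k in D) (F k)%:E)%E.
Proof.
move=> uY YD; apply: esum_ge; exists [set` Y].
  by split=> // k /= /YD; rewrite inE.
by rewrite -fsbig_seq// sumEFin.
Qed.

(* A coefficient vector [c] killed by the pairings of the [u i] with [f k],
   [k] in [K0], gives [h = \sum c_i u_i] whose frame coefficients live outside
   [K0].  An orthonormal family of at least [n - size K0] such vectors exists,
   and summing over it costs, by Bessel's inequality in C^n, at most the sum
   of the tails of the [u i]. *)
Lemma riesz_frame_comparison (n : nat) (u : 'I_n -> R -> R[i]) (K : choiceType)
    (D : set K) (f : K -> R -> R[i]) (K0 : seq K) (A1 A2 eps : R) :
  (forall j, L2 (u j)) -> (forall k, L2 (f k)) -> 0 < A1 -> 0 < A2 ->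
  (forall c : 'I_n -> R[i], A1 * (\sum_j cabs2 (c j)) <=
     norm2 (fun t => \sum_j c j * u j t)) ->
  (forall h, L2 h ->
     ((A2 * norm2 h)%:E <= \esum_(k in D) (ip_abs2 h (f k))%:E)%E) ->
  (forall j,
     (\esum_(k in D `\` [set` K0]) (ip_abs2 (u j) (f k))%:E <= eps%:E)%E) ->
  A1 * A2 * (n%:R - (size K0)%:R) <= eps * n%:R.
Proof.
move=> Lu Lf A10 A20 riesz fr tail.
have [p [c [np c1 cK bessel]]] := kernel_bessel
  (fun (j : 'I_n) (k : 'I_(size K0)) => ip (u j) (f (tnth (in_tuple K0) k))).
pose h i t := \sum_j c i j * u j t.
have Lh i : L2 (h i) by apply: L2_comb => j _.
have iph i k : ip (h i) (f k) = \sum_j c i j * ip (u j) (f k).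
  by rewrite /h ip_suml.
have step i : ((A1 * A2)%:E <=
    \esum_(k in D `\` [set` K0]) (ip_abs2 (h i) (f k))%:E)%E.
  apply: (@le_trans _ _ (A2 * norm2 (h i))%:E).
    have := riesz (c i); rewrite c1 mulr1 lee_fin => H.
    by rewrite mulrC ler_wpM2l// ltW.
  apply: le_trans (fr _ (Lh i)) _.
  rewrite (esumID [set` K0]); last first.
    by move=> k _; rewrite lee_fin ip_abs2E cabs2_ge0.
  rewrite esum1 ?add0e// => k [_ /= kK0].
  have /tnthP[l ->] : k \in in_tuple K0 by [].
  by rewrite ip_abs2E iph cK cabs20.
have total : (\sum_(i < p) (A1 * A2)%:E <= (eps * n%:R)%:E)%E.
  apply: (@le_trans _ _ (\sum_(i < p)
      \esum_(k in D `\` [set` K0]) (ip_abs2 (h i) (f k))%:E)%E).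
    by apply: lee_sum => i _; exact: step.
  rewrite -esum_sum; last by move=> *; rewrite lee_fin ip_abs2E cabs2_ge0.
  apply: (@le_trans _ _ (\esum_(k in D `\` [set` K0])
      \sum_(j < n) (ip_abs2 (u j) (f k))%:E)%E).
    apply: le_esum => k _; rewrite !sumEFin lee_fin.
    under eq_bigr do rewrite ip_abs2E iph.
    exact: bessel.
  rewrite esum_sum; last by move=> *; rewrite lee_fin ip_abs2E cabs2_ge0.
  apply: (@le_trans _ _ (\sum_(j < n) eps%:E)%E); first by apply: lee_sum.
  by rewrite sumEFin sumr_const card_ord mulr_natr.
apply: (@le_trans _ _ (A1 * A2 * p%:R)).
  apply: ler_wpM2l; first by rewrite mulr_ge0 ?ltW.
  by rewrite lerBlDr -natrD ler_nat.
by rewrite mulr_natr; move: total; rewrite sumEFin lee_fin sumr_const card_ord.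
Qed.

End Comparison.

(** * Time-frequency shifts *)

Section Translation.
Variable R : realType.
Local Notation mu := (@lebesgue_measure R).
Implicit Types (f g h : R -> R[i]) (u : R -> R).

Lemma measurable_shift (a : R) :
  measurable_fun setT ((fun x => x + a) : measurableTypeR R -> measurableTypeR R).
Proof. by apply: measurable_funD => //; exact: measurable_cst. Qed.

(** Uniqueness of Lebesgue measure: the translated measure gives the same length to half-open
    intervals. *)
Lemma lebesgue_measure_shift (a : R) (A : set (measurableTypeR R)) :
  measurable A ->
  pushforward mu ((fun x => x + a) : measurableTypeR R -> measurableTypeR R) A
  = mu A.
Proof.
move=> mA.
pose shmix := isMeasurableFun.Build _ _ _ _ _ (measurable_shift a).
pose sh : {mfun measurableTypeR R >-> measurableTypeR R} := HB.pack
  ((fun x => x + a) : measurableTypeR R -> measurableTypeR R) shmix.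
apply/esym; apply: (@lebesgue_measure_unique _ (pushforward mu sh)) => // X.
move=> [[x y] _ <-].
transitivity (mu `]x - a, y - a]%classic); last first.
  congr (mu _); apply/seteqP.
  by split=> t /=; rewrite !in_itv /= ltrBlDr lerBrDr.
rewrite /= !lebesgue_measure_itv /= !lte_fin ltrD2r.
by case: ifP => // _; rewrite -!EFinB; congr (_%:E); ring.
Qed.

Lemma integral_shift (F : R -> \bar R) (a : R) : measurable_fun setT F ->
  (forall x, 0 <= F x)%E ->
  (\int[mu]_x F (x + a)%R = \int[mu]_x F x)%E.
Proof.
move=> mF F0.
have <- := @ge0_integral_pushforward _ _ _ _ _ _ (measurable_shift a) mu setT F
  measurableT mF (fun x _ => F0 x).
apply: eq_measure_integral; first exact: measurable_shift.
by move=> ? A mA _; exact: lebesgue_measure_shift.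
Qed.

Lemma integrable_shift u (a : R) : mu.-integrable setT (EFin \o u) ->
  mu.-integrable setT (EFin \o (fun x => u (x + a))).
Proof.
move=> /integrableP[mf foo]; apply/integrableP; split.
  exact: (measurableT_comp mf (measurable_shift a)).
rewrite (integral_shift (F := fun x => `|(u x)%:E|%E))//.
exact: measurableT_comp.
Qed.

Lemma Rintegral_shift u (a : R) : mu.-integrable setT (EFin \o u) ->
  Rintegral mu setT (fun x => u (x + a)) = Rintegral mu setT u.
Proof.
move=> iu; rewrite /Rintegral; congr fine.
have mu_ : measurable_fun setT (EFin \o u) by case/integrableP : iu.
have <- := @integral_pushforward _ _ _ _ _ _ (measurable_shift a) mu setT
  (EFin \o u) mu_ (integrable_shift a iu) measurableT.
apply: eq_measure_integral; first exact: measurable_shift.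
by move=> ? A mA _; exact: lebesgue_measure_shift.
Qed.

Lemma cint_shift f (a : R) : cintegrable f -> cint (fun x => f (x + a)) = cint f.
Proof.
by move=> [fr fi]; apply: complex_ext; rewrite /= (Rintegral_shift _ fr, Rintegral_shift _ fi).
Qed.

Lemma cmeas_shift f (a : R) : cmeas f -> cmeas (fun x => f (x + a)).
Proof.
by move=> [fr fi]; split; [exact: (measurableT_comp fr (measurable_shift a))|
  exact: (measurableT_comp fi (measurable_shift a))].
Qed.

Lemma L2_shift f (a : R) : L2 f -> L2 (fun x => f (x + a)).
Proof.
move=> /L2P[mf fi]; apply/L2P; split; first exact: cmeas_shift.
exact: (integrable_shift a fi).
Qed.

Lemma cmeas_expi (b : R) : cmeas (fun t => expi (b * t)).
Proof.
have mb : measurable_fun setT (fun t : R => b * t).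
  by apply: measurable_funM => //; exact: measurable_cst.
split.
- exact: (measurableT_comp (continuous_measurable_fun (@continuous_cos R)) mb).
- exact: (measurableT_comp (continuous_measurable_fun (@continuous_sin R)) mb).
Qed.

Lemma L2_modulation f (b : R) : L2 f -> L2 (fun t => expi (b * t) * f t).
Proof.
apply: (@L2M_bounded _ _ _ 1); first exact: cmeas_expi.
by move=> x; rewrite cabs2_expi.
Qed.

Lemma L2_tfshift f (a b : R) : L2 f -> L2 (tfshift f a b).
Proof. by move=> Lf; apply: L2_modulation; exact: L2_shift. Qed.

(* Only the relative time-frequency shift matters, up to a unimodular factor. *)
Lemma ip_tfshift f h (a b a' b' : R) : L2 f -> L2 h ->
  ip_abs2 (tfshift f a b) (tfshift h a' b') = ip_abs2 f (tfshift h (a' - a) (b' - b)).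
Proof.
move=> Lf Lh; rewrite !ip_abs2E.
have Lfh := L2_cintegrable (L2_tfshift a b Lf) (L2_tfshift a' b' Lh).
rewrite {1}/ip -(cint_shift a Lfh).
have -> : (fun x => tfshift f a b (x + a) * (tfshift h a' b' (x + a))^*) =
  (fun x => expi (2 * pi * (b - b') * a) *
    (f x * (tfshift h (a' - a) (b' - b) x)^*)).
  apply/funext => x; rewrite /tfshift addrK !rmorphM /=.
  rewrite (_ : x - (a' - a) = x + a - a'); last by ring.
  rewrite -!expiN mulrACA -expiD [f x * (_ * _)]mulrCA [RHS]mulrA -expiD.
  by congr (expi _ * _); ring.
rewrite cintZ; last by apply: L2_cintegrable => //; exact: L2_tfshift.
by rewrite cabs2M cabs2_expi mul1r.
Qed.

End Translation.

(** * Separated sets *)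

Section Packing.
Variable R : realType.

Lemma sum_uniq_subset (T : eqType) (s t : seq T) (F : T -> R) :
  uniq s -> uniq t -> {subset s <= t} -> (forall x, 0 <= F x) ->
  \sum_(x <- s) F x <= \sum_(x <- t) F x.
Proof.
move=> us ut st F0.
have P : perm_eq [seq x <- t | x \in s] s.
  apply: uniq_perm; rewrite ?filter_uniq// => x.
  by rewrite mem_filter; case: (boolP (x \in s)) => // /st ->.
rewrite -(perm_big _ (permEl (perm_filterC [in s] t))).
by rewrite big_cat /= (perm_big _ P) lerDl sumr_ge0.
Qed.

(** The decay obtained from one second difference. It is summable over Z, so products of two weights
    are summable over Z x Z. *)
Definition weight (x : R) : R := (1 + x ^+ 2)^-1.

Lemma weight_gt0 x : 0 < weight x.
Proof. by rewrite invr_gt0 ltr_pwDl ?sqr_ge0. Qed.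

Lemma weight_ge x (r : R) : `|x| <= r -> (1 + r ^+ 2)^-1 <= weight x.
Proof.
move=> xr; rewrite lef_pV2 ?posrE ?ltr_pwDl ?sqr_ge0//.
by rewrite lerD2l -(real_normK (num_real x)) lerXn2r ?nnegrE// (le_trans _ xr).
Qed.

(** Enumerates Z as 0, -1, 1, -2, 2, ..., so that the code of m is at most 2 |m|. *)
Definition int_code (m : int) : nat :=
  match m with Posz n => n.*2 | Negz n => n.*2.+1 end.

Lemma int_code_inj : injective int_code.
Proof.
move=> [m|m] [n|n] /= /eqP; rewrite ?eqSS ?(inj_eq double_inj).
- by move=> /eqP ->.
- by move=> /eqP /(congr1 odd) /=; rewrite !odd_double.
- by move=> /eqP /(congr1 odd) /=; rewrite !odd_double.
- by move=> /eqP ->.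
Qed.

(** Equals 1/(e+1) - 1/(e+2), so its sums telescope. *)
Definition nat_weight (e : nat) : R := (e.+1%:R * e.+2%:R)^-1.

Lemma nat_weight_gt0 e : 0 < nat_weight e.
Proof. by rewrite invr_gt0 mulr_gt0. Qed.

(** With e <= 2x and x = |m|, (e+1)(e+2) <= 4x^2 + 6x + 2, and 6x <= 3 + 3x^2 brings this below 10
    (1 + x^2). *)
Lemma weight_int_code (m : int) : weight m%:~R <= 10 * nat_weight (int_code m).
Proof.
have [x [x0 E ex]] : exists x : R, [/\ 0 <= x, (m%:~R : R) ^+ 2 = x ^+ 2 &
    (int_code m)%:R <= 2 * x].
  case: m => n /=.
    by exists n%:R; split=> //; rewrite -mul2n natrM.
  exists n.+1%:R; split=> //; first by rewrite NegzE mulrNz sqrrN.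
  by rewrite -natrM ler_nat mul2n doubleS ltnW.
rewrite /weight E /nat_weight; set e := int_code m in ex *.
rewrite ler_pdivlMr ?mulr_gt0// mulrC ler_pdivrMr ?ltr_pwDl ?sqr_ge0//.
rewrite -!natr1; have e0 : 0 <= e%:R :> R by [].
have h1 : 0 <= (2 * x - e%:R) * x by rewrite mulr_ge0// subr_ge0.
have h2 : 0 <= (2 * x - e%:R) * e%:R by rewrite mulr_ge0// subr_ge0.
have := sqr_ge0 (x - 1); move: h1 h2; nra.
Qed.

Lemma sum_nat_weight n : \sum_(e < n) nat_weight e <= 1.
Proof.
suff -> : \sum_(e < n) nat_weight e = 1 - n.+1%:R^-1.
  by rewrite gerBl invr_ge0.
elim: n => [|n IH]; first by rewrite big_ord0 invr1 subrr.
rewrite big_ord_recr /= IH /nat_weight.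
have a0 : n.+1%:R != 0 :> R by rewrite pnatr_eq0.
have b0 : n.+2%:R != 0 :> R by rewrite pnatr_eq0.
have E : n.+2%:R = n.+1%:R + 1 :> R by rewrite natr1.
rewrite E in b0 *; move: a0 b0; set a := n.+1%:R => a0 b0.
by field; rewrite nat1r -/a a0 b0.
Qed.

(** The codes of the points lie in a box [0, M)^2, over which the sum factors into two telescoping
    sums, each at most 1. The factor 10 lost in each coordinate gives 100. *)
Lemma sum_weight_int2 (s : seq (int * int)) : uniq s ->
  \sum_(p <- s) weight p.1%:~R * weight p.2%:~R <= 100.
Proof.
move=> us.
pose c (p : int * int) := (int_code p.1, int_code p.2).
have c_inj : injective c.
  by move=> [a b] [a' b'] [/int_code_inj -> /int_code_inj ->].
pose w (q : nat * nat) := nat_weight q.1 * nat_weight q.2.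
have w0 q : 0 <= w q by rewrite mulr_ge0 ?ltW ?nat_weight_gt0.
apply: (@le_trans _ _ (100 * \sum_(p <- s) w (c p))).
  rewrite mulr_sumr; apply: ler_sum => p _.
  have := ler_pM (ltW (weight_gt0 _)) (ltW (weight_gt0 _))
    (weight_int_code p.1) (weight_int_code p.2).
  by move=> /le_trans; apply; rewrite /w /= mulrACA; apply: ler_wpM2r; [exact: (w0 (c p))|lra].
rewrite -[leRHS]mulr1 ler_pM2l// -(big_map c predT w).
pose M := (\max_(p <- s) maxn (c p).1 (c p).2).+1.
have cM p : p \in s -> ((c p).1 < M)%N && ((c p).2 < M)%N.
  move=> ps; rewrite !ltnS -geq_max.
  exact: (leq_bigmax_seq (F := fun p => maxn (c p).1 (c p).2)).
apply: (@le_trans _ _ (\sum_(q <- [seq (i, j) | i <- iota 0 M, j <- iota 0 M]) w q)).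
  apply: sum_uniq_subset => //; first by rewrite map_inj_uniq.
    by apply: allpairs_uniq; rewrite ?iota_uniq// => -[? ?] [? ?].
  move=> q /mapP[p /cM /andP[p1 p2] ->].
  by apply/allpairsP; exists (c p); rewrite !mem_iota.
rewrite big_allpairs_dep /=.
under eq_bigr do rewrite /w /= -mulr_sumr.
rewrite -mulr_suml.
have E : \sum_(i <- iota 0 M) nat_weight i = \sum_(i < M) nat_weight i.
  by rewrite -(big_mkord predT nat_weight) /index_iota subn0.
rewrite E; have := sum_nat_weight M.
have : 0 <= \sum_(i < M) nat_weight i.
  by rewrite sumr_ge0// => i _; rewrite ltW ?nat_weight_gt0.
move=> *; nra.
Qed.

(** The finite counterpart of uniform discreteness: infinite sums are reached only through finite
    subfamilies, with constants depending on [d] alone. *)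
Definition separated (d : R) (Y : seq (R * R)) : Prop :=
  uniq Y /\ forall p q, p \in Y -> q \in Y -> p != q ->
    d ^+ 2 < (p.1 - q.1) ^+ 2 + (p.2 - q.2) ^+ 2.

(** For m = floor (x / s), |m s| <= |x| + s, hence s^2 (1 + m^2) <= 3 s^2 + 2 x^2 <= 3 (1 + x^2)
    since s <= 1. *)
Lemma weight_floor (s x : R) : 0 < s -> s <= 1 ->
  weight x <= 3 / s ^+ 2 * weight (Num.floor (x / s))%:~R.
Proof.
move=> s0 s1; set m := (Num.floor _)%:~R : R.
have [l u] : m <= x / s /\ x / s < m + 1.
  split; first exact: floor_le.
  by have := floorD1_gt (x / s); rewrite intrD1.
move: l u; rewrite ler_pdivlMr// ltr_pdivrMr// => l u.
rewrite /weight ler_pdivlMr ?ltr_pwDl ?sqr_ge0//.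
rewrite mulrC ler_pdivrMr ?ltr_pwDl ?sqr_ge0//.
rewrite mulrAC ler_pdivlMr ?exprn_gt0//.
have h1 : `|m * s| <= `|x| + s.
  have := ler_norm x; have := ler_norm (- x); rewrite normrN ler_norml => *.
  apply/andP; split; nra.
have : (m * s) ^+ 2 <= (`|x| + s) ^+ 2.
  by rewrite -(real_normK (num_real (m * s))) lerXn2r ?nnegrE// addr_ge0// ltW.
rewrite sqrrD real_normK ?num_real//.
have := sqr_ge0 (`|x| - s); rewrite sqrrB real_normK ?num_real//.
have := sqr_ge0 x.
rewrite exprMn; nra.
Qed.

(* Points in distinct cells of a mesh finer than the separation: the sum is
   compared with its integer analogue. *)
Lemma packing (d : R) : 0 < d -> d <= 1 -> exists2 K, 0 < K &
  forall Y a b, separated d Y ->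
    \sum_(p <- Y) weight (p.1 - a) * weight (p.2 - b) <= K.
Proof.
(* Two points in one cell of side d/2 are at squared distance at most d^2 / 2, so no cell holds two
   points of [Y]. *)
move=> d0 d1; pose s := d / 2.
have s0 : 0 < s by rewrite divr_gt0.
have s1 : s <= 1 by rewrite ler_pdivrMr//; lra.
pose k := 3 / s ^+ 2.
have k0 : 0 < k by rewrite divr_gt0 ?exprn_gt0.
exists (k ^+ 2 * 100); first by rewrite mulr_gt0 ?exprn_gt0.
move=> Y a b [uY sY].
pose c (p : R * R) : int * int :=
  (Num.floor ((p.1 - a) / s), Num.floor ((p.2 - b) / s)).
have close (x y : R) : Num.floor (x / s) = Num.floor (y / s) -> (x - y) ^+ 2 <= s ^+ 2.
  move=> E; have := floor_le (x / s); have := floorD1_gt (x / s).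
  have := floor_le (y / s); have := floorD1_gt (y / s).
  rewrite E intrD1; set m := _%:~R.
  rewrite !ler_pdivlMr// !ltr_pdivrMr// => *.
  rewrite -(real_normK (num_real (x - y))) lerXn2r ?nnegrE ?(ltW s0)//.
  by rewrite ler_norml; apply/andP; split; nra.
have c_inj : {in Y &, injective c}.
  move=> p q pY qY [E1 E2]; apply/eqP; apply: contraT => pq.
  have := sY _ _ pY qY pq; have := close _ _ E1; have := close _ _ E2.
  have -> : p.1 - a - (q.1 - a) = p.1 - q.1 by ring.
  have -> : p.2 - b - (q.2 - b) = p.2 - q.2 by ring.
  have -> : d = 2 * s by rewrite mulrC divfK.
  by move=> *; nra.
have ucY : uniq (map c Y) by rewrite map_inj_in_uniq.
have := sum_weight_int2 ucY; rewrite big_map.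
rewrite -(ler_pM2l (exprn_gt0 2 k0)) => /(le_trans _); apply.
rewrite mulr_sumr; apply: ler_sum => p _.
have := ler_pM (ltW (weight_gt0 _)) (ltW (weight_gt0 _))
  (weight_floor (p.1 - a) s0 s1) (weight_floor (p.2 - b) s0 s1).
by rewrite mulrACA.
Qed.

End Packing.

(** * The window and its Gram matrix *)

Section Window.
Variable R : realType.
Local Notation mu := (@lebesgue_measure R).
Local Notation "x +i* y" := (Complex x y) : ring_scope.
Local Notation "x %:C" := (real_complex _ x) : ring_scope.

(** The truncated square x_+^2: it vanishes on a half-line, yet its second differences of step s are
    at most 2 s^2. *)
Definition ramp2 (x : R) : R := (Num.max 0 x) ^+ 2.

Lemma ramp2_le0 x : x <= 0 -> ramp2 x = 0.
Proof. by move=> x0; rewrite /ramp2 max_l// expr0n. Qed.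

Lemma ramp2_ge0 x : 0 <= x -> ramp2 x = x ^+ 2.
Proof. by move=> x0; rewrite /ramp2 max_r. Qed.

Lemma measurable_ramp2 (f : R -> R) : measurable_fun setT f ->
  measurable_fun setT (fun x => ramp2 (f x)).
Proof.
move=> mf; apply: measurable_funX; apply: measurable_maxr => //.
Qed.

(** The slope grows with x, so this bound is local: |2x + s| and |2x - s| are at most 5 for |x| <= 2
    and s <= 1. *)
Lemma ramp2_diff1 x s : 0 <= s -> `|x| <= 2 -> s <= 1 ->
  `|ramp2 (x + s) - ramp2 x| <= 5 * s /\ `|ramp2 (x - s) - ramp2 x| <= 5 * s.
Proof.
move=> s0; rewrite !ler_norml => /andP[x1 x2] s1.
by split; apply/andP;
  case: (lerP 0 x) => x0; rewrite ?(ramp2_ge0 x0) ?(ramp2_le0 (ltW x0));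
  (case: (lerP 0 (x + s)) => y0; rewrite ?(ramp2_ge0 y0) ?(ramp2_le0 (ltW y0)));
  (case: (lerP 0 (x - s)) => z0; rewrite ?(ramp2_ge0 z0) ?(ramp2_le0 (ltW z0)));
  split; nra.
Qed.

Lemma ramp2_diff2 x s : 0 <= s ->
  `|ramp2 (x + s) + ramp2 (x - s) - 2 * ramp2 x| <= 2 * s ^+ 2.
Proof.
move=> s0; rewrite !ler_norml.
by apply/andP;
  case: (lerP 0 x) => x0; rewrite ?(ramp2_ge0 x0) ?(ramp2_le0 (ltW x0));
  (case: (lerP 0 (x + s)) => y0; rewrite ?(ramp2_ge0 y0) ?(ramp2_le0 (ltW y0)));
  (case: (lerP 0 (x - s)) => z0; rewrite ?(ramp2_ge0 z0) ?(ramp2_le0 (ltW z0)));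
  split; nra.
Qed.

(** A discrete Leibniz rule. Being about numbers, it serves both for the two ramps inside [bump] and
    for [bump] times its translate. *)
Lemma diff2M (u u1 u2 v v1 v2 s M N D E S T : R) : 0 <= s -> s <= 1 ->
  0 <= D -> 0 <= E ->
  `|u| <= M -> `|v| <= N ->
  `|u1 - u| <= D * s -> `|u2 - u| <= D * s ->
  `|v1 - v| <= E * s -> `|v2 - v| <= E * s ->
  `|u1 + u2 - 2 * u| <= S * s ^+ 2 -> `|v1 + v2 - 2 * v| <= T * s ^+ 2 ->
  [/\ `|u1 * v1 - u * v| <= (D * (N + E) + M * E) * s,
      `|u2 * v2 - u * v| <= (D * (N + E) + M * E) * s &
      `|u1 * v1 + u2 * v2 - 2 * (u * v)| <=
         (M * T + N * S + 2 * (D * E)) * s ^+ 2].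
Proof.
move=> s0 s1 D0 E0 uM vN u1D u2D v1E v2E uS vT.
have M0 := le_trans (normr_ge0 _) uM; have N0 := le_trans (normr_ge0 _) vN.
have lip w z : `|w - u| <= D * s -> `|z - v| <= E * s ->
    `|w * z - u * v| <= (D * (N + E) + M * E) * s.
  move=> wD zE.
  have -> : w * z - u * v = (w - u) * z + u * (z - v) by ring.
  apply: le_trans (ler_normD _ _) _; rewrite !normrM.
  have zN : `|z| <= N + E.
    have -> : z = v + (z - v) by ring.
    apply: le_trans (ler_normD _ _) _; apply: lerD => //.
    by apply: le_trans zE _; rewrite ler_piMr.
  have h1 := ler_pM (normr_ge0 _) (normr_ge0 _) wD zN.
  have h2 := ler_pM (normr_ge0 _) (normr_ge0 _) uM zE.
  lra.
split; [exact: lip|exact: lip|].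
have -> : u1 * v1 + u2 * v2 - 2 * (u * v) =
  u * (v1 + v2 - 2 * v) + v * (u1 + u2 - 2 * u) +
  (u1 - u) * (v1 - v) + (u2 - u) * (v2 - v) by ring.
have h1 := ler_pM (normr_ge0 _) (normr_ge0 _) uM vT.
have h2 := ler_pM (normr_ge0 _) (normr_ge0 _) vN uS.
have h3 := ler_pM (normr_ge0 _) (normr_ge0 _) u1D v1E.
have h4 := ler_pM (normr_ge0 _) (normr_ge0 _) u2D v2E.
rewrite -!normrM in h1 h2 h3 h4.
set a := u * (v1 + v2 - 2 * v) in h1 *; set b := v * (u1 + u2 - 2 * u) in h2 *.
set c := (u1 - u) * (v1 - v) in h3 *; set d := (u2 - u) * (v2 - v) in h4 *.
have := ler_normD (a + b + c) d; have := ler_normD (a + b) c.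
have := ler_normD a b; lra.
Qed.

(* Equal to [t^2 (1 - t)^2] on [0, 1] and to 0 elsewhere. *)
Definition bump (t : R) : R := ramp2 t * ramp2 (1 - t).

Lemma bump_le0 t : t <= 0 -> bump t = 0.
Proof. by move=> t0; rewrite /bump ramp2_le0// mul0r. Qed.

Lemma bump_ge1 t : 1 <= t -> bump t = 0.
Proof. by move=> t1; rewrite /bump (@ramp2_le0 (1 - t)) ?mulr0// subr_le0. Qed.

Lemma bumpE t : 0 <= t <= 1 -> bump t = (t * (1 - t)) ^+ 2.
Proof.
by move=> /andP[t0 t1]; rewrite /bump !ramp2_ge0 ?exprMn// subr_ge0.
Qed.

Lemma bump_ge0 t : 0 <= bump t.
Proof. by rewrite mulr_ge0 ?sqr_ge0. Qed.

Lemma bump_le1 t : bump t <= 1.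
Proof.
case: (lerP t 0) => t0; first by rewrite bump_le0.
case: (lerP 1 t) => t1; first by rewrite bump_ge1.
rewrite bumpE ?(ltW t0) ?(ltW t1)//.
by rewrite -[leRHS](expr1n _ 2) lerXn2r ?nnegrE//; nra.
Qed.

Lemma bump_lower (eta t : R) : 0 < eta -> eta <= t <= 1 - eta ->
  (eta ^+ 2) ^+ 2 <= bump t.
Proof.
move=> e0 /andP[t0 t1]; rewrite bumpE; last first.
  by apply/andP; split; [exact: (le_trans (ltW e0) t0)|lra].
by rewrite lerXn2r ?nnegrE ?sqr_ge0//; nra.
Qed.

Lemma measurable_bump (f : R -> R) : measurable_fun setT f ->
  measurable_fun setT (fun x => bump (f x)).
Proof.
move=> mf; apply: measurable_funM; first exact: measurable_ramp2.
by apply: measurable_ramp2; apply: measurable_funB.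
Qed.

Lemma bump_diff : exists D S, [/\ 0 <= D, 0 <= S & forall t s, 0 <= s -> s <= 1 ->
  [/\ `|bump (t + s) - bump t| <= D * s, `|bump (t - s) - bump t| <= D * s &
      `|bump (t + s) + bump (t - s) - 2 * bump t| <= S * s ^+ 2]].
Proof.
(* The constants of [diff2M] for M = N = 4, D = E = 5 and S = T = 2. Outside ]-1, 2[ a step of size
   at most 1 never reaches the support, and all differences vanish. *)
exists (5 * (4 + 5) + 4 * 5), (4 * 2 + 4 * 2 + 2 * (5 * 5)); split; try lra.
move=> t s s0 s1.
case: (lerP t (-1)) => tl.
  rewrite !bump_le0; try lra.
  by rewrite !subr0 !mulr0 !addr0 subr0 normr0; split; rewrite ?mulr_ge0 ?sqr_ge0//; lra.
case: (lerP 2 t) => tu.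
  rewrite !bump_ge1; try lra.
  by rewrite !subr0 !mulr0 !addr0 subr0 normr0; split; rewrite ?mulr_ge0 ?sqr_ge0//; lra.
have t2 : `|t| <= 2 by rewrite ler_norml; apply/andP; split; lra.
have t3 : `|1 - t| <= 2 by rewrite ler_norml; apply/andP; split; lra.
have [d1 d2] := ramp2_diff1 s0 t2 s1; have [e1 e2] := ramp2_diff1 s0 t3 s1.
have d3 := ramp2_diff2 t s0; have e3 := ramp2_diff2 (1 - t) s0.
have E1 : 1 - (t + s) = 1 - t - s by ring.
have E2 : 1 - (t - s) = 1 - t + s by ring.
rewrite /bump E1 E2.
have bnd x : `|x| <= 2 -> `|ramp2 x| <= 4.
  move=> x2; rewrite ger0_norm ?sqr_ge0//.
  case: (lerP x 0) => x0; first by rewrite ramp2_le0.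
  rewrite (ramp2_ge0 (ltW x0)); move: x2; rewrite ler_norml => /andP[_ ?]; nra.
by apply: diff2M => //; rewrite ?bnd// [_ (1 - t - s) + _]addrC.
Qed.

Definition window (t : R) : R[i] := (bump t)%:C.

Lemma integrable_unit_box (u : R -> R) (a b M : R) : measurable_fun setT u ->
  (forall t, `|u t| <= M) -> (forall t, t < a -> u t = 0) ->
  (forall t, b < t -> u t = 0) -> a <= b ->
  mu.-integrable setT (EFin \o u) /\ `|Rintegral mu setT u| <= M * (b - a).
Proof.
move=> mu_ uM ua ub ab.
have iI := integrable_indic_itv a b true false.
have iv := integrableZl measurableT M iI.
have uv t : `|u t| <= M * \1_(`[a, b]%classic : set R) t.
  rewrite indicE; case: (boolP (t \in _)) => [_|].
    by rewrite mulr1.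
  rewrite notin_setE /= in_itv /= => /negP; rewrite negb_and -!ltNge.
  by move=> /orP[/ua ->|/ub ->]; rewrite normr0 mulr0.
have iu : mu.-integrable setT (EFin \o u) by apply: integrable_le uv.
split=> //.
apply: le_trans (le_normr_Rintegral measurableT iu) _.
apply: (@le_trans _ _ (Rintegral mu setT (fun t => M * \1_(`[a, b]%classic : set R) t))).
  apply: le_Rintegral => //.
  exact: integrable_norm.
rewrite RintegralZl// /Rintegral integral_indic// setIT /= lebesgue_measure_itv /= lte_fin.
case: ltP => [_|ba]; first by rewrite -EFinB.
by rewrite (@le_anti _ _ a b) ?ab// subrr.
Qed.

Lemma L2_window : L2 window.
Proof.
have mb : measurable_fun setT bump by exact: measurable_bump.
apply/L2P; split.
  by split => //=; exact: measurable_cst.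
rewrite /window /cabs2 /=.
have [] // := @integrable_unit_box (fun x => bump x ^+ 2 + 0 ^+ 2) 0 1 1 _ _ _ _ ler01.
- by apply: measurable_funD => //; exact: measurable_funX.
- move=> t; rewrite expr0n addr0 ger0_norm ?sqr_ge0//.
  by rewrite -[leRHS](expr1n _ 2) lerXn2r ?nnegrE ?bump_ge0 ?bump_le1.
- by move=> t /ltW t0; rewrite bump_le0// expr0n addr0.
- by move=> t /ltW t0; rewrite bump_ge1// expr0n addr0.
Qed.

Lemma integrableM_bounded (u v : R -> R) : mu.-integrable setT (EFin \o u) ->
  measurable_fun setT v -> (forall t, `|v t| <= 1) ->
  mu.-integrable setT (EFin \o (fun t => u t * v t)).
Proof.
move=> iu mv v1.
have mu_ : measurable_fun setT u by apply/measurable_EFinP; case/integrableP : iu.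
apply: integrable_le (integrable_norm iu) _ => //; first exact: measurable_funM.
by move=> t /=; rewrite normrM ler_piMr.
Qed.

(* Translating by the half-period [s] of [v] flips its sign; this trades the
   two integrations by parts for a second difference. *)
Lemma Rintegral_antiperiodic (u v : R -> R) (s : R) :
  mu.-integrable setT (EFin \o u) ->
  measurable_fun setT v -> (forall t, `|v t| <= 1) ->
  (forall t, v (t + s) = - v t) ->
  Rintegral mu setT (fun t => (u (t + s) + u (t - s) - 2 * u t) * v t) =
  - 4 * Rintegral mu setT (fun t => u t * v t).
Proof.
move=> iu mv v1 vs.
have iuv := integrableM_bounded iu mv v1.
have ip := integrableM_bounded (integrable_shift s iu) mv v1.
have im := integrableM_bounded (integrable_shift (- s) iu) mv v1.
have Ep : Rintegral mu setT (fun t => u (t + s) * v t) =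
    - Rintegral mu setT (fun t => u t * v t).
  have iw := integrable_shift s iuv.
  have := Rintegral_linear (-1) 0 iw iw.
  rewrite (Rintegral_shift s iuv) mul0r addr0 mulN1r => <-.
  by apply: eq_Rintegral => t _; rewrite vs; ring.
have Em : Rintegral mu setT (fun t => u (t - s) * v t) =
    - Rintegral mu setT (fun t => u t * v t).
  have iw := integrable_shift (- s) iuv.
  have := Rintegral_linear (-1) 0 iw iw.
  rewrite (Rintegral_shift (- s) iuv) mul0r addr0 mulN1r => <-.
  apply: eq_Rintegral => t _; have := vs (t - s); rewrite subrK => ->; ring.
transitivity (Rintegral mu setT (fun t => 1 * (1 * (u (t + s) * v t) + 1 * (u (t - s) * v t))
   + (- 2) * (u t * v t))).
  by apply: eq_Rintegral => t _; ring.
rewrite Rintegral_linear//; last exact: integrable_linear.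
rewrite Rintegral_linear// Ep Em; ring.
Qed.

End Window.

(** * Decay of the Gram matrix of the window *)

Section HomogeneousApproximation.
Variable R : realType.
Local Notation mu := (@lebesgue_measure R).
Local Notation "x +i* y" := (Complex x y) : ring_scope.
Local Notation "x %:C" := (real_complex _ x) : ring_scope.
Local Notation window := (@window R).

Lemma bump_pair (a t : R) : t < 0 \/ 1 < t -> bump t * bump (t - a) = 0.
Proof.
by case=> /ltW t0; [rewrite bump_le0|rewrite bump_ge1]; rewrite ?mul0r.
Qed.

Lemma bump_pair_le1 (a t : R) : `|bump t * bump (t - a)| <= 1.
Proof.
rewrite ger0_norm; last by rewrite mulr_ge0 ?bump_ge0.
rewrite -[leRHS]mulr1.
by apply: ler_pM; rewrite ?bump_ge0 ?bump_le1.
Qed.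

Lemma measurable_bump_pair (a : R) :
  measurable_fun setT (fun t : R => bump t * bump (t - a)).
Proof.
by apply: measurable_funM; apply: measurable_bump => //; exact: measurable_funB.
Qed.

(** Up to the factor -4, the integral is one of a second difference of the product of the bumps
    against [v]. That difference is O(s^2), uniformly in [a], and lives on [-1, 2]. *)
Lemma bump_pair_oscillation : exists2 C : R, 0 < C & forall (a s : R) (v : R -> R),
  0 < s -> s <= 1 -> measurable_fun setT v -> (forall t, `|v t| <= 1) ->
  (forall t, v (t + s) = - v t) ->
  `|Rintegral mu setT (fun t => bump t * bump (t - a) * v t)| <= C * s ^+ 2.
Proof.
have [D [S [D0 S0 dS]]] := bump_diff R.
pose S' := 1 * S + 1 * S + 2 * (D * D).
have S'0 : 0 <= S' by rewrite /S'; nra.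
(* The interval [-1, 2] of length 3 and the factor 4 would give 3 S' / 4; adding 1 makes the
   constant positive. *)
exists (S' + 1); first lra.
move=> a s v s0 s1 mv v1 vs.
pose p t := bump t * bump (t - a).
have mp : measurable_fun setT p by exact: measurable_bump_pair.
have [ip _] := integrable_unit_box mp (bump_pair_le1 a)
  (fun t t0 => bump_pair a (or_introl t0)) (fun t t1 => bump_pair a (or_intror t1)) ler01.
have := Rintegral_antiperiodic ip mv v1 vs.
pose q t := p (t + s) + p (t - s) - 2 * p t.
rewrite -/(Rintegral mu setT (fun t => q t * v t)) => E.
have qS t : `|q t| <= S' * s ^+ 2.
  have [h1 h2 h3] := dS t s (ltW s0) s1.
  have [k1 k2 k3] := dS (t - a) s (ltW s0) s1.
  have b1 x : `|bump x| <= 1 :> R by rewrite ger0_norm ?bump_ge0 ?bump_le1.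
  have [_ _] := diff2M (ltW s0) s1 D0 D0 (b1 t) (b1 (t - a)) h1 h2 k1 k2 h3 k3.
  move=> H; rewrite /q /p.
  have -> : t + s - a = t - a + s by ring.
  by have -> : t - s - a = t - a - s by ring.
have mq : measurable_fun setT q.
  apply: measurable_funB; last by apply: measurable_funM.
  by apply: measurable_funD;
    [exact: (measurableT_comp mp (measurable_shift s))|
     exact: (measurableT_comp mp (measurable_shift (- s)))].
have q0 t : t < -1 \/ 2 < t -> q t = 0.
  move=> h; rewrite /q /p !(@bump_pair a); last 3 first.
  - by case: h => h; [left|right]; lra.
  - by case: h => h; [left|right]; lra.
  - by case: h => h; [left|right]; lra.
  by rewrite mulr0 addr0 subr0.
have mqv : measurable_fun setT (fun t => q t * v t) by exact: measurable_funM.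
have qvS t : `|q t * v t| <= S' * s ^+ 2.
  by rewrite normrM; apply: le_trans (qS t); rewrite ler_piMr.
have qv0 t : t < -1 \/ 2 < t -> q t * v t = 0 by move=> /q0 ->; rewrite mul0r.
have m12 : -1 <= 2 :> R by lra.
have [_] := integrable_unit_box mqv qvS (fun t h => qv0 t (or_introl h))
  (fun t h => qv0 t (or_intror h)) m12.
rewrite E normrM normrN (@ger0_norm _ 4)// => H.
have := sqr_ge0 s; rewrite -/p; nra.
Qed.

(** Three regimes. For |a| >= 1 the product of the two bumps vanishes. For |b| >= 1/2 the
    half-period s = 1 / (2 |b|) is at most 1 and the oscillation bound applies. Otherwise both
    weights are at least 1/2 and the trivial bound 1 suffices. *)
Lemma window_gram : exists2 C : R, 0 < C & forall a b : R,
  ip_abs2 window (tfshift window a b) <= (C * (weight a * weight b)) ^+ 2.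
Proof.
have [C C0 osc] := bump_pair_oscillation.
exists (20 * (C + 1)); first lra.
move=> a b.
(* One argument for the cosine and the sine part: |s b| = 1/2 says that [s] is a half-period up to
   sign. The factor 20 leaves room for adding the two squares. *)
suff main (v : R -> R) : measurable_fun setT v -> (forall t, `|v t| <= 1) ->
   (forall s, `|s * b| = 2^-1 -> forall t, v (t + s) = - v t) ->
   `|Rintegral mu setT (fun t => bump t * bump (t - a) * v t)| <=
      10 * (C + 1) * (weight a * weight b).
  have mb : measurable_fun setT (fun t : R => 2 * pi * b * t).
    by apply: measurable_funM.
  have anti (s t : R) : `|s * b| = 2^-1 ->
      cos (2 * pi * b * (t + s)) = - cos (2 * pi * b * t) /\
      sin (2 * pi * b * (t + s)) = - sin (2 * pi * b * t).
    rewrite mulrDr => sb.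
    have [|] := lerP 0 (s * b) => s0.
      move: sb; rewrite ger0_norm// => sb.
      have -> : 2 * pi * b * s = pi by rewrite -mulrA [b * s]mulrC sb; field.
      by rewrite cosDpi sinDpi.
    move: sb; rewrite ltr0_norm// => sb.
    have -> : 2 * pi * b * s = - pi.
      by rewrite -[RHS]mul1r -mulrA [b * s]mulrC -[s * b]opprK sb; field.
    split.
      by rewrite -[in RHS](subrK pi (2 * pi * b * t)) cosDpi opprK.
    by rewrite -[in RHS](subrK pi (2 * pi * b * t)) sinDpi opprK.
  have Hc := main (fun t => cos (2 * pi * b * t)).
  have Hs := main (fun t => - sin (2 * pi * b * t)).
  rewrite /ip_abs2.
  under eq_Rintegral => t _.
    rewrite (_ : complex.Re _ = bump t * bump (t - a) * cos (2 * pi * b * t)); last first.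
      by rewrite /tfshift /window !cE /=; ring.
    over.
  under [X in _ + X ^+ 2]eq_Rintegral => t _.
    rewrite (_ : complex.Im _ = bump t * bump (t - a) * - sin (2 * pi * b * t)); last first.
      by rewrite /tfshift /window !cE /=; ring.
    over.
  set W := weight a * weight b in Hc Hs *.
  have W0 : 0 < W by rewrite mulr_gt0 ?weight_gt0.
  have {}Hc := Hc (measurableT_comp (continuous_measurable_fun (@continuous_cos R)) mb)
    (fun t => cos_max _) (fun s sb t => (anti s t sb).1).
  set x := Rintegral _ _ _ in Hc *; set y := Rintegral _ _ _ in Hs *.
  have ms : measurable_fun setT (fun t => - sin (2 * pi * b * t)).
    apply: measurable_funN.
    exact: (measurableT_comp (continuous_measurable_fun (@continuous_sin R)) mb).
  have {}Hs := Hs ms (fun t => ltac:(rewrite normrN; exact: sin_max))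
    (fun s sb t => ltac:(by rewrite (anti s t sb).2)).
  have K0 : 0 <= 10 * (C + 1) * W by apply: mulr_ge0; lra.
  have x2 : x ^+ 2 <= (10 * (C + 1) * W) ^+ 2.
    by rewrite -(real_normK (num_real x)) lerXn2r ?nnegrE.
  have y2 : y ^+ 2 <= (10 * (C + 1) * W) ^+ 2.
    by rewrite -(real_normK (num_real y)) lerXn2r ?nnegrE.
  rewrite !exprMn in x2 y2 *; have := sqr_ge0 ((C + 1) * W); rewrite exprMn; nra.
move=> mv v1 vs.
have Wa := weight_gt0 a; have Wb := weight_gt0 b.
have [a1|a1] := lerP 1 `|a|.
  rewrite (_ : (fun t => _) = fun=> 0); last first.
    apply/funext => t; rewrite (_ : _ * bump _ = 0) ?mul0r//.
    have [t0|t0] := lerP t 0; first by rewrite bump_le0 ?mul0r.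
    have [t1|t1] := lerP 1 t; first by rewrite bump_ge1 ?mul0r.
    move: a1; rewrite ler_normr => /orP[a1|a1].
      by rewrite (@bump_le0 _ (t - a)) ?mulr0//; lra.
    by rewrite (@bump_ge1 _ (t - a)) ?mulr0//; lra.
  by rewrite Rintegral_cst// mul0r normr0 !mulr_ge0 ?ltW//; lra.
have Wa2 : 2^-1 <= weight a.
  by have := weight_ge (ltW a1); rewrite expr1n.
have [b1|b1] := lerP 2^-1 `|b|.
  have b0 : 0 < `|b| by apply: lt_le_trans b1; lra.
  pose s := (2 * `|b|)^-1.
  have s0 : 0 < s by rewrite invr_gt0; lra.
  have s1 : s <= 1 by rewrite invf_le1; lra.
  have sb : `|s * b| = 2^-1.
    by rewrite normrM (gtr0_norm s0) /s; field; rewrite gt_eqF.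
  have H := osc a s v s0 s1 mv v1 (vs s sb).
  apply: le_trans H _.
  have Wb2 : 5 * weight b >= s ^+ 2.
    rewrite /weight /s exprVn ler_pdivlMr ?ltr_pwDl ?sqr_ge0// mulrC.
    rewrite ler_pdivrMr ?exprn_gt0 ?mulr_gt0// -(real_normK (num_real b)).
    nra.
  have h1 : C * s ^+ 2 <= C * (5 * weight b) by apply: ler_wpM2l => //; exact: ltW.
  have h2 : 2^-1 * ((C + 1) * weight b) <= weight a * ((C + 1) * weight b).
    by apply: ler_wpM2r => //; rewrite mulr_ge0//; lra.
  nra.
have Wb2 : 2^-1 <= weight b.
  have := weight_ge (ltW b1); apply: le_trans; rewrite lef_pV2 ?posrE; lra.
have mpv : measurable_fun setT (fun t => bump t * bump (t - a) * v t).
  by apply: measurable_funM => //; exact: measurable_bump_pair.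
have pv1 t : `|bump t * bump (t - a) * v t| <= 1.
  by rewrite normrM; apply: le_trans (bump_pair_le1 a t); rewrite ler_piMr.
have pv0 t : t < 0 \/ 1 < t -> bump t * bump (t - a) * v t = 0.
  by move=> /bump_pair ->; rewrite mul0r.
have [_ H] := integrable_unit_box mpv pv1 (fun t h => pv0 t (or_introl h))
  (fun t h => pv0 t (or_intror h)) ler01.
apply: le_trans H _.
have h1 : 2^-1 * 2^-1 <= weight a * weight b by apply: ler_pM.
nra.
Qed.

End HomogeneousApproximation.

(** * Homogeneous approximation *)

Section WindowBessel.
Variable R : realType.
Local Notation mu := (@lebesgue_measure R).
Local Notation "x +i* y" := (Complex x y) : ring_scope.
Local Notation "x %:C" := (real_complex _ x) : ring_scope.
Local Notation window := (@window R).

Lemma weightB (x y : R) : weight (x - y) = weight (y - x).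
Proof. by rewrite /weight -sqrrN opprB. Qed.

Lemma Re_sum (I : Type) (s : seq I) (F : I -> R[i]) :
  complex.Re (\sum_(i <- s) F i) = \sum_(i <- s) complex.Re (F i).
Proof. by apply: (big_morph (@complex.Re R)) => // z w; exact: ReD. Qed.

(** The arithmetic-geometric step of the Schur test. Comparing squares keeps everything in terms of
    [cabs2]. *)
Lemma Re_mul3_le (z w G : R[i]) (c : R) : 0 <= c -> cabs2 G <= c ^+ 2 ->
  complex.Re (z * w^* * G) <= (cabs2 z / 2 + cabs2 w / 2) * c.
Proof.
move=> c0 Gc; have zw0 := cabs2_ge0 z; have ww0 := cabs2_ge0 w.
have h : complex.Re (z * w^* * G) ^+ 2 <= ((cabs2 z / 2 + cabs2 w / 2) * c) ^+ 2.
  apply: (@le_trans _ _ (cabs2 (z * w^* * G))).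
    by rewrite /cabs2 lerDl sqr_ge0.
  rewrite !cabs2M cabs2_conj exprMn.
  apply: ler_pM => //; rewrite ?mulr_ge0 ?cabs2_ge0//.
  have := sqr_ge0 (cabs2 z - cabs2 w); nra.
apply: le_trans (ler_norm _) _.
rewrite -(@ler_pXn2r _ 2)// ?nnegrE//; last by rewrite mulr_ge0//; lra.
by rewrite real_normK ?num_real.
Qed.

(* Schur test on the Gram matrix of the shifted windows. *)
Lemma window_bessel (d : R) : 0 < d -> d <= 1 ->
  exists2 C : R, 0 < C & forall f Y, L2 f -> separated d Y ->
    \sum_(w <- Y) ip_abs2 f (tfshift window w.1 w.2) <= C * norm2 f.
Proof.
move=> d0 d1; have [G G0 gram] := window_gram R.
have [K K0 pack] := packing d0 d1.
exists (G * K); first exact: mulr_gt0.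
move=> f Y Lf sY.
pose h (w : R * R) := tfshift window w.1 w.2.
have Lh w : L2 (h w) by apply: L2_tfshift; exact: L2_window.
pose c w := ip f (h w).
pose S := \sum_(w <- Y) cabs2 (c w).
have -> : \sum_(w <- Y) ip_abs2 f (tfshift window w.1 w.2) = S by [].
(* Duality: <f, F> = S, so S^2 <= |f|^2 |F|^2, and |F|^2 <= G K S then leaves S <= G K |f|^2. *)
pose F t := \sum_(w <- Y) c w * h w t.
have LF : L2 F by apply: L2_comb.
have S0 : 0 <= S by rewrite sumr_ge0// => w _; exact: cabs2_ge0.
have fF : ip f F = S%:C.
  rewrite /F ip_sumr// /S rmorph_sum /=; apply: eq_bigr => w _.
  by rewrite -/(c w) mulrC conjcM_cabs2.
have FS : norm2 F <= G * K * S.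
  have -> : norm2 F = complex.Re (\sum_(v <- Y) \sum_(w <- Y)
      c v * (c w)^* * ip (h v) (h w)).
    exact: (congr1 (@complex.Re R) (norm2_sum c (fun w (_ : w \in Y) => Lh w))).
  rewrite Re_sum; under eq_bigr do rewrite Re_sum.
  pose W (v w : R * R) := weight (w.1 - v.1) * weight (w.2 - v.2).
  have W0 v w : 0 <= W v w by rewrite mulr_ge0// ltW ?weight_gt0.
  apply: (@le_trans _ _ (\sum_(v <- Y) \sum_(w <- Y)
      (cabs2 (c v) / 2 * (G * W v w) + cabs2 (c w) / 2 * (G * W v w)))).
    apply: ler_sum => v _; apply: ler_sum => w _; rewrite -mulrDl.
    apply: Re_mul3_le; first by rewrite mulr_ge0// ltW.
    rewrite -ip_abs2E ip_tfshift//; exact: L2_window.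
  have rowsum v : \sum_(w <- Y) W v w <= K by exact: pack.
  under eq_bigr do rewrite big_split /=.
  rewrite big_split /= [X in _ + X]exchange_big /=.
  have half (V : R * R -> R * R -> R) : (forall v, \sum_(w <- Y) V v w <= K) ->
      \sum_(v <- Y) \sum_(w <- Y) cabs2 (c v) / 2 * (G * V v w) <= G * K * S / 2.
    move=> VK.
    have -> : G * K * S / 2 = \sum_(v <- Y) cabs2 (c v) / 2 * (G * K).
      by rewrite -mulr_suml -mulr_suml -/S; ring.
    apply: ler_sum => v _; rewrite -mulr_sumr -mulr_sumr.
    apply: ler_wpM2l; first by rewrite divr_ge0 ?cabs2_ge0.
    by apply: ler_wpM2l; [exact: ltW|exact: VK].
  have := half W rowsum.
  have := half (fun v w => W w v) _.
  have colsum v : \sum_(w <- Y) W w v <= K.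
    apply: le_trans (rowsum v); rewrite le_eqVlt; apply/orP; left; apply/eqP.
    by apply: eq_bigr => w _; rewrite /W weightB [X in _ * X]weightB.
  move=> /(_ colsum); lra.
have := cauchy_schwarz Lf LF; rewrite ip_abs2E fF /cabs2 /= expr0n addr0 => CS.
have nf := norm2_ge0 f.
have [->|Sn0] := eqVneq S 0; first by rewrite mulr_ge0// ltW// mulr_gt0.
have Sp : 0 < S by rewrite lt_def Sn0.
rewrite -(ler_pM2r Sp) -expr2; apply: le_trans CS _.
have := ler_wpM2l nf FS; lra.
Qed.

(** The gap between the two squares has width 1 >= d, so points on opposite sides of it are far
    enough apart. *)
Lemma separated_cat (d r : R) (Y Z : seq (R * R)) : 0 < d -> d <= 1 ->
  separated d Y -> separated d Z ->
  (forall w, w \in Y -> square 0 0 r w) ->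
  (forall w, w \in Z -> ~ square 0 0 (r + 1) w) ->
  separated d (Y ++ Z).
Proof.
move=> d0 d1 [uY sY] [uZ sZ] Yr Zr.
have far p q : p \in Y -> q \in Z -> d ^+ 2 < (p.1 - q.1) ^+ 2 + (p.2 - q.2) ^+ 2.
  move=> /Yr; rewrite /square /= !subr0 => -[p1 p2] /Zr.
  rewrite /square /= !subr0 => /not_andP H.
  have d2 : d ^+ 2 <= 1 by rewrite -(expr1n _ 2) lerXn2r ?nnegrE// ltW.
  have big (x y : R) : `|x| <= r -> ~ `|y| <= r + 1 -> 1 < (x - y) ^+ 2.
    move=> xr /negP; rewrite -ltNge => yr.
    rewrite -(real_normK (num_real (x - y))) -(expr1n _ 2) ltrXn2r ?nnegrE//.
    by have := ler_distD x y 0; rewrite !subr0 (distrC y x); lra.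
  case: H => H; [have := big _ _ p1 H|have := big _ _ p2 H].
    by have := sqr_ge0 (p.2 - q.2); lra.
  by have := sqr_ge0 (p.1 - q.1); lra.
split.
  rewrite cat_uniq uY uZ andbT /=; apply/hasPn => w wZ.
  apply/negP => wY; have := far _ _ wY wZ; rewrite !subrr expr0n addr0.
  by rewrite ltNge sqr_ge0.
move=> p q; rewrite !mem_cat => /orP[pY|pZ] /orP[qY|qZ] pq; first exact: sY.
- exact: far.
- have -> : (p.1 - q.1) ^+ 2 + (p.2 - q.2) ^+ 2 =
    (q.1 - p.1) ^+ 2 + (q.2 - p.2) ^+ 2 by ring.
  exact: far.
- exact: sZ.
Qed.

(* Otherwise infinitely many mutually distant pieces, each of mass [> e], could
   be collected into one separated set, against the uniform Bessel bound. *)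
Lemma homogeneous_approximation (g : R -> R[i]) (d e : R) :
  L2 g -> 0 < d -> d <= 1 -> 0 < e ->
  exists2 r : R, 0 < r & forall Y, separated d Y ->
    (forall w, w \in Y -> ~ square 0 0 r w) ->
    \sum_(w <- Y) ip_abs2 g (tfshift window w.1 w.2) <= e.
Proof.
move=> Lg d0 d1 e0; apply: contrapT => H.
have {}H (r : R) : 0 < r -> exists Y, [/\ separated d Y,
    forall w, w \in Y -> ~ square 0 0 r w &
    e < \sum_(w <- Y) ip_abs2 g (tfshift window w.1 w.2)].
  move=> r0; apply: contrapT => H1; apply: H; exists r => // Y sY Yr.
  rewrite leNgt; apply/negP => eY; apply: H1; by exists Y.
have grow n : exists2 Y, separated d Y &
    n%:R * e <= \sum_(w <- Y) ip_abs2 g (tfshift window w.1 w.2).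
  elim: n => [|n [Y sY nY]].
    by exists [::]; [split|rewrite mul0r big_nil].
  (* The finite set [Y] lies in some square; taking the next piece outside a square larger by 1
     keeps the union separated. *)
  have [r r0 Yr] : exists2 r : R, 0 < r & forall w, w \in Y -> square 0 0 r w.
    elim: Y {sY nY} => [|w Y [r r0 IH]]; first by exists 1.
    exists (r + `|w.1| + `|w.2|); first by rewrite -addrA ltr_pwDl ?addr_ge0.
    move=> v; rewrite inE => /orP[/eqP ->|/IH]; rewrite /square /= !subr0.
      by split; have := normr_ge0 w.1; have := normr_ge0 w.2; lra.
    by move=> [? ?]; split; have := normr_ge0 w.1; have := normr_ge0 w.2; lra.
  have [|Z [sZ Zr eZ]] := H (r + 1); first lra.
  exists (Y ++ Z); first exact: (@separated_cat d r).
  by rewrite big_cat /= -natr1 mulrDl mul1r lerD// ltW.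
have [C C0 bes] := window_bessel d0 d1.
(* Enough pieces for their total mass n e to exceed the Bessel bound C |g|^2. *)
pose n := (Num.truncn (C * norm2 g / e)).+1.
have [Y sY nY] := grow n.
have := le_trans nY (bes _ _ Lg sY); rewrite -ler_pdivlMr//.
by rewrite leNgt /n truncnS_gt.
Qed.

End WindowBessel.

(** * Fourier series on the unit interval *)

Section Exponentials.
Variable R : realType.
Local Notation mu := (@lebesgue_measure R).
Local Notation "x +i* y" := (Complex x y) : ring_scope.
Local Notation "x %:C" := (real_complex _ x) : ring_scope.

Lemma expi_int (n : int) : expi (2 * pi * n%:~R) = 1 :> R[i].
Proof.
have nat_case (k : nat) : expi (2 * pi * k%:R) = 1 :> R[i].
  elim: k => [|k IH]; first by rewrite mulr0 expi0.
  rewrite -[k.+1%:R]natr1 mulrDr mulr1 expiD IH mul1r /expi mulr_natl cos2pi sin2pi.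
  by apply: complex_ext.
case: n => k; first exact: nat_case.
by rewrite NegzE mulrNz mulrN expiN nat_case rmorph1.
Qed.

Lemma Rintegral_itv_derive (f F : R -> R) (a b : R) : a < b ->
  continuous f -> (forall t : R, is_derive t (1 : R) F (f t)) ->
  Rintegral mu `[a, b] f = F b - F a.
Proof.
move=> ab cf dF; rewrite /Rintegral (@continuous_FTC2 _ f F)//=.
- by apply: continuous_subspaceT.
- have cF : continuous F.
    by move=> x; apply/differentiable_continuous/derivable1_diffP;
      exact: (@ex_derive _ _ _ _ _ _ _ (dF x)).
  split=> //.
  + by apply: cvg_at_right_filter; exact: cF.
  + by apply: cvg_at_left_filter; exact: cF.
- by move=> x _; rewrite derive1E; have [_] := dF x.
Qed.

Lemma is_derive_mull (c t : R) : is_derive t (1 : R) (fun t => c * t) c.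
Proof.
have := is_deriveZ c (is_derive_id t (1 : R)).
by rewrite [c *: 1]mulr1.
Qed.

Lemma Rintegral_cos_itv (c a b : R) : c != 0 -> a < b ->
  Rintegral mu `[a, b] (fun t => cos (c * t)) = (sin (c * b) - sin (c * a)) / c.
Proof.
move=> c0 ab.
have cont : continuous (fun t : R => cos (c * t)).
  by move=> x; apply: (@continuous_comp _ _ _ ( *%R c) (@cos R));
    [exact: mulrl_continuous|exact: continuous_cos].
have der (t : R) : is_derive t (1 : R) (fun t => c^-1 * sin (c * t)) (cos (c * t)).
  have -> : cos (c * t) = c^-1 *: (cos (c * t) * c) by rewrite /GRing.scale /=; field.
  apply: is_deriveZ; apply: (is_derive1_comp (f := @sin R)).
  exact: is_derive_mull.
by rewrite (Rintegral_itv_derive ab cont der); ring.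
Qed.

Lemma Rintegral_sin_itv (c a b : R) : c != 0 -> a < b ->
  Rintegral mu `[a, b] (fun t => sin (c * t)) = (cos (c * a) - cos (c * b)) / c.
Proof.
move=> c0 ab.
have cont : continuous (fun t : R => sin (c * t)).
  by move=> x; apply: (@continuous_comp _ _ _ ( *%R c) (@sin R));
    [exact: mulrl_continuous|exact: continuous_sin].
have der (t : R) : is_derive t (1 : R) (fun t => - c^-1 * cos (c * t)) (sin (c * t)).
  have -> : sin (c * t) = (- c^-1) *: (- sin (c * t) * c) by rewrite /GRing.scale /=; field.
  apply: is_deriveZ; apply: (is_derive1_comp (f := @cos R)).
  exact: is_derive_mull.
by rewrite (Rintegral_itv_derive ab cont der); ring.
Qed.

Lemma expi_period (m : int) (c a b : R) : c * (b - a) = 2 * pi * m%:~R ->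
  expi (c * b) = expi (c * a) :> R[i].
Proof.
move=> cab; have -> : c * b = 2 * pi * m%:~R + c * a by rewrite -cab; ring.
by rewrite expiD expi_int mul1r.
Qed.

Definition itv_ind (a b : R) (t : R) : R[i] := (\1_(`[a, b]%classic : set R) t)%:C.

Lemma L2_itv_ind (a b : R) : L2 (itv_ind a b).
Proof.
apply/L2P; split.
  by split => //=; exact: measurable_indic.
apply: eq_integrable (integrable_indic_itv a b true false) => // x _ /=.
rewrite /cabs2 /= indicE; case: (_ \in _) => /=; by rewrite ?expr1n expr0n /= addr0.
Qed.

Definition itv_expi (a b c : R) (t : R) : R[i] := expi (c * t) * itv_ind a b t.

Lemma L2_itv_expi (a b c : R) : L2 (itv_expi a b c).
Proof. by apply: L2_modulation; exact: L2_itv_ind. Qed.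

Lemma Rintegral_indic_mul (a b : R) (u : R -> R) :
  Rintegral mu setT (fun t => \1_(`[a, b]%classic : set R) t * u t) = Rintegral mu `[a, b] u.
Proof.
rewrite [RHS]Rintegral_mkcond; apply: eq_Rintegral => t _.
by rewrite patchE indicE; case: ifP => _; rewrite ?mul1r ?mul0r.
Qed.

(** The difference of the frequencies makes [m] full turns over [a, b]; for m <> 0 the primitives
    agree at both ends. *)
Lemma ip_itv_expi (a b c c' : R) (m : int) : a < b -> (c - c') * (b - a) = 2 * pi * m%:~R ->
  ip (itv_expi a b c) (itv_expi a b c') = if m == 0 then (b - a)%:C else 0.
Proof.
move=> ab cm.
have E (t : R) : itv_expi a b c t * (itv_expi a b c' t)^* =
    (\1_(`[a, b]%classic : set R) t)%:C * expi ((c - c') * t).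
  rewrite /itv_expi /itv_ind rmorphM /= -expiN mulrACA -expiD.
  have -> : c * t + - (c' * t) = (c - c') * t by ring.
  rewrite mulrC; congr (_ * _); apply: complex_ext; rewrite !cE /= indicE.
    by case: (_ \in _) => /=; ring.
  by ring.
rewrite /ip /cint; under eq_Rintegral do rewrite E ReM mul0r subr0 /=.
under [X in Complex _ X]eq_Rintegral do rewrite E ImM mul0r addr0 /=.
rewrite !Rintegral_indic_mul.
have [m0|m0] := eqVneq m 0.
  have -> : c - c' = 0.
    have : (c - c') * (b - a) = 0 by rewrite cm m0 mulr0.
    by move=> /eqP; rewrite mulf_eq0 (subr_eq0 b a) [b == a]gt_eqF// orbF => /eqP.
  under eq_Rintegral do rewrite mul0r cos0.
  under [X in Complex _ X]eq_Rintegral do rewrite mul0r sin0.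
  rewrite !Rintegral_cst// mul0r mul1r /= lebesgue_measure_itv /= lte_fin ab.
  by rewrite -EFinB.
have c0 : c - c' != 0.
  apply: contra_neq m0 => c0; move: cm; rewrite c0 mul0r => /esym/eqP.
  by rewrite !mulf_eq0 intr_eq0 pnatr_eq0 /= gt_eqF ?pi_gt0// => /eqP.
have [H1 H2] := (congr1 (@complex.Re R) (expi_period cm),
  congr1 (@complex.Im R) (expi_period cm)).
rewrite /= in H1 H2.
by rewrite Rintegral_cos_itv// Rintegral_sin_itv// H1 H2 !subrr !mul0r.
Qed.

Lemma norm2_itv_expi_comb (I : eqType) (s : seq I) (k : I -> int) (a b c : R)
    (x : I -> R[i]) : uniq s -> {in s &, injective k} -> a < b -> c * (b - a) = 2 * pi ->
  norm2 (fun t => \sum_(i <- s) x i * itv_expi a b (c * (k i)%:~R) t) =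
  (b - a) * \sum_(i <- s) cabs2 (x i).
Proof.
move=> us kI ab cab.
suff : (norm2 (fun t => \sum_(i <- s) x i * itv_expi a b (c * (k i)%:~R) t))%:C =
   ((b - a) * \sum_(i <- s) cabs2 (x i))%:C by move=> /(congr1 (@complex.Re R)).
rewrite norm2_sum; last by move=> i _; exact: L2_itv_expi.
rewrite mulr_sumr rmorph_sum /=; apply: eq_big_seq => i si.
rewrite (bigD1_seq i)//= big1_seq ?addr0.
  rewrite (@ip_itv_expi _ _ _ _ 0)//; last by rewrite subrr mul0r mulr0.
  by rewrite eqxx conjcM_cabs2 mulrC -rmorphM.
move=> j /andP[ji sj].
rewrite (@ip_itv_expi _ _ _ _ (k i - k j))//; last first.
  by rewrite -mulrBr -intrB -cab; ring.
by rewrite subr_eq0 (inj_in_eq kI)// eq_sym (negPf ji) mulr0.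
Qed.

Lemma norm2B (F P : R -> R[i]) : L2 F -> L2 P ->
  norm2 (fun t => F t - P t) = norm2 F + norm2 P - 2 * complex.Re (ip F P).
Proof.
move=> LF LP; rewrite /norm2 /ip /cint /=.
have iF := L2_integrable LF; have iP := L2_integrable LP.
have [iR _] := L2_cintegrable LF LP.
transitivity (Rintegral mu setT (fun t =>
    1 * (1 * cabs2 (F t) + 1 * cabs2 (P t)) + - 2 * complex.Re (F t * (P t)^*))).
  apply: eq_Rintegral => t _; rewrite !cE.
  by case: (F t) (P t) => a b [c d]; rewrite /cabs2 /=; ring.
rewrite Rintegral_linear//; last exact: integrable_linear.
rewrite Rintegral_linear//; ring.
Qed.

(** Completing the square in each coefficient: the orthogonal projection is the best approximation.
    Any approximation at all thus bounds the mass missing from the Fourier coefficients. *)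
Lemma bessel_defect (F : R -> R[i]) (s : seq int) (x : int -> R[i]) :
  L2 F -> uniq s ->
  norm2 F - \sum_(n <- s) ip_abs2 F (itv_expi 0 1 (2 * pi * n%:~R)) <=
  norm2 (fun t => F t - \sum_(n <- s) x n * itv_expi 0 1 (2 * pi * n%:~R) t).
Proof.
move=> LF us; pose e n := itv_expi 0 1 (2 * pi * n%:~R).
have Le n : n \in s -> L2 (e n) by move=> _; exact: L2_itv_expi.
pose P t := \sum_(n <- s) x n * e n t.
have LP : L2 P by exact: L2_comb.
have nP : norm2 P = \sum_(n <- s) cabs2 (x n).
  by rewrite /P (@norm2_itv_expi_comb _ _ id 0 1) ?subr0 ?mul1r ?mulr1.
rewrite (norm2B LF LP) nP /P ip_sumr// Re_sum -addrA lerD2l.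
rewrite mulr_sumr -sumrB -sumrN; apply: ler_sum => n _.
rewrite ip_abs2E -/(e n); case: (x n) (ip F (e n)) => a b [c d].
rewrite !cE /cabs2 /=; have := sqr_ge0 (a - c); have := sqr_ge0 (b - d); nra.
Qed.

End Exponentials.

(** * Approximation by Laurent polynomials in L^2 of [0, 1] *)

Section TrigonometricDensity.
Variable R : realType.
Local Notation mu := (@lebesgue_measure R).
Local Notation "x +i* y" := (Complex x y) : ring_scope.
Local Notation "x %:C" := (real_complex _ x) : ring_scope.
Implicit Types (F G : R -> R[i]) (P Q : {poly R[i]}).

Lemma expi_neq0 (x : R) : expi x != 0 :> R[i].
Proof.
apply/eqP => /(congr1 (@cabs2 R)); rewrite cabs2_expi cabs20 => /eqP.
by rewrite oner_eq0.
Qed.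

Lemma expi_exp (x : R) k : expi x ^+ k = expi (x * k%:R) :> R[i].
Proof.
elim: k => [|k IH]; first by rewrite expr0 mulr0 expi0.
by rewrite exprSr IH -expiD -[k.+1%:R]natr1 mulrDr mulr1.
Qed.

(** A trigonometric polynomial as P(z) / z^k at z = e^{2 pi i t}; sums and products are then
    inherited from the polynomial ring. *)
Definition laurent P (k : nat) (t : R) : R[i] :=
  P.[expi (2 * pi * t)] / expi (2 * pi * t) ^+ k.

Definition is_laurent (p : R -> R[i]) := exists P k, p =1 laurent P k.

Lemma is_laurentD p q : is_laurent p -> is_laurent q ->
  is_laurent (fun t => p t + q t).
Proof.
move=> [P [k pE]] [Q [l qE]]; exists (P * 'X^l + Q * 'X^k), (k + l)%N => t.
rewrite pE qE /laurent !hornerE.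
have z0 := expi_neq0 (2 * pi * t); set z := expi _ in z0 *.
by rewrite exprD; field; rewrite !expf_neq0.
Qed.

Lemma is_laurentM p q : is_laurent p -> is_laurent q ->
  is_laurent (fun t => p t * q t).
Proof.
move=> [P [k pE]] [Q [l qE]]; exists (P * Q), (k + l)%N => t.
by rewrite pE qE /laurent hornerM exprD invfM mulrACA.
Qed.

Lemma is_laurent_cst z : is_laurent (fun=> z).
Proof. by exists z%:P, 0 => t; rewrite /laurent hornerC expr0 divr1. Qed.

Lemma is_laurent_expi : is_laurent (fun t => expi (2 * pi * t)).
Proof. by exists 'X, 0 => t; rewrite /laurent hornerX expr0 divr1. Qed.

Lemma is_laurent_expiN : is_laurent (fun t => expi (- (2 * pi * t))).
Proof.
exists 1, 1 => t; rewrite /laurent hornerC expr1; apply: (mulIf (expi_neq0 (2 * pi * t))).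
by rewrite -expiD addNr expi0 mul1r mulVf ?expi_neq0.
Qed.

Lemma laurent_sum P k t : laurent P k t * itv_ind 0 1 t =
  \sum_(n <- [seq i%:Z - k%:Z | i <- iota 0 (size P)])
     P`_(absz (n + k)) * itv_expi 0 1 (2 * pi * n%:~R) t.
Proof.
rewrite big_map /laurent horner_coef !mulr_suml.
rewrite -(big_mkord predT (fun i => P`_i * expi (2 * pi * t) ^+ i /
   expi (2 * pi * t) ^+ k * itv_ind 0 1 t)) /index_iota subn0.
apply: eq_bigr => i _; rewrite subrK absz_nat -!mulrA; congr (_ * _).
rewrite mulrA; congr (_ * _); rewrite !expi_exp.
apply: (mulIf (expi_neq0 (2 * (pi * t) * k%:R))); rewrite divfK ?expi_neq0//.
by rewrite -expiD; congr expi; rewrite intrB -!pmulrn; ring.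
Qed.

Lemma laurent_index_uniq P (k : nat) :
  uniq [seq i%:Z - k%:Z | i <- iota 0 (size P)].
Proof. by rewrite map_inj_uniq ?iota_uniq// => i j /addIr []. Qed.

Definition trig_dense F := L2 F /\ forall e : R, 0 < e -> exists P k,
  norm2 (fun t => F t - laurent P k t * itv_ind 0 1 t) <= e.

Lemma L2_laurent P k : L2 (fun t => laurent P k t * itv_ind 0 1 t).
Proof.
under eq_fun do rewrite laurent_sum.
by apply: L2_comb => n _; exact: L2_itv_expi.
Qed.

Lemma L2B F G : L2 F -> L2 G -> L2 (fun t => F t - G t).
Proof.
move=> LF /(L2Z (-1)) LG.
rewrite [X in L2 X](_ : _ = (fun t => F t + -1 * G t)); first exact: L2D.
by apply/funext => t; rewrite mulN1r.
Qed.

Lemma trig_dense_laurent p : is_laurent p ->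
  trig_dense (fun t => p t * itv_ind 0 1 t).
Proof.
move=> [P [k pE]]; split.
  by under eq_fun do rewrite pE; exact: L2_laurent.
move=> e e0; exists P, k; under [X in norm2 X]eq_fun do rewrite pE subrr.
by rewrite /norm2; under eq_Rintegral do rewrite cabs20; rewrite Rintegral_cst// mul0r ltW.
Qed.

Lemma trig_dense_lim F : L2 F -> (forall e : R, 0 < e ->
  exists2 G, trig_dense G & norm2 (fun t => F t - G t) <= e) -> trig_dense F.
Proof.
move=> LF FG; split=> // e e0.
(* [norm2D_le] doubles each of the two errors. *)
have e4 : 0 < e / 4 by rewrite divr_gt0.
have [G [LG Gd] nFG] := FG _ e4; have [P [k nG]] := Gd _ e4.
exists P, k; set q := fun t => laurent P k t * itv_ind 0 1 t in nG *.
have Lq : L2 q by exact: L2_laurent.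
have -> : (fun t => F t - q t) = (fun t => (F t - G t) + (G t - q t)).
  by apply/funext => t; rewrite addrA subrK.
have := norm2D_le (L2B LF LG) (L2B LG Lq); lra.
Qed.

Lemma trig_denseD F G : trig_dense F -> trig_dense G ->
  trig_dense (fun t => F t + G t).
Proof.
move=> [LF Fd] [LG Gd]; split; first exact: L2D.
move=> e e0; have e4 : 0 < e / 4 by rewrite divr_gt0.
have [P [k nF]] := Fd _ e4; have [Q [l nG]] := Gd _ e4.
have [S [m SE]] : is_laurent (fun t => laurent P k t + laurent Q l t).
  by apply: is_laurentD; [exists P, k|exists Q, l].
exists S, m.
have -> : (fun t => F t + G t - laurent S m t * itv_ind 0 1 t) =
  (fun t => (F t - laurent P k t * itv_ind 0 1 t) +
            (G t - laurent Q l t * itv_ind 0 1 t)).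
  by apply/funext => t; rewrite -SE; ring.
have := norm2D_le (L2B LF (L2_laurent P k)) (L2B LG (L2_laurent Q l)); lra.
Qed.

Lemma norm2Z z F : L2 F -> norm2 (fun t => z * F t) = cabs2 z * norm2 F.
Proof.
move=> LF; rewrite /norm2 -RintegralZl//; last exact: L2_integrable.
by apply: eq_Rintegral => t _; rewrite cabs2M.
Qed.

Lemma trig_denseZ z F : trig_dense F -> trig_dense (fun t => z * F t).
Proof.
move=> [LF Fd]; split; first exact: L2Z.
move=> e e0; have z0 := cabs2_ge0 z.
have e1 : 0 < e / (cabs2 z + 1) by rewrite divr_gt0// ltr_wpDl.
have [P [k nF]] := Fd _ e1.
have [S [m SE]] : is_laurent (fun t => z * laurent P k t).
  by apply: is_laurentM; [exact: is_laurent_cst|exists P, k].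
exists S, m.
have -> : (fun t => z * F t - laurent S m t * itv_ind 0 1 t) =
  (fun t => z * (F t - laurent P k t * itv_ind 0 1 t)).
  by apply/funext => t; rewrite -SE; ring.
rewrite norm2Z; last by apply: L2B => //; exact: L2_laurent.
move: nF; rewrite ler_pdivlMr ?ltr_wpDl//.
have := norm2_ge0 (fun t => F t - laurent P k t * itv_ind 0 1 t); lra.
Qed.

Lemma trig_dense_sum (I : Type) (s : seq I) (F : I -> R -> R[i]) :
  (forall i, trig_dense (F i)) -> trig_dense (fun t => \sum_(i <- s) F i t).
Proof.
move=> Fd; elim: s => [|i s IH].
  under eq_fun do rewrite big_nil.
  have := trig_dense_laurent (is_laurent_cst 0).
  by under [X in trig_dense X]eq_fun do rewrite mul0r.
by under eq_fun do rewrite big_cons; exact: trig_denseD.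
Qed.

Lemma Rintegral_dominated_cvg0 (u : nat -> R -> R) (g : R -> R) :
  (forall k, measurable_fun setT (u k)) -> mu.-integrable setT (EFin \o g) ->
  (forall k t, 0 <= u k t <= g t) ->
  {ae mu, forall t, u ^~ t @ \oo --> 0} ->
  forall e : R, 0 < e -> exists k, Rintegral mu setT (u k) <= e.
Proof.
move=> mu_ ig ug ucvg e e0.
have mf k : measurable_fun setT (EFin \o u k) by exact/measurable_EFinP.
have m0 : measurable_fun setT (cst 0%E : R -> \bar R) by exact: measurable_cst.
have cv : {ae mu, forall t, setT t -> (fun k => (EFin \o u k) t) @ \oo --> cst 0%E t}.
  have FF := ae_filter_ringOfSetsType mu.
  apply: filterS ucvg => t ut _; apply: cvg_EFin; [exact: nearW|exact: ut].
have dom : {ae mu, forall t, forall k, setT t -> (`|(EFin \o u k) t| <= (EFin \o g) t)%E}.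
  apply: aeW => t k _; rewrite /= lee_fin.
  by have /andP[u0 u1] := ug k t; rewrite ger0_norm.
have [_ _] := @dominated_convergence _ _ _ mu setT measurableT
  _ _ _ mf m0 cv ig dom.
rewrite integral0 => /fine_cvg /cvgr_lt /(_ _ e0)[k _ /(_ k (leqnn _)) ke].
by exists k; exact: ltW.
Qed.

Lemma trig_dense_dominated F (G : nat -> R -> R[i]) (g : R -> R) :
  L2 F -> (forall k, trig_dense (G k)) -> mu.-integrable setT (EFin \o g) ->
  (forall k t, cabs2 (F t - G k t) <= g t) ->
  {ae mu, forall t, (fun k => cabs2 (F t - G k t)) @ \oo --> 0} ->
  trig_dense F.
Proof.
move=> LF Gd ig FGg FG; apply: trig_dense_lim => // e e0.
have mu_ k : measurable_fun setT (fun t => cabs2 (F t - G k t)).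
  by apply: cmeas_cabs2; apply: L2_cmeas; apply: L2B => //; have [] := Gd k.
have ug k t : 0 <= cabs2 (F t - G k t) <= g t by rewrite cabs2_ge0 FGg.
have [k kE] := Rintegral_dominated_cvg0 mu_ ig ug FG e0.
by exists (G k).
Qed.

End TrigonometricDensity.

(** * Indicators of rays as limits of Laurent polynomials *)

Section FourierCompleteness.
Variable R : realType.
Local Notation mu := (@lebesgue_measure R).
Local Notation "x +i* y" := (Complex x y) : ring_scope.
Local Notation "x %:C" := (real_complex _ x) : ring_scope.
Implicit Types (F G : R -> R[i]).

(* Fixes -1, 0 and 1, and its iterates converge to the sign function on [-1, 1]. *)
Definition steepen (y : R) : R := y * (3 - y ^+ 2) / 2.

Lemma iter_steepenN k y : iter k steepen (- y) = - iter k steepen y.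
Proof. by elim: k => //= k ->; rewrite /steepen; ring. Qed.

(** The identity for 1 - [steepen] z shows that a step contracts the distance to 1 by (1 - z)(2 +
    z)/2 <= 1 - z/2. The iterates never fall below [y], so the ratio 1 - y/2 serves at every
    step. *)
Lemma iter_steepen_gt0 k y : 0 < y <= 1 ->
  y <= iter k steepen y <= 1 /\ 1 - iter k steepen y <= (1 - y / 2) ^+ k.
Proof.
move=> /andP[y0 y1]; elim: k => [|k [/andP[z0 z1] IH]] /=.
  by rewrite expr0; split; [apply/andP; split|]; lra.
set z := iter k steepen y in z0 z1 IH *.
have E : 1 - steepen z = (1 - z) * ((1 - z) * (2 + z) / 2).
  by rewrite /steepen; field.
have h0 : 0 <= (1 - z) * (2 + z) / 2 by apply: divr_ge0 => //; apply: mulr_ge0; lra.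
have h1 : (1 - z) * (2 + z) / 2 <= 1 - y / 2 by nra.
split; [apply/andP; split|].
- by apply: le_trans z0 _; rewrite /steepen; nra.
- by rewrite -subr_ge0 E mulr_ge0// subr_ge0.
- rewrite E exprSr; apply: ler_pM => //; lra.
Qed.

Lemma steepen_le1 k y : `|y| <= 1 -> `|iter k steepen y| <= 1.
Proof.
have pos z : 0 < z -> z <= 1 -> `|iter k steepen z| <= 1.
  move=> z0 z1; have [|/andP[h1 h2] _] := @iter_steepen_gt0 k z.
    by apply/andP.
  by rewrite ger0_norm//; apply: le_trans h1; exact: ltW.
rewrite ler_norml => /andP[y1 y2].
have [y0|y0|y0] := ltrgtP 0 y.
- exact: pos.
- by rewrite -(opprK y) iter_steepenN normrN pos// ?oppr_gt0// lerNl.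
- by rewrite -y0 (_ : iter k steepen 0 = 0) ?normr0//;
    elim: k {pos} => //= k ->; rewrite /steepen !mul0r.
Qed.

(** Positive on ]0, x[ and negative on ]x, 1[. Each factor has half-integral frequency, but the
    product is (cos (2 pi t - pi x) - cos (pi x)) / 2. *)
Definition arc (x t : R) : R := sin (pi * t) * sin (pi * (x - t)).

Lemma is_laurent_arc x : is_laurent (fun t => (arc x t)%:C).
Proof.
have -> : (fun t => (arc x t)%:C) = (fun t =>
     expi (2 * pi * t) * ((4^-1)%:C * expi (- (pi * x)))
   + (expi (- (2 * pi * t)) * ((4^-1)%:C * expi (pi * x)) + (- (cos (pi * x) / 2))%:C)).
  apply/funext => t; have -> : 2 * pi * t = pi * t + pi * t by ring.
  have := cos2Dsin2 (pi * t).
  rewrite /arc mulrBr sinB !expiN !expiD.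
  rewrite /expi; set c := cos (pi * t); set s := sin (pi * t).
  set C := cos _; set S := sin _ => cs.
  (* Makes the constant term quadratic in [c] and [s], so that the identity becomes polynomial. *)
  have -> : C / 2 = C * (c ^+ 2 + s ^+ 2) / 2 by rewrite cs mulr1.
  by apply: complex_ext; rewrite !cE /=; field.
apply: is_laurentD.
  by apply: is_laurentM; [exact: is_laurent_expi|exact: is_laurent_cst].
apply: is_laurentD; last exact: is_laurent_cst.
by apply: is_laurentM; [exact: is_laurent_expiN|exact: is_laurent_cst].
Qed.

Lemma is_laurent_steepen (y : R -> R) : is_laurent (fun t => (y t)%:C) ->
  is_laurent (fun t => (steepen (y t))%:C).
Proof.
move=> ly.
have -> : (fun t => (steepen (y t))%:C) =
    (fun t => (y t)%:C * ((3 / 2)%:C + (- 2^-1)%:C * ((y t)%:C * (y t)%:C))).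
  by apply/funext => t; rewrite -!rmorphM -rmorphD -rmorphM /steepen; congr (_%:C); field.
apply: is_laurentM => //; apply: is_laurentD; first exact: is_laurent_cst.
by apply: is_laurentM; [exact: is_laurent_cst|exact: is_laurentM].
Qed.

Lemma is_laurent_iter_steepen k x :
  is_laurent (fun t => (iter k steepen (arc x t))%:C).
Proof.
by elim: k => [|k IH] /=; [exact: is_laurent_arc|exact: is_laurent_steepen].
Qed.

Lemma arc_le1 x t : `|arc x t| <= 1.
Proof.
rewrite normrM -[leRHS]mulr1.
by apply: ler_pM; rewrite ?normr_ge0 ?sin_max.
Qed.

Lemma arc_gt0 x t : 0 < t -> t < x -> x < 1 -> 0 < arc x t.
Proof.
move=> t0 tx x1; have p0 := pi_gt0 R.
by apply: mulr_gt0; apply: sin_gt0_pi; apply/andP; split; nra.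
Qed.

Lemma arc_lt0 x t : 0 <= x -> x < t -> t < 1 -> arc x t < 0.
Proof.
move=> x0 xt t1; have p0 := pi_gt0 R.
rewrite /arc -[x - t]opprB mulrN sinN mulrN oppr_lt0.
by apply: mulr_gt0; apply: sin_gt0_pi; apply/andP; split; nra.
Qed.

Lemma sqr_steep_cvg0 (y : R) : 0 < y <= 1 ->
  (fun k => ((1 - iter k steepen y) / 2) ^+ 2) @ \oo --> 0.
Proof.
move=> y01; have /andP[y0 y1] := y01.
apply: (@squeeze_cvgr _ _ _ _ (cst 0) (fun k => (1 - y / 2) ^+ k)).
- apply: nearW => k /=; have [/andP[h1 h2] h3] := iter_steepen_gt0 k y01.
  by rewrite sqr_ge0 /=; apply: le_trans h3; nra.
- exact: cvg_cst.
- by apply: cvg_expr; rewrite ger0_norm; lra.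
Qed.

Definition restr (A : set R) (t : R) : R[i] := (\1_A t)%:C * itv_ind 0 1 t.

Lemma L2_restr (A : set R) : measurable A -> L2 (restr A).
Proof.
move=> mA; apply: (@L2M_bounded _ _ _ 1); last exact: L2_itv_ind.
  by split => //=; exact: measurable_indic.
move=> t; rewrite /cabs2 /= indicE; case: (_ \in _) => /=; lra.
Qed.

Lemma cabs2_restr (z : R) (t : R) :
  cabs2 (z%:C * itv_ind 0 1 t) = z ^+ 2 * \1_(`[0, 1]%classic : set R) t.
Proof.
rewrite /cabs2 !cE /= indicE; case: (_ \in _) => /=; ring.
Qed.

(* On [0, 1] the iterates of [steepen] on [arc x] tend to 1 before [x] and to
   -1 after it, which turns Laurent polynomials into the indicator of a ray. *)
Lemma trig_dense_ray (x : R) : trig_dense (restr `]x, +oo[%classic).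
Proof.
have [x0|x0] := ltP x 0.
  have -> : restr `]x, +oo[%classic = (fun t => 1 * itv_ind 0 1 t).
    apply/funext => t; rewrite /restr /itv_ind !indicE.
    case: (boolP (t \in `[0, 1]%classic)) => [|_]; last by rewrite rmorph0 !mulr0.
    rewrite inE /= in_itv /= => /andP[t0 _].
    by rewrite mem_set//= in_itv /= andbT (lt_le_trans x0 t0).
  exact: trig_dense_laurent (is_laurent_cst 1).
have [x1|x1] := leP 1 x.
  have -> : restr `]x, +oo[%classic = (fun t => 0 * itv_ind 0 1 t).
    apply/funext => t; rewrite /restr /itv_ind !indicE.
    case: (boolP (t \in `[0, 1]%classic)) => [|_]; last by rewrite rmorph0 !mulr0.
    rewrite inE /= in_itv /= => /andP[_ t1].
    rewrite memNset ?rmorph0//= in_itv /= andbT => xt.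
    by have := lt_le_trans xt t1; rewrite ltNge x1.
  exact: trig_dense_laurent (is_laurent_cst 0).
pose G k t := ((1 - iter k steepen (arc x t)) / 2)%:C * itv_ind 0 1 t.
have E k t : cabs2 (restr `]x, +oo[%classic t - G k t) =
   (\1_(`]x, +oo[%classic : set R) t - (1 - iter k steepen (arc x t)) / 2) ^+ 2
   * \1_(`[0, 1]%classic : set R) t.
  by rewrite -cabs2_restr rmorphB mulrBl.
apply: (@trig_dense_dominated _ _ G (\1_(`[0, 1]%classic : set R))).
- exact: L2_restr.
- move=> k; apply: trig_dense_laurent.
  have -> : (fun t => ((1 - iter k steepen (arc x t)) / 2)%:C) =
      (fun t => (2^-1)%:C + (- 2^-1)%:C * (iter k steepen (arc x t))%:C).
    by apply/funext => t; rewrite -rmorphM -rmorphD; congr (_%:C); ring.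
  apply: is_laurentD; first exact: is_laurent_cst.
  by apply: is_laurentM; [exact: is_laurent_cst|exact: is_laurent_iter_steepen].
- exact: integrable_indic_itv.
- move=> k t; rewrite E ler_piMl ?indic_ge0//.
  have := steepen_le1 k (arc_le1 x t); rewrite ler_norml => /andP[h1 h2].
  by rewrite indicE; case: (_ \in _) => /=; nra.
(* At these points [arc x] is 0 and so are all its iterates; the approximants stay at 1/2 there. *)
- exists ([set 0] `|` [set x] `|` [set 1]); split.
  + by apply: measurableU; [apply: measurableU|]; exact: measurable_set1.
  + apply: countable_lebesgue_measure0; apply: finite_set_countable.
    by rewrite !finite_setU; do ?split; exact: finite_set1.
  move=> t /=; apply: contra_notP => /not_orP[/not_orP[t0 tx] t1].
  under eq_fun do rewrite E.
  have [tI|tI] := boolP (t \in `[0, 1]%classic); last first.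
    by under eq_fun do rewrite [X in _ * X]indicE (negPf tI) mulr0; exact: cvg_cst.
  under eq_fun do rewrite [X in _ * X]indicE tI mulr1.
  move: tI; rewrite inE /= in_itv /= => /andP[tt0 tt1].
  have {}tt0 : 0 < t by rewrite lt_def tt0 andbT; apply/eqP.
  have {}tt1 : t < 1 by rewrite lt_def tt1 andbT; apply/eqP => /esym.
  have arc1 := arc_le1 x t; rewrite ler_norml in arc1; move/andP: arc1 => [a1 a2].
  have [xt|xt|xt] := ltrgtP x t; last by case: tx.
  + rewrite indicE mem_set; last by rewrite /= in_itv /= andbT.
    have alt0 := arc_lt0 x0 xt tt1.
    under eq_fun => k.
      have -> : (1%:R - (1 - iter k steepen (arc x t)) / 2) ^+ 2 =
          ((1 - iter k steepen (- arc x t)) / 2) ^+ 2 :> R.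
        by rewrite iter_steepenN; field.
      over.
    by apply: sqr_steep_cvg0; rewrite oppr_gt0 alt0 lerNl.
  + rewrite indicE memNset; last by rewrite /= in_itv /= andbT => /(lt_trans xt); rewrite ltxx.
    have agt0 := arc_gt0 tt0 xt x1.
    under eq_fun do rewrite sub0r sqrrN.
    by apply: sqr_steep_cvg0; rewrite agt0.
Qed.

End FourierCompleteness.

(** * From rays to all of L^2 of [0, 1], and Parseval's inequality *)

Section Parseval.
Import HBNNSimple.
Variable R : realType.
Local Notation mu := (@lebesgue_measure R).
Local Notation "x +i* y" := (Complex x y) : ring_scope.
Local Notation "x %:C" := (real_complex _ x) : ring_scope.
Implicit Types (F G : R -> R[i]).

Lemma trig_dense_restr_setT : trig_dense (restr [set: R]).
Proof.
have -> : restr [set: R] = (fun t => 1 * itv_ind 0 1 t).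
  by apply/funext => t; rewrite /restr indicE in_setT.
exact: trig_dense_laurent (is_laurent_cst 1).
Qed.

(** A pi-lambda argument: rays are stable under intersection and generate the Borel sets,
    complements are linear combinations, and a disjoint union is a dominated limit of finite
    ones. *)
Lemma trig_dense_measurable (A : set R) : measurable A -> trig_dense (restr A).
Proof.
move=> mA.
have mE : @measurable _ (measurableTypeR R) = <<s @RGenOInfty.G R >>.
  exact: RGenOInfty.measurableE.
apply: (@dynkin_induction _ (measurableTypeR R) (@RGenOInfty.G R)
  [set S | trig_dense (restr S)]) => //.
- move=> _ _ [x ->] [y ->]; exists (Num.max x y).
  by apply/seteqP; split=> t /=; rewrite !in_itv /= !andbT gt_max => /andP.
- exact: trig_dense_restr_setT.
- by move=> _ [x ->]; exact: trig_dense_ray.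
- move=> S mS dS; rewrite /=.
  have -> : restr (~` S) = (fun t => restr [set: R] t + (-1) * restr S t).
    apply/funext => t; rewrite /restr !indicE in_setT in_setC.
    by case: (_ \in S) => /=; ring.
  by apply: trig_denseD; [exact: trig_dense_restr_setT|exact: trig_denseZ].
- move=> S mS tS dS; rewrite /=.
  pose U n := \big[setU/set0]_(i < n) S i.
  have mU n : measurable (U n) by apply: bigsetU_measurable.
  have dU n : trig_dense (restr (U n)).
    elim: n => [|n IH].
      have -> : restr (U 0) = (fun t => 0 * itv_ind 0 1 t).
        by apply/funext => t; rewrite /restr indicE /U big_ord0 in_set0.
      exact: trig_dense_laurent (is_laurent_cst 0).
    have -> : restr (U n.+1) = (fun t => restr (U n) t + restr (S n) t).
      apply/funext => t; rewrite /restr !indicE /U big_ord_recr /= in_setU.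
      case: (boolP (t \in U n)) => [tU|_]; case: (boolP (t \in S n)) => [tS'|_] /=;
        rewrite ?rmorph0; try ring.
      exfalso; move: tU tS'; rewrite !inE /U -bigcup_mkord => -[i /= ni Si] Sn.
      have := tS i n I I (ex_intro _ t (conj Si Sn)) => ein.
      by move: ni; rewrite ein ltnn.
    by apply: trig_denseD; [exact: IH|exact: dS].
  have sub n t : t \in U n -> t \in \bigcup_k S k.
    by rewrite !inE /U -bigcup_mkord => -[i _ Si]; exists i.
  have E n t : cabs2 (restr (\bigcup_k S k) t - restr (U n) t) =
     (t \in (\bigcup_k S k) `\` U n)%:R * \1_(`[0, 1]%classic : set R) t.
    rewrite /restr -mulrBl -rmorphB cabs2_restr !indicE; congr (_ * _).
    rewrite in_setD; case: (boolP (t \in U n)) => [/sub ->|_] /=; first by ring.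
    by case: (_ \in _) => /=; ring.
  apply: (@trig_dense_dominated _ _ (fun n => restr (U n)) (\1_(`[0, 1]%classic : set R))).
  + by apply: L2_restr; exact: bigcupT_measurable.
  + exact: dU.
  + exact: integrable_indic_itv.
  + by move=> n t; rewrite E; case: (_ \in _ `\` _); rewrite ?mul1r ?mul0r ?indic_ge0.
  + apply: aeW => t; under eq_fun do rewrite E.
    (* [U n] uses the indices below n, so at a point of [S i] the error vanishes from [i.+1] on. *)
    apply: cvg_near_cst; have [[i _ Si]|nS] := pselect ((\bigcup_k S k) t).
      exists i.+1 => // n /= ni; rewrite memNset ?mul0r// => -[_]; apply.
      by rewrite /U -bigcup_mkord; exists i.
    by apply: nearW => n; rewrite memNset ?mul0r// => -[].
- by rewrite -mE.
Qed.

(** Simple functions increase to [u], and the squared error is dominated by [u ^+ 2] itself. *)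
Lemma trig_dense_real_ge0 (u : R -> R) : measurable_fun setT u ->
  (forall t, 0 <= u t) -> (forall t, t \notin `[0, 1]%classic -> u t = 0) ->
  mu.-integrable setT (EFin \o (fun t => u t ^+ 2)) ->
  trig_dense (fun t => (u t)%:C).
Proof.
move=> mu_ u0 uI iu.
have mEu : measurable_fun setT (EFin \o u) by exact/measurable_EFinP.
pose f k := nnsfun_approx measurableT mEu k.
have fu k t : f k t <= u t.
  by rewrite -lee_fin /f nnsfun_approxE;
    apply: (le_approx (D := setT)) => // x _; rewrite lee_fin.
have f0 k t : 0 <= f k t by [].
have fI k t : (f k t)%:C * itv_ind 0 1 t = (f k t)%:C.
  rewrite /itv_ind indicE; case: (boolP (t \in `[0, 1]%classic)) => [|tI].
    by rewrite rmorph1 mulr1.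
  have -> : f k t = 0 by apply/le_anti; rewrite f0 andbT -(uI _ tI) fu.
  by rewrite rmorph0 mulr0.
have df k : trig_dense (fun t => (f k t)%:C * itv_ind 0 1 t).
  have -> : (fun t => (f k t)%:C * itv_ind 0 1 t) = (fun t =>
     \sum_(y <- fset_set (range (f k))) y%:C * restr (f k @^-1` [set y]) t).
    apply/funext => t; rewrite fimfunE fsbig_finite//= rmorph_sum mulr_suml.
    by apply: eq_bigr => y _; rewrite rmorphM mulrA.
  by apply: trig_dense_sum => y; apply: trig_denseZ; exact: trig_dense_measurable.
have E k t : cabs2 ((u t)%:C - (f k t)%:C * itv_ind 0 1 t) = (u t - f k t) ^+ 2.
  by rewrite fI /cabs2 !cE /=; ring.
apply: (@trig_dense_dominated _ _ (fun k t => (f k t)%:C * itv_ind 0 1 t)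
  (fun t => u t ^+ 2)) => //.
- apply/L2P; split; first by split => //=; exact: measurable_cst.
  by apply: eq_integrable iu => // t _ /=; rewrite /cabs2 /= expr0n addr0.
- move=> k t; rewrite E; have := fu k t; have := f0 k t; nra.
apply: aeW => t; under eq_fun do rewrite E.
have : (fun k => f k t) @ \oo --> u t.
  have := @cvg_nnsfun_approx _ _ _ _ measurableT _ mEu _ t I.
  by move=> /(_ (fun x _ => u0 x)) /fine_cvg.
move=> fut; have -> : 0 = (u t - u t) * (u t - u t) by rewrite subrr mulr0.
under eq_fun do rewrite expr2.
by apply: cvgM; apply: cvgB => //; exact: cvg_cst.
Qed.

Lemma trig_dense_L2 F : L2 F -> (forall t, t \notin `[0, 1]%classic -> F t = 0) ->
  trig_dense F.
Proof.
move=> LF FI; have [mF iF] := (L2P F).1 LF; have [mr mi] := mF.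
have part (u : R -> R) : measurable_fun setT u ->
    (forall t, u t ^+ 2 <= cabs2 (F t)) -> trig_dense (fun t => (u t)%:C).
  move=> mu_ uF.
  have pos (v : R -> R) : measurable_fun setT v -> (forall t, v t ^+ 2 <= cabs2 (F t)) ->
      trig_dense (fun t => (Num.max (v t) 0)%:C).
    move=> mv vF; apply: trig_dense_real_ge0.
    - exact: measurable_maxr.
    - by move=> t; rewrite le_max lexx orbT.
    - move=> t /FI Ft; have := vF t; rewrite Ft cabs20 => v0.
      have /eqP : v t ^+ 2 == 0 by rewrite eq_le v0 sqr_ge0.
      by move=> /eqP; rewrite sqrf_eq0 => /eqP ->; rewrite maxxx.
    - apply: integrable_le iF _.
        by apply: measurable_funX; exact: measurable_maxr.
      move=> t; rewrite ger0_norm ?sqr_ge0//; apply: le_trans (vF t).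
      by case: (lerP (v t) 0) => _; rewrite ?expr0n ?sqr_ge0.
  have -> : (fun t => (u t)%:C) = (fun t =>
      (Num.max (u t) 0)%:C + (-1) * (Num.max (- u t) 0)%:C).
    apply/funext => t; rewrite mulN1r -rmorphN -rmorphD; congr (_%:C).
    by case: (lerP (u t) 0); case: (lerP (- u t) 0); lra.
  apply: trig_denseD; first exact: pos.
  apply: trig_denseZ; apply: pos; first exact: measurable_funN.
  by move=> t; rewrite sqrrN.
have -> : F = (fun t => (complex.Re (F t))%:C + (0 +i* 1) * (complex.Im (F t))%:C).
  by apply/funext => t; apply: complex_ext; rewrite !cE /=; ring.
apply: trig_denseD; [|apply: trig_denseZ]; apply: part => // t;
  by rewrite /cabs2 ?lerDl ?lerDr sqr_ge0.
Qed.

(** By [bessel_defect], the finitely many frequencies of one approximating Laurent polynomial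
    already miss at most [e] of the mass. *)
Lemma parseval_le F : L2 F -> (forall t, t \notin `[0, 1]%classic -> F t = 0) ->
  ((norm2 F)%:E <=
   \esum_(n in [set: int]) (ip_abs2 F (itv_expi 0 1 (2 * pi * n%:~R)))%:E)%E.
Proof.
move=> LF FI; apply/lee_addgt0Pr => e e0.
have [_ /(_ _ e0)[P [k]]] := trig_dense_L2 LF FI.
under [X in norm2 X]eq_fun do rewrite laurent_sum.
have us := laurent_index_uniq P k.
move=> /(le_trans (bessel_defect (fun n => P`_(absz (n + k))) LF us)).
rewrite lerBlDr => H; apply: (@le_trans _ _
  (e + \sum_(n <- [seq i%:Z - k%:Z | i <- iota 0 (size P)])
     ip_abs2 F (itv_expi 0 1 (2 * pi * n%:~R)))%:E); first by rewrite lee_fin.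
rewrite EFinD addeC leeD2r//.
by apply: esum_ge_uniq => // n _; rewrite inE.
Qed.

End Parseval.

(** * Lattice systems generated by the window *)

Section LatticePreliminaries.
Variable R : realType.
Local Notation mu := (@lebesgue_measure R).
Local Notation "x +i* y" := (Complex x y) : ring_scope.
Local Notation "x %:C" := (real_complex _ x) : ring_scope.
Local Notation window := (@window R).

Lemma Rintegral_sum (I : eqType) (s : seq I) (v : I -> R -> R) :
  (forall i, i \in s -> mu.-integrable setT (EFin \o v i)) ->
  mu.-integrable setT (EFin \o (fun t => \sum_(i <- s) v i t)) /\
  Rintegral mu setT (fun t => \sum_(i <- s) v i t) =
  \sum_(i <- s) Rintegral mu setT (v i).
Proof.
elim: s => [|i s IH] iv.
  under [X in _ \o X]eq_fun do rewrite big_nil; split.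
    exact: (@integrable0 _ _ _ mu setT).
  under eq_Rintegral do rewrite big_nil.
  by rewrite Rintegral_cst// mul0r big_nil.
have [|i1 i2] := IH; first by move=> j js; apply: iv; rewrite inE js orbT.
have i0 := iv i (mem_head _ _).
under [X in _ \o X]eq_fun do rewrite big_cons -[v i _]mul1r -[\sum_(_ <- s) _]mul1r.
split; first exact: integrable_linear.
under eq_Rintegral do rewrite big_cons.
by rewrite big_cons RintegralD// i2.
Qed.

Lemma intr_dist1 (i j : int) : `|(i%:~R : R) - j%:~R| < 1 -> i = j.
Proof.
by rewrite -intrB -intr_norm ltrz1 => ij; lia.
Qed.

Lemma window_off t : t \notin `[0, 1]%classic -> window t = 0.
Proof.
rewrite notin_setE /= in_itv /= => /negP; rewrite negb_and -!ltNge => /orP[|] /ltW t0.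
  by rewrite /window bump_le0.
by rewrite /window bump_ge1.
Qed.

(** The window is real and supported in [0, 1]. After a translation by [a], the pairing is, up to a
    unimodular factor, a Fourier coefficient of a function on [0, 1]. *)
Lemma ip_window_fourier (f : R -> R[i]) (a b : R) : L2 f ->
  ip_abs2 f (tfshift window a b) =
  ip_abs2 (fun t => f (t + a) * window t) (itv_expi 0 1 (2 * pi * b)).
Proof.
move=> Lf; rewrite !ip_abs2E.
have LW := L2_window R.
have Lfw := L2_cintegrable Lf (L2_tfshift a b LW).
rewrite {1}/ip -(cint_shift a Lfw).
have E : (fun t => f (t + a) * (tfshift window a b (t + a))^*) =
   (fun t => expi (- (2 * pi * b * a)) *
     (f (t + a) * window t * (itv_expi 0 1 (2 * pi * b) t)^*)).
  apply/funext => t; rewrite /tfshift /itv_expi addrK !rmorphM /= -!expiN.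
  have -> : - (2 * pi * b * (t + a)) = - (2 * pi * b * a) - 2 * pi * b * t by ring.
  rewrite expiD.
  have wr : (window t)^* = window t * (itv_ind 0 1 t)^*.
    have [tI|tI] := boolP (t \in `[0, 1]%classic).
      by rewrite /itv_ind indicE tI; apply: complex_ext; rewrite !cE /=; ring.
    by rewrite window_off// rmorph0 mul0r.
  by rewrite wr; ring.
have iFg : cintegrable (fun t => f (t + a) * window t * (itv_expi 0 1 (2 * pi * b) t)^*).
  apply: L2_cintegrable; last exact: L2_itv_expi.
  under eq_fun do rewrite mulrC.
  apply: (@L2M_bounded _ _ _ 1); first exact: L2_cmeas.
    move=> t; rewrite /window /cabs2 /= expr0n addr0.
    by rewrite -[leRHS](expr1n _ 2) lerXn2r ?nnegrE ?bump_ge0 ?bump_le1.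
  exact: L2_shift.
by rewrite E cintZ// cabs2M cabs2_expi mul1r.
Qed.

(** Reduces the lower frame bound to finitely many translates of the window, those that cover
    [-k, k]. *)
Lemma norm2_truncate (f : R -> R[i]) (e : R) : L2 f -> 0 < e -> exists k : nat,
  norm2 f <= e + Rintegral mu setT
    (fun t => \1_(`[- k%:R, k%:R]%classic : set R) t * cabs2 (f t)).
Proof.
move=> Lf e0; have [mf iF] := (L2P f).1 Lf.
pose u (k : nat) t := (1 - \1_(`[- k%:R, k%:R]%classic : set R) t) * cabs2 (f t).
have mi (k : nat) : measurable_fun setT (\1_(`[- k%:R, k%:R]%classic : set R) : R -> R).
  exact: measurable_indic.
have mu_ k : measurable_fun setT (u k).
  by apply: measurable_funM; [exact: measurable_funB|exact: cmeas_cabs2].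
have ug k t : 0 <= u k t <= cabs2 (f t).
  have := cabs2_ge0 (f t); rewrite /u indicE; case: (_ \in _) => /= h; apply/andP; split; lra.
have ucv : {ae mu, forall t, u ^~ t @ \oo --> 0}.
  apply: aeW => t; apply: cvg_near_cst; exists (Num.truncn `|t|).+1 => // k /= tk.
  rewrite /u indicE mem_set ?subrr ?mul0r//= in_itv /= -ler_norml.
  by apply/ltW/(lt_le_trans (truncnS_gt _)); rewrite ler_nat.
have [k uk] := Rintegral_dominated_cvg0 mu_ iF ug ucv e0.
exists k.
have i1 : mu.-integrable setT (EFin \o u k).
  by apply: integrable_le iF _ => // t; have /andP[h0 h1] := ug k t; rewrite ger0_norm.
have i2 : mu.-integrable setT (EFin \o
    (fun t => \1_(`[- k%:R, k%:R]%classic : set R) t * cabs2 (f t))).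
  apply: integrable_le iF _; first by apply: measurable_funM => //; exact: cmeas_cabs2.
  move=> t; have := cabs2_ge0 (f t).
  by rewrite indicE; case: (_ \in _) => /= h; rewrite ?mul1r ?mul0r ?normr0// ger0_norm.
have -> : norm2 f = Rintegral mu setT (u k) + Rintegral mu setT
    (fun t => \1_(`[- k%:R, k%:R]%classic : set R) t * cabs2 (f t)).
  by rewrite -RintegralD//; apply: eq_Rintegral => t _; rewrite /u; ring.
by rewrite lerD2r.
Qed.

Definition int_ball (N : nat) : seq int := [seq i%:Z - N%:Z | i <- iota 0 (N + N).+1].

Lemma mem_int_ball N (j : int) : `|j| <= N%:Z -> j \in int_ball N.
Proof.
move=> jN; apply/mapP; exists (absz (j + N%:Z)); last by lia.
by rewrite mem_iota; lia.
Qed.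

Lemma int_ball_uniq N : uniq (int_ball N).
Proof. by rewrite map_inj_uniq ?iota_uniq// => i j /addIr []. Qed.

End LatticePreliminaries.

(** * Lower Riesz and frame bounds for the two lattices *)

Section LatticeSystems.
Variable R : realType.
Local Notation mu := (@lebesgue_measure R).
Local Notation "x +i* y" := (Complex x y) : ring_scope.
Local Notation "x %:C" := (real_complex _ x) : ring_scope.
Local Notation window := (@window R).
Variable eta : R.
Hypothesis eta_gt0 : 0 < eta.
Hypothesis eta_lt : eta < 2^-1.
(** [len] is the length of [eta, 1 - eta]. There [bump] is at least eta^4, and [kappa] = eta^8
    bounds its square. *)
Let len : R := 1 - 2 * eta.
Let kappa : R := ((eta ^+ 2) ^+ 2) ^+ 2.

Lemma len_gt0 : 0 < len.
Proof. rewrite /len; move: eta_lt; lra. Qed.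

Lemma kappa_gt0 : 0 < kappa.
Proof. by rewrite !exprn_gt0. Qed.

Lemma bump_sqr_lower t : eta <= t <= 1 - eta -> kappa <= bump t ^+ 2.
Proof.
move=> /(bump_lower eta_gt0) h.
by rewrite lerXn2r ?nnegrE ?bump_ge0 ?exprn_ge0// ltW.
Qed.

(** The middle part of [j, j + 1], on which the translate of the window by j is bounded below and
    all other integer translates vanish. *)
Definition cell (j : int) : set R := `[j%:~R + eta, j%:~R + eta + len]%classic.

Lemma cellP (j : int) t : t \in cell j -> eta <= t - j%:~R <= 1 - eta.
Proof.
rewrite inE /cell /= in_itv /= /len => /andP[h1 h2].
by apply/andP; split; lra.
Qed.

Lemma window_cell_other (i j : int) t : t \in cell j -> i != j -> window (t - i%:~R) = 0.
Proof.
move=> /cellP /andP[h1 h2] ij.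
have {}ij : 1 <= `|(i%:~R : R) - j%:~R|.
  by rewrite leNgt; apply/negP => /(@intr_dist1 R) E; rewrite E eqxx in ij.
move: h1 h2 ij (eta_gt0); rewrite ler_normr /window.
move: (i%:~R : R) (j%:~R : R) => x y h1 h2 /orP[ij|ij] e0.
  by rewrite bump_le0//; lra.
by rewrite bump_ge1//; lra.
Qed.

(** On the cell of j the combination is the translate by j times a trigonometric sum with exactly
    the period [len] of the cell, so orthogonality yields [len] times the coefficients with first
    index j. The cells are disjoint, and outside them the lower bound is 0. *)
Lemma lattice_riesz_lower (s : seq (int * int)) (c : int * int -> R[i]) : uniq s ->
  kappa * len * (\sum_(p <- s) cabs2 (c p)) <=
  norm2 (fun t => \sum_(p <- s) c p * tfshift window p.1%:~R (p.2%:~R / len) t).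
Proof.
move=> us; set f := (X in norm2 X); have l0 := len_gt0; have k0 := kappa_gt0.
have Lf : L2 f by apply: L2_comb => p _; apply: L2_tfshift; exact: L2_window.
pose js := undup (map fst s).
pose q (j : int) t := \sum_(p <- [seq p <- s | p.1 == j])
  c p * itv_expi (j%:~R + eta) (j%:~R + eta + len) (2 * pi / len * p.2%:~R) t.
have Lq j : L2 (q j) by apply: L2_comb => p _; exact: L2_itv_expi.
have nq j : norm2 (q j) = len * \sum_(p <- s | p.1 == j) cabs2 (c p).
  rewrite /q norm2_itv_expi_comb ?filter_uniq//.
  - by rewrite big_filter; congr (_ * _); ring.
  - move=> [a b] [a' b']; rewrite !mem_filter /= => /andP[/eqP -> _] /andP[/eqP -> _].
    by move=> ->.
  - by rewrite ltrDl.
  - by rewrite [X in _ * X](_ : _ = len) ?divfK ?gt_eqF//; ring.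
have iv j : j \in js -> mu.-integrable setT (EFin \o (fun t => kappa * cabs2 (q j t))).
  by move=> _; exact: (integrableZl measurableT kappa (L2_integrable (Lq j))).
have [isum Esum] := Rintegral_sum iv.
have -> : kappa * len * (\sum_(p <- s) cabs2 (c p)) =
    \sum_(j <- js) Rintegral mu setT (fun t => kappa * cabs2 (q j t)).
  have Ij j : Rintegral mu setT (fun t => kappa * cabs2 (q j t)) =
      kappa * len * \sum_(p <- s | p.1 == j) cabs2 (c p).
    by rewrite RintegralZl//; [rewrite -/(norm2 (q j)) nq mulrA|exact: L2_integrable].
  rewrite (eq_bigr _ (fun j _ => Ij j)) -mulr_sumr; congr (_ * _).
  rewrite (exchange_big_dep predT)//=; apply: eq_big_seq => p ps.
  have pj : p.1 \in js by rewrite mem_undup map_f.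
  rewrite big_mkcond (bigD1_seq p.1) ?undup_uniq//= eqxx big1 ?addr0//.
  by move=> j; rewrite eq_sym => /negPf ->.
rewrite -Esum; apply: le_Rintegral => //; first exact: L2_integrable.
move=> t _.
have q0 j : t \notin cell j -> kappa * cabs2 (q j t) = 0.
  move=> tj; rewrite /q big1 ?cabs20 ?mulr0// => p _.
  by rewrite /itv_expi /itv_ind indicE (negPf tj) rmorph0 !mulr0.
have [[j [jjs tj]]|none] := pselect (exists j, j \in js /\ t \in cell j); last first.
  rewrite big1_seq ?cabs2_ge0// => j /andP[_ jjs]; apply: q0.
  by apply/negP => tj; apply: none; exists j.
rewrite (bigD1_seq j) ?undup_uniq//= big1 ?addr0; last first.
  move=> i ij; apply: q0; apply/negP => ti.
  have /andP[h1 h2] := cellP tj; have /andP[h3 h4] := cellP ti.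
  have E : i = j.
    by apply: (@intr_dist1 R); rewrite ltr_norml;
      move: eta_gt0; move=> *; apply/andP; split; lra.
  by rewrite E eqxx in ij.
have -> : f t = window (t - j%:~R) * q j t.
  rewrite /f (bigID (fun p => p.1 == j)) /= [X in _ + X]big1 ?addr0; last first.
    by move=> p pj; rewrite /tfshift (window_cell_other tj pj) !mulr0.
  rewrite /q big_filter mulr_sumr; apply: eq_bigr => p /eqP ->.
  rewrite /tfshift /itv_expi /itv_ind indicE tj rmorph1 mulr1.
  have -> : 2 * pi * (p.2%:~R / len) * t = 2 * pi / len * p.2%:~R * t by ring.
  by ring.
rewrite cabs2M ler_wpM2r ?cabs2_ge0//.
by rewrite /window /cabs2 /= expr0n addr0 bump_sqr_lower// cellP.
Qed.

(** Parseval on each translate of [0, 1] turns the frame sum into the integral of |f|^2 times the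
    sum of the squared translates of the window. Steps of size [len] place every t in the middle
    part of some translate, so that sum is at least [kappa]. *)
Lemma lattice_frame_lower (f : R -> R[i]) : L2 f ->
  ((kappa * norm2 f)%:E <= \esum_(p in [set: int * int])
    (ip_abs2 f (tfshift window (len * p.1%:~R) p.2%:~R))%:E)%E.
Proof.
move=> Lf; have l0 := len_gt0; have k0 := kappa_gt0.
apply/lee_addgt0Pr => e e0.
have ek : 0 < e / kappa by rewrite divr_gt0.
have [M nM] := norm2_truncate Lf ek.
pose F j t := f (t + len * j%:~R) * window t.
have wb t : cabs2 (window t) <= 1.
  rewrite /window /cabs2 /= expr0n addr0.
  by rewrite -[leRHS](expr1n _ 2) lerXn2r ?nnegrE ?bump_ge0 ?bump_le1.
have LF (j : int) : L2 (F j).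
  rewrite /F; under eq_fun do rewrite mulrC.
  apply: (@L2M_bounded _ _ _ 1) => //; first exact: L2_cmeas (L2_window R).
  exact: L2_shift.
have pF (j : int) : ((norm2 (F j))%:E <= \esum_(n in [set: int])
     (ip_abs2 f (tfshift window (len * j%:~R) n%:~R))%:E)%E.
  apply: le_trans (parseval_le (LF j) _) _.
    by move=> t tI; rewrite /F window_off// mulr0.
  by apply: le_esum => n _; rewrite ip_window_fourier.
(* For |t| <= M the chosen translate satisfies |j| len <= M + 1. *)
pose N := (Num.truncn ((M%:R + 1) / len)).+1.
have sumF : kappa * norm2 f <= e + \sum_(j <- int_ball N) norm2 (F j).
  pose v (j : int) t := cabs2 (f t * window (t - len * j%:~R)).
  have vE j : v j = (fun t => cabs2 (F j (t - len * j%:~R))).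
    by apply/funext => t; rewrite /v /F subrK.
  have iv (j : int) : mu.-integrable setT (EFin \o v j).
    by rewrite vE; exact: (integrable_shift (- (len * j%:~R)) (L2_integrable (LF j))).
  have nv j : norm2 (F j) = Rintegral mu setT (v j).
    rewrite vE; symmetry; exact: (Rintegral_shift (- (len * j%:~R)) (L2_integrable (LF j))).
  under eq_bigr do rewrite nv.
  have [isum <-] := Rintegral_sum (fun j (_ : j \in int_ball N) => iv j).
  have -> : e = kappa * (e / kappa) by rewrite mulrC divfK// gt_eqF.
  apply: (@le_trans _ _ (kappa * (e / kappa + Rintegral mu setT
    (fun t => \1_(`[- M%:R, M%:R]%classic : set R) t * cabs2 (f t))))).
    by rewrite ler_pM2l.
  rewrite mulrDr lerD2l.
  have iM : mu.-integrable setT (EFin \o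
      (fun t => \1_(`[- M%:R, M%:R]%classic : set R) t * cabs2 (f t))).
    apply: integrable_le (L2_integrable Lf) _.
      by apply: measurable_funM; [exact: measurable_indic|apply: cmeas_cabs2; exact: L2_cmeas].
    move=> t; have := cabs2_ge0 (f t).
    by rewrite indicE; case: (_ \in _) => /= h; rewrite ?mul1r ?mul0r ?normr0// ger0_norm.
  rewrite -RintegralZl//; apply: le_Rintegral => //.
    exact: (integrableZl measurableT kappa iM).
  move=> t _.
  have v0 j : 0 <= v j t by exact: cabs2_ge0.
  rewrite indicE; case: (boolP (t \in _)) => [|_]; last first.
    by rewrite mul0r mulr0 sumr_ge0.
  rewrite inE /= in_itv /= mul1r -ler_norml => tM.
  (* The translate with eta <= t - len j < eta + len = 1 - eta. *)
  pose j := Num.floor ((t - eta) / len).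
  have [j1 j2] : j%:~R * len <= t - eta /\ t - eta < (j%:~R + 1) * len.
    rewrite -ler_pdivlMr// -ltr_pdivrMr//; split; first exact: floor_le.
    by have := floorD1_gt ((t - eta) / len); rewrite intrD1.
  have jN : j \in int_ball N.
    apply: mem_int_ball.
    have : `|(j%:~R : R)| <= N%:R.
      have E := truncnS_gt ((M%:R + 1) / len).
      apply: le_trans (ltW E); rewrite ler_pdivlMr// -[X in _ * X](ger0_norm (ltW l0)) -normrM.
      move: tM; rewrite !ler_norml => /andP[t1 t2].
      have := eta_lt; have := eta_gt0; rewrite /len in j1 j2 * => *.
      by apply/andP; split; nra.
    by rewrite -intr_norm -[N%:R]/(N%:Z%:~R) ler_int.
  apply: (@le_trans _ _ (v j t)).
    rewrite /v cabs2M mulrC ler_wpM2l ?cabs2_ge0//.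
    rewrite /window /cabs2 /= expr0n addr0; apply: bump_sqr_lower.
    rewrite /len in j1 j2 *; apply/andP; split; nra.
  rewrite (bigD1_seq j) ?int_ball_uniq//= lerDl.
  by rewrite sumr_ge0.
apply: (@le_trans _ _ (e + \sum_(j <- int_ball N) norm2 (F j))%:E); first by rewrite lee_fin.
rewrite EFinD addeC leeD2r//.
have -> : [set: int * int] = [set: int] `*`` (fun=> [set: int]) by apply/seteqP; split.
rewrite -(@esum_esum _ _ _ _ _ (fun j n =>
   (ip_abs2 f (tfshift window (len * j%:~R) n%:~R))%:E)); last first.
  by move=> j n _ _; rewrite lee_fin ip_abs2E cabs2_ge0.
apply: (@le_trans _ _ (\esum_(j in [set: int]) (norm2 (F j))%:E)%E).
  by apply: esum_ge_uniq; [exact: int_ball_uniq|move=> n _; rewrite inE].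
by apply: le_esum.
Qed.

End LatticeSystems.

(** * Counting points in squares *)

Section Counting.
Variable R : realType.

(** Used for tail radii and, through inverses, for separation constants. The summand 1 keeps the
    radius positive even for N = 0. *)
Lemma common_radius (N : nat) (P : 'I_N -> R -> Prop) :
  (forall n, exists2 r : R, 0 < r & P n r) ->
  (forall n r r', r <= r' -> P n r -> P n r') ->
  exists2 r : R, 0 < r & forall n, P n r.
Proof.
move=> Pr mono.
have /choice[r rP] : forall n, exists r : R, 0 < r /\ P n r.
  by move=> n; have [r r0 h] := Pr n; exists r.
have r0 n : 0 <= r n by have [/ltW] := rP n.
exists (1 + \sum_n r n); first by rewrite ltr_pwDl ?sumr_ge0.
move=> n; apply: (mono n (r n)); last by have [] := rP n.
rewrite (bigD1 n)//= addrCA lerDl addr_ge0// sumr_ge0//.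
Qed.

Lemma unif_discrete_common (N : nat) (L : 'I_N -> set (R * R)) :
  (forall n, unif_discrete (L n)) ->
  exists d : R, [/\ 0 < d, d <= 1 & forall n p q, L n p -> L n q -> p <> q ->
    d ^+ 2 < (p.1 - q.1) ^+ 2 + (p.2 - q.2) ^+ 2].
Proof.
move=> uL.
(* Positivity is part of the predicate, since inversion reverses the order only among positive
   radii. *)
have [||r r0 rP] := @common_radius N (fun n r => forall p q, L n p -> L n q -> p <> q ->
    r^-1 ^+ 2 < (p.1 - q.1) ^+ 2 + (p.2 - q.2) ^+ 2 /\ 0 < r).
- move=> n; have [d d0 dP] := uL n; exists d^-1; first by rewrite invr_gt0.
  move=> p q Lp Lq pq; rewrite invrK invr_gt0; split=> //.
  have := dP p q Lp Lq pq.
  rewrite -(@ltr_pXn2r _ 2)// ?nnegrE ?sqrtr_ge0 ?(ltW d0)//.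
  by rewrite sqr_sqrtr// addr_ge0 ?sqr_ge0.
- move=> n r r' rr' H p q Lp Lq pq; have [h r0] := H p q Lp Lq pq.
  have r'0 := lt_le_trans r0 rr'; split=> //; apply: le_lt_trans h.
  by rewrite lerXn2r ?nnegrE ?invr_ge0 ?(ltW r0) ?(ltW r'0)// lef_pV2.
have m0 : 0 < Num.min 1 r^-1 by rewrite lt_min ltr01 invr_gt0.
exists (Num.min 1 r^-1); split=> //; first by rewrite ge_min lexx.
move=> n p q Lp Lq pq; have [h _] := rP n p q Lp Lq pq.
apply: le_lt_trans h.
by rewrite lerXn2r ?nnegrE ?(ltW m0) ?invr_ge0 ?(ltW r0)// ge_min lexx orbT.
Qed.

End Counting.

Section CountingSquares.
Variables (R : realType) (N : nat) (L : 'I_N -> set (R * R)) (d : R).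
Hypotheses (d_gt0 : 0 < d) (d_le1 : d <= 1)
  (sep : forall n p q, L n p -> L n q -> p <> q ->
    d ^+ 2 < (p.1 - q.1) ^+ 2 + (p.2 - q.2) ^+ 2).

Lemma separated_sub n (Y : seq (R * R)) : uniq Y -> {subset Y <= L n} ->
  separated d Y.
Proof.
move=> uY YL; split=> // p q /YL; rewrite inE => Lp /YL; rewrite inE => Lq.
by move/eqP; exact: sep Lp Lq.
Qed.

(** Each point of the square contributes at least a fixed amount to the packing sum. Finiteness
    matters because [fset_set] of an infinite set is empty by default. *)
Lemma finite_square n (a b r : R) : finite_set (L n `&` square a b r).
Proof.
apply: contrapT => inf.
have [K K0 pack] := packing d_gt0 d_le1.
pose c := (1 + r ^+ 2)^-1.
have c0 : 0 < c by rewrite invr_gt0 ltr_pwDl ?sqr_ge0.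
have [B BA Bn] := @infinite_set_fset _ _ (Num.truncn (K / c ^+ 2)).+1 inf.
have sB : separated d (enum_fset B).
  apply: (@separated_sub n); first exact: fset_uniq.
  by move=> p pB; rewrite inE; have [] := BA p pB.
have := pack _ a b sB; apply/negP; rewrite -ltNge.
apply: (@lt_le_trans _ _ (\sum_(p <- enum_fset B) c ^+ 2)).
  rewrite big_const_seq count_predT iter_addr addr0 -mulr_natr mulrC -ltr_pdivrMr ?exprn_gt0//.
  by apply: lt_le_trans (truncnS_gt _) _; rewrite ler_nat.
rewrite big_seq [leRHS]big_seq; apply: ler_sum => p pB.
have [_ [p1 p2]] := BA p pB.
by rewrite expr2; apply: ler_pM; rewrite ?(ltW c0)//; exact: weight_ge.
Qed.

(** Points carry their index [n], so one shared by several sets is counted once for each. *)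
Definition points (a b r : R) : seq ('I_N * (R * R)) :=
  [seq (n, p) | n <- enum 'I_N, p <- enum_fset (fset_set (L n `&` square a b r))].

Lemma mem_points a b r k :
  k \in points a b r <-> gabor_index L k /\ square a b r k.2.
Proof.
case: k => n p; split.
  move=> /allpairsPdep[m [q [_ qs [-> ->]]]] /=.
  by move: qs; rewrite in_fset_set ?inE; [|exact: finite_square].
move=> [/= Lp sp]; apply/allpairsPdep; exists n, p; split; rewrite ?mem_enum//.
by rewrite in_fset_set ?inE//; exact: finite_square.
Qed.

Lemma points_uniq a b r : uniq (points a b r).
Proof.
apply: allpairs_uniq_dep; rewrite ?enum_uniq//.
by move=> [n p] [m q] _ _ /= [-> ->].
Qed.

Lemma size_points a b r : (size (points a b r))%:R = count_sq L a b r.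
Proof.
rewrite /count_sq; congr (_%:R).
rewrite size_allpairs_dep sumnE big_map big_enum; apply: eq_bigr => n _.
by rewrite cardfE.
Qed.

Lemma count_sq_ge0 a b r : 0 <= count_sq L a b r.
Proof. by []. Qed.

Lemma points_count a b r a' b' r' :
  (forall p, square a' b' r' p -> square a b r p) ->
  size (points a' b' r') = count (mem (points a' b' r')) (points a b r).
Proof.
move=> sub; rewrite -size_filter; apply: perm_size; apply: uniq_perm.
- exact: points_uniq.
- by rewrite filter_uniq// points_uniq.
move=> k; rewrite mem_filter.
apply/idP/idP => [kJ|/andP[]//]; apply/andP; split=> //.
by apply/mem_points; have [Lk /sub sk] := (mem_points _ _ _ _).1 kJ.
Qed.

Definition min_count (r : R) : R :=
  inf [set count_sq L ab.1 ab.2 r | ab in [set: R * R]].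

Lemma min_count_le a b r : min_count r <= count_sq L a b r.
Proof.
apply: ge_inf; last by exists (a, b).
by exists 0 => _ [ab _ <-]; exact: count_sq_ge0.
Qed.

Lemma le_min_count x r : (forall a b, x <= count_sq L a b r) -> x <= min_count r.
Proof.
move=> H; apply: lb_le_inf; first by exists (count_sq L 0 0 r), (0, 0).
by move=> _ [[a b] _ <-]; exact: H.
Qed.

Lemma min_count_ge0 r : 0 <= min_count r.
Proof. by apply: le_min_count => a b; exact: count_sq_ge0. Qed.

(* [k ^ 2] disjoint squares of radius [r] fit into one of radius [S]: their
   centres are spaced by [2 S / k > 2 r]. *)
Lemma min_count_super (r S : R) (k : nat) : 0 < r -> k%:R * r < S ->
  (k ^ 2)%:R * min_count r <= min_count S.
Proof.
move=> r0 krS; apply: le_min_count => a b.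
case: k krS => [|k] krS; first by rewrite mul0r count_sq_ge0.
have k0 : 0 < k.+1%:R :> R by [].
pose s := 2 * S / k.+1%:R.
have s2r : 2 * r < s by rewrite /s ltr_pdivlMr//; lra.
have sk : s * k.+1%:R = 2 * S by rewrite /s divfK// gt_eqF.
pose ctr (x : R) (i : 'I_k.+1) : R := x - S + s * (i%:R + 2^-1).
have ctr_in x i y : `|y - ctr x i| <= r -> `|y - x| <= S.
  rewrite /ctr !ler_norml => /andP[h1 h2].
  have i1 : (i%:R : R) + 1 <= k.+1%:R by rewrite natr1 ler_nat ltn_ord.
  have i0 : 0 <= i%:R :> R by [].
  by apply/andP; split; nra.
have ctr_inj x i j y : `|y - ctr x i| <= r -> `|y - ctr x j| <= r -> i = j.
  rewrite /ctr !ler_norml => /andP[h1 h2] /andP[h3 h4]; apply: val_inj => /=.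
  have lt1 (m n : nat) : s * ((m%:R : R) - n%:R) <= 2 * r -> (m <= n)%N.
    move=> H; rewrite leqNgt; apply/negP => nm.
    have : (n%:R : R) + 1 <= m%:R by rewrite natr1 ler_nat.
    by move=> *; nra.
  by apply/eqP; rewrite eqn_leq; apply/andP; split; apply: lt1; lra.
have sub i j p : square (ctr a i) (ctr b j) r p -> square a b S p.
  by move=> [p1 p2]; split; apply: ctr_in; eassumption.
rewrite -size_points.
apply: (@le_trans _ _ (\sum_(ij : 'I_k.+1 * 'I_k.+1)
    (size (points (ctr a ij.1) (ctr b ij.2) r))%:R)).
  have -> : (k.+1 ^ 2)%:R * min_count r = \sum_(ij : 'I_k.+1 * 'I_k.+1) min_count r.
    by rewrite sumr_const card_prod card_ord mulr_natl.
  by apply: ler_sum => ij _; rewrite size_points; exact: min_count_le.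
rewrite -natr_sum ler_nat.
under eq_bigr => ij _.
  rewrite (points_count (@sub ij.1 ij.2)) -sum1_count big_mkcond /=.
  over.
(* Double counting: each point of the large square lies in at most one of the small ones. *)
rewrite exchange_big /= -sum1_size; apply: leq_sum => p _.
rewrite -big_mkcond /= sum1_card; apply/card_le1P => ij.
rewrite unfold_in => pij ij'; rewrite inE [LHS]unfold_in.
have [_ [p1 p2]] := (mem_points _ _ _ _).1 pij.
apply/idP/eqP => [pij'|->//].
have [_ [q1 q2]] := (mem_points _ _ _ _).1 pij'.
case: ij ij' p1 p2 q1 q2 {pij pij'} => i j [i' j'] /= p1 p2 q1 q2.
by rewrite (ctr_inj _ _ _ _ p1 q1) (ctr_inj _ _ _ _ p2 q2).
Qed.

(** At most (5 r)^2 integer centres suffice. Every point has weight at least 1/4 around one of them,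
    and the total weight around each is at most K. *)
Lemma count_sq_bound : exists2 C : R, 0 < C &
  forall a b r, 1 <= r -> count_sq L a b r <= C * r ^+ 2.
Proof.
have [K K0 pack] := packing d_gt0 d_le1.
exists (N%:R * (4 * (25 * K)) + 1).
  by rewrite ltr_wpDl// mulr_ge0// mulr_ge0// mulr_ge0// ltW.
move=> a b r r1; pose M := (Num.truncn r).+1.
have Mr : r < M%:R by exact: truncnS_gt.
have M2 : (size (int_ball M))%:R <= 5 * r.
  have : (Num.truncn r)%:R <= r by rewrite truncn_le; lra.
  rewrite /int_ball size_map size_iota /M -addn1 !natrD -!natr1 => *; lra.
have near1 (x y : R) : `|y - x| <= r -> exists2 i, i \in int_ball M &
    2^-1 <= weight (y - (x + i%:~R)).
  move=> yx; exists (Num.floor (y - x)).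
    apply: mem_int_ball.
    have l := floor_le (y - x); have u := floorD1_gt (y - x).
    move: yx; rewrite ler_norml => /andP[h1 h2].
    have m1 : (- (M%:Z))%:~R < (Num.floor (y - x) + 1)%:~R :> R.
      by apply: le_lt_trans u; rewrite mulrNz -pmulrn; lra.
    have m2 : (Num.floor (y - x))%:~R < (M%:Z)%:~R :> R.
      by apply: le_lt_trans l _; rewrite -pmulrn; lra.
    by rewrite !ltr_int in m1 m2; lia.
  have l := floor_le (y - x); have := floorD1_gt (y - x); rewrite intrD1 => u.
  have -> : 2^-1 = (1 + 1 ^+ 2)^-1 :> R by rewrite expr1n.
  by apply: (@weight_ge _ _ 1); rewrite ler_norml; apply/andP; split; lra.
have one n : (#|` fset_set (L n `&` square a b r)|%fset)%:R <= 4 * (25 * K) * r ^+ 2.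
  pose Y := enum_fset (fset_set (L n `&` square a b r)).
  have YP p : p \in Y -> L n p /\ square a b r p.
    by rewrite /Y in_fset_set ?inE; [|exact: finite_square].
  have sY : separated d Y.
    apply: (@separated_sub n); first exact: fset_uniq.
    by move=> p /YP[Lp _]; rewrite inE.
  pose G := [seq (i, j) | i <- int_ball M, j <- int_ball M].
  pose w (p : R * R) (c : int * int) :=
    weight (p.1 - (a + c.1%:~R)) * weight (p.2 - (b + c.2%:~R)).
  have w0 p c : 0 <= w p c by rewrite mulr_ge0// ltW ?weight_gt0.
  have uG : uniq G.
    by apply: allpairs_uniq; rewrite ?int_ball_uniq// => -[? ?] [? ?].
  have lower : (size Y)%:R * 4^-1 <= \sum_(p <- Y) \sum_(c <- G) w p c.
    have -> : (size Y)%:R * 4^-1 = \sum_(p <- Y) 4^-1 :> R.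
      by rewrite big_const_seq count_predT iter_addr addr0 mulr_natl.
    rewrite big_seq [leRHS]big_seq; apply: ler_sum => p /YP[_ [p1 p2]].
    have [i iM wi] := near1 _ _ p1; have [j jM wj] := near1 _ _ p2.
    have ijG : (i, j) \in G by apply/allpairsP; exists (i, j).
    rewrite (bigD1_seq (i, j))//=; apply: ler_wpDr; first by rewrite sumr_ge0.
    have -> : 4^-1 = 2^-1 * 2^-1 :> R by field.
    by apply: ler_pM.
  have upper : \sum_(p <- Y) \sum_(c <- G) w p c <= 25 * r ^+ 2 * K.
    rewrite exchange_big /=; apply: (@le_trans _ _ (\sum_(c <- G) K)).
      by apply: ler_sum => c _; exact: pack.
    rewrite big_const_seq count_predT iter_addr addr0 -[K *+ _]mulr_natl.
    apply: ler_wpM2r; first exact: ltW.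
    rewrite size_allpairs natrM; have -> : 25 * r ^+ 2 = (5 * r) * (5 * r) by ring.
    by apply: ler_pM.
  by have := le_trans lower upper; rewrite -/Y; lra.
rewrite /count_sq natr_sum; apply: (@le_trans _ _ (\sum_(n < N) 4 * (25 * K) * r ^+ 2)).
  by apply: ler_sum => n _; exact: one.
rewrite sumr_const card_ord -[_ *+ N]mulr_natl; have := sqr_ge0 r; lra.
Qed.

End CountingSquares.

(** * Existence of the lower density *)

Section LowerDensity.
Variable R : realType.

(** Fekete's argument in the plane: the limit is the supremum of the ratio over r >= 1, where the
    quadratic bound keeps it finite. *)
Lemma cvg_superadditive (m : R -> R) (C : R) : (forall r, 0 <= m r) ->
  (forall (r S : R) k, 0 < r -> k%:R * r < S -> (k ^ 2)%:R * m r <= m S) ->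
  (forall r, 1 <= r -> m r <= C * r ^+ 2) ->
  cvg (m r / (2 * r) ^+ 2 @[r --> +oo]).
Proof.
move=> m0 msup mC; pose F (r : R) := m r / (2 * r) ^+ 2.
pose A := [set F r | r in [set r : R | 1 <= r]].
have FC r : 1 <= r -> F r <= C / 4.
  move=> r1; rewrite /F ler_pdivrMr ?exprn_gt0 ?mulr_gt0//; last lra.
  by apply: le_trans (mC r r1) _; rewrite exprMn; lra.
have F0 r : 0 <= F r by rewrite divr_ge0 ?sqr_ge0.
have supA : has_sup A.
  split; first by exists (F 1), 1 => /=.
  by exists (C / 4) => _ [r r1 <-]; exact: FC.
pose S := sup A.
have FS r : 1 <= r -> F r <= S.
  by move=> r1; apply: ub_le_sup; [exact: supA.2|exists r].
have S0 : 0 <= S by apply: le_trans (FS 1 (lexx _)); exact: F0.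
apply/cvg_ex; exists S; apply/cvgrPdist_le => e e0.
have [_ [r r1 <-] Fr] := @sup_adherent _ A (e / 2) ltac:(by rewrite divr_gt0) supA.
rewrite /= -/S in r1 Fr.
have r0 : 0 < r by apply: lt_le_trans r1.
(* Replacing (k r)^2 by T^2 loses at most 4 r F(r) / T, which is below e/2 from here on; the term 2
   r keeps T - 2 r nonnegative. *)
exists (8 * r * (S + 1) / e + 2 * r); split; first exact: num_real.
move=> T Tbig.
have q0 : 0 <= 8 * r * (S + 1) / e by rewrite divr_ge0 ?mulr_ge0//; lra.
have T0 : 0 < T by lra.
have STe : 8 * r * (S + 1) <= e * T.
  by rewrite [leRHS]mulrC -ler_pdivrMr//; lra.
rewrite ger0_norm; last by rewrite subr_ge0 FS//; lra.
(* Subtracting r/2 makes k r < T strict, as superadditivity requires. *)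
pose k := Num.truncn ((T - r / 2) / r).
have [k1 k2] : k%:R * r < T /\ T - 2 * r <= k%:R * r.
  have tr0 : 0 <= (T - r / 2) / r by rewrite divr_ge0//; lra.
  have h1 : k%:R <= (T - r / 2) / r by rewrite truncn_le.
  have h2 : (T - r / 2) / r < k.+1%:R by exact: truncnS_gt.
  move: h1 h2; rewrite ler_pdivlMr// ltr_pdivrMr// -[k.+1%:R]natr1 mulrDl mul1r => h1 h2.
  by split; lra.
have key := msup r T k r0 k1.
have mr : m r = F r * (2 * r) ^+ 2.
  by rewrite /F divfK// expf_neq0// gt_eqF// mulr_gt0.
have mT : m T = F T * (2 * T) ^+ 2.
  by rewrite /F divfK// expf_neq0// gt_eqF// mulr_gt0.
rewrite mr mT natrX in key.
have {}key : F r * (k%:R * r) ^+ 2 <= F T * T ^+ 2 by rewrite !exprMn in key *; lra.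
rewrite -/(F T).
have T2 : 0 < T ^+ 2 by rewrite exprn_gt0.
have sq : (T - 2 * r) ^+ 2 <= (k%:R * r) ^+ 2.
  by rewrite lerXn2r ?nnegrE//; lra.
have low : F r * (T ^+ 2 - 4 * r * T) <= F T * T ^+ 2.
  apply: le_trans key; apply: ler_wpM2l => //; apply: le_trans sq.
  by rewrite sqrrB; have := sqr_ge0 r; lra.
have h3 : F r * (4 * r * T) <= e / 2 * T ^+ 2.
  apply: (@le_trans _ _ (S * (4 * r * T))).
    by apply: ler_wpM2r; [apply: mulr_ge0; lra|exact: FS].
  have h4 : 0 <= (e * T - 8 * r * (S + 1)) * T by apply: mulr_ge0; lra.
  have h5 : 0 <= r * T by apply: mulr_ge0; lra.
  nra.
have h6 : 0 <= (F r - (S - e / 2)) * T ^+ 2 by apply: mulr_ge0; lra.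
by rewrite -(ler_pM2r T2); lra.
Qed.

End LowerDensity.

(** * Density inequalities *)

Section DensityBounds.
Variable R : realType.
Local Notation "x +i* y" := (Complex x y) : ring_scope.
Local Notation "x %:C" := (real_complex _ x) : ring_scope.
Local Notation window := (@window R).

Lemma riesz_frame_comparison_seq (I : eqType) (s : seq I) (u : I -> R -> R[i])
    (K : choiceType) (D : set K) (f : K -> R -> R[i]) (K0 : seq K) (A1 A2 eps : R) :
  uniq s -> (forall j, L2 (u j)) -> (forall k, L2 (f k)) -> 0 < A1 -> 0 < A2 ->
  (forall c : I -> R[i], A1 * (\sum_(j <- s) cabs2 (c j)) <=
     norm2 (fun t => \sum_(j <- s) c j * u j t)) ->
  (forall h, L2 h ->
     ((A2 * norm2 h)%:E <= \esum_(k in D) (ip_abs2 h (f k))%:E)%E) ->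
  (forall j, j \in s ->
     (\esum_(k in D `\` [set` K0]) (ip_abs2 (u j) (f k))%:E <= eps%:E)%E) ->
  A1 * A2 * ((size s)%:R - (size K0)%:R) <= eps * (size s)%:R.
Proof.
move=> us Lu Lf A10 A20 riesz fr tail.
apply: (@riesz_frame_comparison _ _ (fun i => u (tnth (in_tuple s) i)) _ D f) => //.
- move=> c.
  (* Transports coefficients from positions to elements, which is unambiguous since [s] has no
     duplicates. *)
  pose c' k := if insub (index k s) is Some i then c i else 0.
  have c'E i : c' (tnth (in_tuple s) i) = c i.
    rewrite /c' (tnth_nth (tnth (in_tuple s) i)) /= index_uniq//.
    by rewrite insubT//= => lt; congr c; apply: val_inj.
  have := riesz c'; rewrite big_tnth.
  under eq_bigr do rewrite c'E.
  under [in X in _ <= X -> _]eq_fun do rewrite big_tnth.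
  by under [in X in _ <= X -> _]eq_fun do under eq_bigr do rewrite c'E.
- by move=> j; apply: tail; exact: mem_tnth.
Qed.

Definition int_range (lo : int) (k : nat) : seq int := [seq lo + i%:Z | i <- iota 0 k].

Lemma int_range_uniq lo k : uniq (int_range lo k).
Proof. by rewrite map_inj_uniq ?iota_uniq// => i j /addrI []. Qed.

Lemma mem_int_range lo k (j : int) : j \in int_range lo k ->
  exists2 i, (i < k)%N & j = lo + i%:Z.
Proof. by move=> /mapP[n]; rewrite mem_iota => nk ->; exists n. Qed.

(** For the frame side of the comparison: the list has to contain every near lattice point, extra
    members do no harm, and only its size must be bounded above. *)
Lemma lattice_cover (x c r : R) : 0 < x -> 0 <= r -> exists s : seq int,
  (size s)%:R <= 2 * r / x + 1 /\ forall j, `|x * j%:~R - c| <= r -> j \in s.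
Proof.
move=> x0 r0; pose lo := Num.ceil ((c - r) / x); pose k := (Num.truncn (2 * r / x)).+1.
exists (int_range lo k); split.
  by rewrite size_map size_iota /k -[_.+1%:R]natr1 lerD2r truncn_le divr_ge0 ?mulr_ge0// ltW.
move=> j; rewrite ler_norml => /andP[h1 h2].
have l1 : (lo <= j)%R.
  by rewrite real_ceil_le_int ?num_real// ler_pdivrMr// mulrC; lra.
have l2 : (j - lo)%:~R <= 2 * r / x.
  rewrite intrB lerBlDr; apply: (@le_trans _ _ ((c + r) / x)).
    by rewrite ler_pdivlMr// mulrC; lra.
  have : (c - r) / x <= lo%:~R by exact: ceil_ge.
  have -> : (c + r) / x = 2 * r / x + (c - r) / x by ring.
  by rewrite lerD2l.
have l3 : ((absz (j - lo))%:Z = j - lo)%R by lia.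
have l4 : (absz (j - lo) < k)%N.
  rewrite -(ltr_nat R); apply: le_lt_trans (truncnS_gt _).
  by apply: le_trans l2; rewrite -l3 -pmulrn.
by apply/mapP; exists (absz (j - lo)); [rewrite mem_iota|rewrite l3; lia].
Qed.

(** For the Riesz side: every listed point has to be near, and the size must be bounded below. *)
Lemma lattice_inner (x c r : R) : 0 < x -> 0 <= r -> exists s : seq int,
  [/\ uniq s, 2 * r / x - 1 <= (size s)%:R &
      forall j, j \in s -> `|x * j%:~R - c| <= r].
Proof.
move=> x0 r0; pose lo := Num.ceil ((c - r) / x); pose k := Num.truncn (2 * r / x).
exists (int_range lo k); split; first exact: int_range_uniq.
  rewrite size_map size_iota lerBlDr natr1; exact/ltW/truncnS_gt.
move=> j /mem_int_range[i ik ->].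
have i1 : (i%:R : R) + 1 <= 2 * r / x.
  by rewrite natr1; apply: (@le_trans _ _ k%:R);
    [rewrite ler_nat|rewrite truncn_le// divr_ge0 ?mulr_ge0// ltW].
have i0 : 0 <= i%:R :> R by [].
have l1 : (c - r) / x <= lo%:~R by exact: ceil_ge.
have l2 : lo%:~R < (c - r) / x + 1.
  by have := ceilB1_lt ((c - r) / x); rewrite intrB ltrBlDr.
move: i1 l1 l2; rewrite ler_pdivlMr// ler_pdivrMr// -ltrBlDr ltr_pdivlMr// => i1 l1 l2.
rewrite intrD -pmulrn ler_norml; apply/andP; split; nra.
Qed.

Lemma lattice_separated (x y d a b : R) (Y : seq (int * int)) :
  0 < d -> d < x -> d < y -> uniq Y ->
  separated d [seq (x * p.1%:~R - a, y * p.2%:~R - b) | p <- Y].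
Proof.
move=> d0 dx dy uY.
have far (z e : R) (i j : int) : d < z -> i != j ->
    d ^+ 2 < (z * i%:~R - e - (z * j%:~R - e)) ^+ 2.
  move=> dz ij.
  have -> : z * i%:~R - e - (z * j%:~R - e) = z * (i - j)%:~R by rewrite intrB; ring.
  have h : 1 <= `|(i - j)%:~R : R|.
    by rewrite -intr_norm ler1z; move/eqP: ij; lia.
  rewrite exprMn -[X in _ < _ * X]real_normK ?num_real//.
  have h2 : 1 <= `|(i - j)%:~R : R| ^+ 2 by rewrite expr_ge1.
  have h3 : d ^+ 2 < z ^+ 2 by rewrite ltrXn2r ?nnegrE//; lra.
  by have := sqr_ge0 z; nra.
have main p q : p != q -> d ^+ 2 < (x * p.1%:~R - a - (x * q.1%:~R - a)) ^+ 2 +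
    (y * p.2%:~R - b - (y * q.2%:~R - b)) ^+ 2.
  case: p q => [p1 p2] [q1 q2] /=; rewrite xpair_eqE negb_and => /orP[h|h].
    by rewrite ltr_wpDr ?sqr_ge0// far.
  by rewrite ltr_wpDl ?sqr_ge0// far.
split.
  rewrite map_inj_uniq// => p q [E1 E2]; apply/eqP; apply: contraT => /main.
  by rewrite E1 E2 !subrr expr0n addr0 ltNge sqr_ge0.
move=> _ _ /mapP[p pY ->] /mapP[q qY ->] /= pq; apply: main.
by apply: contra_neq pq => ->.
Qed.

Section Windows.
Variables (N : nat) (g : 'I_N -> R -> R[i]) (L : 'I_N -> set (R * R)) (eta : R).
Hypotheses (Lg : forall n, L2 (g n)) (uL : forall n, unif_discrete (L n))
  (eta_gt0 : 0 < eta) (eta_lt : eta < 2^-1).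
Let len : R := 1 - 2 * eta.

Lemma L2_gabor k : L2 (gabor_family g k).
Proof. exact: L2_tfshift. Qed.

Lemma common_tail (d e : R) : 0 < d -> d <= 1 -> 0 < e ->
  exists2 r : R, 0 < r & forall n Y, separated d Y ->
    (forall w, w \in Y -> ~ square 0 0 r w) ->
    \sum_(w <- Y) ip_abs2 (g n) (tfshift window w.1 w.2) <= e.
Proof.
move=> d0 d1 e0.
have [||r r0 rP] := @common_radius R N (fun n r => forall Y, separated d Y ->
    (forall w, w \in Y -> ~ square 0 0 r w) ->
    \sum_(w <- Y) ip_abs2 (g n) (tfshift window w.1 w.2) <= e).
- by move=> n; exact: homogeneous_approximation.
- move=> n r r' rr' H Y sY Yr; apply: H => // w wY [w1 w2].
  by apply: (Yr w wY); split; apply: le_trans rr'.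
by exists r => // n; exact: rP.
Qed.

(** The Gabor system is the Riesz side and the lattice of steps [len] and 1 the frame side. The
    right-hand side bounds the number of lattice points in the enlarged square. *)
Lemma riesz_count : riesz_seq (gabor_index L) (gabor_family g) ->
  exists2 r : R, 0 < r & forall a b S, 0 <= S ->
    count_sq L a b S * (1 - eta) <= (2 * (S + r) / len + 1) * (2 * (S + r) + 1).
Proof.
move=> [A [B [A0 B0 riesz]]].
have [eta0 eta2] := (eta_gt0, eta_lt).
have l0 : 0 < len := len_gt0 eta_lt.
have k0 := kappa_gt0 eta_gt0; set kap := (X in 0 < X) in k0.
have [d [d0 d1 sep]] := unif_discrete_common uL.
(* A tail equal to [eta] times the product of the two bounds becomes the factor 1 - eta. *)
have e0 : 0 < A * kap * eta by rewrite !mulr_gt0.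
have len1 : len <= 1 by rewrite /len; lra.
(* The lattice steps are [len] and 1, both larger than len/2. *)
have [||r r0 tail] := @common_tail (len / 2) (A * kap * eta) _ _ e0; try lra.
exists r => // a b S S0.
have Sr : 0 <= S + r by lra.
have [s1 [size1 cov1]] := lattice_cover a l0 Sr.
have [s2 [size2 cov2]] := lattice_cover b ltr01 Sr.
pose K0 := [seq (i, j) | i <- s1, j <- s2].
have cmp := @riesz_frame_comparison_seq _ (points L a b S) (gabor_family g)
  _ [set: int * int] (fun p => tfshift window (len * p.1%:~R) p.2%:~R) K0 A kap
  (A * kap * eta) (points_uniq L a b S) L2_gabor
  (fun p => L2_tfshift _ _ (L2_window R)) A0 k0.
have {}cmp : A * kap * ((size (points L a b S))%:R - (size K0)%:R) <=
    A * kap * eta * (size (points L a b S))%:R.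
  apply: cmp.
  - move=> c; have /andP[H _] := riesz (points L a b S) c (points_uniq L a b S)
      (fun k kP => ltac:(by rewrite inE; have [] := (mem_points d0 d1 sep _ _ _ _).1 kP)).
    exact: H.
  - by move=> h Lh; exact: lattice_frame_lower.
  move=> [n lam] /(mem_points d0 d1 sep) [_ [/= la1 la2]].
  apply: esum_le_uniq => Y uY YK.
  have -> : \sum_(p <- Y) ip_abs2 (gabor_family g (n, lam))
        (tfshift window (len * p.1%:~R) p.2%:~R) =
      \sum_(w <- [seq (len * p.1%:~R - lam.1, 1 * p.2%:~R - lam.2) | p <- Y])
        ip_abs2 (g n) (tfshift window w.1 w.2).
    rewrite big_map; apply: eq_bigr => p _.
    by rewrite /gabor_family /= ip_tfshift ?mul1r//; exact: L2_window.
  apply: tail; first by apply: lattice_separated => //; lra.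
  (* A re-centred lattice point within [r] of the origin comes from one within S + r of (a, b),
     which is in [K0]. *)
  move=> w /mapP[p /YK]; rewrite inE /= => -[_ pK] -> [/=]; rewrite !subr0 => w1 w2.
  apply: pK; apply/allpairsP; exists p; split; last by case: p {w1 w2}.
  - apply: cov1; have := ler_distD lam.1 (len * p.1%:~R) a; lra.
  - apply: cov2; have := ler_distD lam.2 (1 * p.2%:~R) b; lra.
rewrite -size_points.
have A1 : 0 < A * kap by rewrite mulr_gt0.
have {}cmp : (size (points L a b S))%:R * (1 - eta) <= (size K0)%:R :> R.
  by rewrite -(ler_pM2l A1); lra.
apply: le_trans cmp _; rewrite size_allpairs natrM divr1 in size2 *.
by apply: ler_pM.
Qed.

(** The roles are exchanged: the lattice of steps 1 and 1/len is the Riesz side and the Gabor system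
    the frame side. The condition on 2 S len keeps both factors of the lattice count nonnegative. *)
Lemma frame_count : frame (gabor_index L) (gabor_family g) ->
  exists2 r : R, 0 < r & forall a b S, 0 <= S -> 1 <= 2 * S * len ->
    (2 * S - 1) * (2 * S * len - 1) * (1 - eta) <= count_sq L a b (S + r).
Proof.
move=> [A [B [A0 B0 fr]]].
have [eta0 eta2] := (eta_gt0, eta_lt).
have l0 : 0 < len := len_gt0 eta_lt.
have k0 := kappa_gt0 eta_gt0; set kap := (X in 0 < X) in k0.
have [d [d0 d1 sep]] := unif_discrete_common uL.
have kl0 : 0 < kap * len by rewrite mulr_gt0.
(* The tail budget is shared among the N functions; [N.+1] avoids division by zero. *)
have e0 : 0 < kap * len * A * eta / N.+1%:R by rewrite divr_gt0 ?mulr_gt0.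
have len1 : len <= 1 by rewrite /len; lra.
have [r r0 tail] := common_tail d0 d1 e0.
exists r => // a b S S0 Sl.
have li0 : 0 < len^-1 by rewrite invr_gt0.
have [s1 [us1 size1 in1]] := lattice_inner a ltr01 S0.
have [s2 [us2 size2 in2]] := lattice_inner b li0 S0.
rewrite invrK divr1 in size1 size2.
pose s := [seq (i, j) | i <- s1, j <- s2].
have us : uniq s by apply: allpairs_uniq => // -[? ?] [? ?].
have cmp := @riesz_frame_comparison_seq _ s
  (fun p => tfshift window p.1%:~R (p.2%:~R / len))
  _ (gabor_index L) (gabor_family g) (points L a b (S + r)) (kap * len) A
  (kap * len * A * eta) us (fun p => L2_tfshift _ _ (L2_window R)) L2_gabor kl0 A0.
have {}cmp : kap * len * A * ((size s)%:R - (size (points L a b (S + r)))%:R) <=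
    kap * len * A * eta * (size s)%:R.
  apply: cmp.
  - by move=> c; exact: lattice_riesz_lower.
  - by move=> h Lh; have [] := fr h Lh.
  move=> z zs; apply: esum_le_uniq => Y uY YK.
  have [z1 z2] : `|z.1%:~R - a| <= S /\ `|z.2%:~R / len - b| <= S.
    have /allpairsP[p [p1 p2 ->]] := zs; split => /=.
      by have := in1 _ p1; rewrite mul1r.
    by have := in2 _ p2; rewrite mulrC.
  (* Separation holds only within one set [L n], so the tail is split by [n] before re-centring. *)
  rewrite (partition_big (fun k : 'I_N * (R * R) => k.1) predT)//=.
  apply: (@le_trans _ _ (\sum_(n < N) kap * len * A * eta / N.+1%:R)).
    apply: ler_sum => n _.
    pose Z := [seq (z.1%:~R - k.2.1, z.2%:~R / len - k.2.2) | k <- Y & k.1 == n].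
    have -> : \sum_(k <- Y | k.1 == n) ip_abs2 (tfshift window z.1%:~R (z.2%:~R / len))
          (gabor_family g k) =
        \sum_(w <- Z) ip_abs2 (g n) (tfshift window w.1 w.2).
      rewrite big_map big_filter; apply: eq_bigr => k /eqP <-.
      rewrite ip_abs2C ?ip_tfshift//; try exact: L2_window.
      - exact: L2_gabor.
      - by apply: L2_tfshift; exact: L2_window.
    have YL k : k \in Y -> L k.1 k.2 /\ k \notin points L a b (S + r).
      by move=> /YK; rewrite inE /= => -[Lk /negP kp].
    apply: tail; [split|].
    - rewrite map_inj_in_uniq ?filter_uniq//.
      move=> [k p] [l q]; rewrite !mem_filter /= => /andP[/eqP -> _] /andP[/eqP -> _].
      move=> [/addrI/oppr_inj E1 /addrI/oppr_inj E2]; congr (_, _).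
      by case: p q E1 E2 => ? ? [? ?] /= -> ->.
    - move=> _ _ /mapP[[k p] kY ->] /mapP[[l q] lY ->] /= pq.
      move: kY lY; rewrite !mem_filter /= => /andP[/eqP kn /YL [/= Lk _]]
        /andP[/eqP ln /YL [/= Ll _]].
      rewrite kn in Lk; rewrite ln in Ll.
      have pq' : p <> q by move=> E; rewrite E eqxx in pq.
      have := sep _ _ _ Lk Ll pq'.
      set lhs := (X in _ < X); set rhs := (X in _ -> _ < X).
      by have -> : rhs = lhs by rewrite /lhs /rhs; ring.
    move=> _ /mapP[k kY ->] [/=]; rewrite !subr0 => w1 w2.
    move: kY; rewrite mem_filter => /andP[_ /YL [Lk /negP]]; apply.
    apply/(mem_points d0 d1 sep); split=> //; split.
    - have := ler_distD z.1%:~R k.2.1 a; rewrite (distrC k.2.1 z.1%:~R); lra.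
    - have := ler_distD (z.2%:~R / len) k.2.2 b; rewrite (distrC k.2.2 (z.2%:~R / len)); lra.
  rewrite sumr_const card_ord -[_ *+ N]mulr_natr -mulrA ler_piMr//.
    by rewrite !mulr_ge0// ltW.
  by rewrite mulrC ler_pdivrMr// mul1r ler_nat.
rewrite -size_points.
have A1 : 0 < kap * len * A by rewrite mulr_gt0.
have {}cmp : (size s)%:R * (1 - eta) <= (size (points L a b (S + r)))%:R :> R.
  by rewrite -(ler_pM2l A1); lra.
apply: le_trans cmp; apply: ler_wpM2r; first lra.
rewrite size_allpairs natrM.
have S1 : 1 <= 2 * S by nra.
by apply: ler_pM => //; lra.
Qed.

End Windows.
End DensityBounds.

(** * Absorbing the margins into the density bounds *)

Section LimitComparison.
Variable R : realType.

Lemma upper_density_arith (c S r eta delta : R) : 0 < eta -> 12 * eta <= 1 ->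
  12 * eta <= delta -> 0 < r -> r + 1 <= S * eta -> 0 <= c ->
  c * (1 - eta) <= (2 * (S + r) / (1 - 2 * eta) + 1) * (2 * (S + r) + 1) ->
  c <= (1 + delta) * (2 * S) ^+ 2.
Proof.
move=> e0 e1 ed r0 rS c0; set l := 1 - 2 * eta => H.
have l0 : 0 < l by rewrite /l; lra.
have S0 : 0 < S by nra.
(* The hypothesis r + 1 <= S eta absorbs both the radius and the boundary term into the factor 1 +
   eta. *)
pose X := 2 * (S + r) + 1; pose Z := 2 * S * (1 + eta).
have X0 : 0 <= X by rewrite /X; lra.
have XZ : X <= Z by rewrite /X /Z; lra.
have H1 : c * (1 - eta) * l <= X * X.
  have h := ler_wpM2r (ltW l0) H.
  have E : (2 * (S + r) / l + 1) * X * l = (2 * (S + r) + l) * X.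
    by field; rewrite gt_eqF.
  apply: le_trans h _; rewrite -/X E.
  by apply: ler_wpM2r => //; rewrite /X /l; lra.
have H2 : X * X <= Z * Z by apply: ler_pM.
have H3 : c * (1 - 3 * eta) <= c * (1 - eta) * l.
  by rewrite -mulrA; apply: ler_wpM2l => //; rewrite /l; nra.
have T0 : 0 <= (2 * S) ^+ 2 by rewrite sqr_ge0.
have H4 : Z * Z <= (2 * S) ^+ 2 * (1 + 3 * eta).
  have -> : Z * Z = (2 * S) ^+ 2 * (1 + eta) ^+ 2 by rewrite /Z; ring.
  by apply: ler_wpM2l => //; nra.
have m0 : 0 < 1 - 3 * eta by lra.
rewrite -(ler_pM2r m0); apply: le_trans H3 _; apply: le_trans H1 _.
apply: le_trans H2 _; apply: le_trans H4 _.
rewrite (mulrC (1 + delta)) -[leRHS]mulrA; apply: ler_wpM2l => //.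
(* Origin of the 12: 1 + 3 eta <= (1 + 12 eta)(1 - 3 eta) as long as eta <= 1/6. *)
have : (1 + 12 * eta) * (1 - 3 * eta) <= (1 + delta) * (1 - 3 * eta).
  by apply: ler_wpM2r; lra.
nra.
Qed.

Lemma lower_density_arith (c T r eta delta : R) : 0 < eta -> 12 * eta <= 1 ->
  12 * eta <= delta -> 0 < r -> 2 * r + 1 <= eta * T ->
  (2 * (T - r) - 1) * (2 * (T - r) * (1 - 2 * eta) - 1) * (1 - eta) <= c ->
  (1 - delta) * (2 * T) ^+ 2 <= c.
Proof.
move=> e0 e1 ed r0 rT H.
have T0 : 0 < T by nra.
have h1 : 2 * T * (1 - eta) <= 2 * (T - r) - 1 by lra.
have h2 : 2 * T * (1 - 3 * eta) <= 2 * (T - r) * (1 - 2 * eta) - 1.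
  have : 0 <= r * eta by apply: mulr_ge0; lra.
  lra.
have p1 : 0 <= 2 * T * (1 - eta) by apply: mulr_ge0; lra.
have p2 : 0 <= 2 * T * (1 - 3 * eta) by apply: mulr_ge0; lra.
have h3 := ler_pM p1 p2 h1 h2.
apply: le_trans H; have e2 : 0 <= 1 - eta by lra.
apply: le_trans (ler_wpM2r e2 h3).
have -> : 2 * T * (1 - eta) * (2 * T * (1 - 3 * eta)) * (1 - eta) =
  (1 - eta) * (1 - 3 * eta) * (1 - eta) * (2 * T) ^+ 2 by ring.
apply: ler_wpM2r; first exact: sqr_ge0.
(* To first order (1 - eta)^2 (1 - 3 eta) is 1 - 5 eta, and the remainder 7 eta^2 - 3 eta^3 is
   nonnegative. *)
by apply: (@le_trans _ _ (1 - 5 * eta)); [lra|nra].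
Qed.

Lemma small_parameter (delta : R) : 0 < delta -> exists eta : R,
  [/\ 0 < eta, 12 * eta <= 1, 12 * eta <= delta & eta < 2^-1].
Proof.
move=> d0; have [h|h] := leP delta 1.
  by exists (delta / 12); split; lra.
by exists (1 / 12); split; lra.
Qed.

End LimitComparison.

Unset Implicit Arguments.

Theorem theoremA (R : realType) (N : nat) (g : 'I_N -> R -> R[i])
    (L : 'I_N -> set (R * R)) :
  (forall n, L2 (g n)) ->
  (forall n m : 'I_N, n <> m ->
     ~ {ae (@lebesgue_measure R), forall x, g n x = g m x}) ->
  (forall n, unif_discrete (L n)) ->
  (riesz_seq (gabor_index L) (gabor_family g) -> Dplus L <= 1) /\
  (frame (gabor_index L) (gabor_family g) -> 1 <= Dminus L).
Proof.
move=> Lg _ uL; split=> [riesz|fr].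
  rewrite /Dplus; set F := (X in lim (X @ _)).
  (* Without convergence [lim] takes its default value 0, which is at most 1. *)
  have [cF|/dvgP ->] := pselect (cvg (F r @[r --> +oo])); last exact: ler01.
  apply/ler_addgt0Pr => delta d0; apply: limr_le => //.
  have [eta [e0 e12 ed e2]] := small_parameter d0.
  have [r r0 H] := riesz_count Lg uL e0 e2 riesz.
  exists ((r + 1) / eta); split; first exact: num_real.
  move=> S; rewrite ltr_pdivrMr// => rS.
  have S0 : 0 < S by nra.
  rewrite /F ler_pdivrMr ?exprn_gt0 ?mulr_gt0//.
  apply: ge_sup; first by exists (count_sq L 0 0 S), (0, 0).
  move=> _ [[a b] _ <-] /=.
  apply: (upper_density_arith e0 e12 ed r0 (ltW rS)) => //.
  by apply: H; exact: ltW.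
have [d [d0 d1 sep]] := unif_discrete_common uL.
have [C C0 bound] := count_sq_bound d0 d1 sep.
(* Here the default value would not do: [limr_ge] needs an actual limit. *)
have cF : cvg (min_count L r / (2 * r) ^+ 2 @[r --> +oo]).
  apply: (@cvg_superadditive _ _ C).
  - exact: min_count_ge0.
  - by move=> r S k; exact: (min_count_super d0 d1 sep).
  - by move=> r r1; apply: le_trans (min_count_le L 0 0 r) _; exact: bound.
apply/ler_addgt0Pr => delta dl0; rewrite -lerBlDr; apply: limr_ge => //.
have [eta [e0 e12 ed e2]] := small_parameter dl0.
have [r r0 H] := frame_count Lg uL e0 e2 fr.
exists ((2 * r + 1) / eta); split; first exact: num_real.
move=> T; rewrite ltr_pdivrMr// => rT.
have T0 : 0 < T by nra.
rewrite ler_pdivlMr ?exprn_gt0 ?mulr_gt0//.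
apply: le_min_count => a b.
apply: (@lower_density_arith _ _ _ r _ _ e0 e12 ed r0); first by rewrite [leRHS]mulrC ltW.
have eT : eta * T < T by rewrite gtr_pMl//; lra.
have rT2 : 0 <= T - 2 * r - 1 by lra.
(* The inner radius T - r makes the outer one exactly T. *)
have := H a b (T - r); rewrite subrK; apply; [lra|nra].
Qed.
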